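(* Let $V=(V(t))_{t\ge 0}$ be a centered homogeneous random process with independent increments, defined on a probability space $(\Omega,\mathfrak{A},{\bf P})$, such that $V(0)=0$ and ${\bf E}(V(1))^2=\sigma^2<\infty$, $\sigma\ge 0$. For $t>0$ let $X_t(x)=\frac{1}{\sqrt{t}}V(tx)$, $x\in[0,1]$. Let $(s_n)_{n\ge1}$ be a sequence of positive numbers such that for some $\beta>0$ the sequence $s_n/n^{\beta}$ is increasing. For $n\ge 2$ and $\omega\in\Omega$ let $$ Q_n(\omega)=\frac{1}{\ln n}\sum_{k=1}^{n}\frac{1}{k}\,\delta_{X_{s_k}(\omega)} . $$ Then, for almost all $\omega\in\Omega$, $$ Q_n(\omega)\stackrel{w}{\to}\mu_{\sigma W}\qquad\text{as } n\to\infty , $$ in the Skorohod space $D[0,1]$, where $W$ is the standard Wiener process and $\mu_{\sigma W}$ is the distribution of $\sigma W$.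
   Context: ''Homogeneous'' means that the increments are stationary: the law of $V(t+h)-V(t)$ depends only on $h$. ''Centered'' means ${\bf E}V(t)=0$ for all $t\ge0$. Almost all sample paths of $V$ are right-continuous with left limits, so that almost all sample paths of $X_t$ belong to $D[0,1]$, the space of real functions on $[0,1]$ that are right-continuous with left limits; $D[0,1]$ carries Skorohod's $J_1$-topology and its Borel $\sigma$-algebra. $X_{s_k}(\omega)\in D[0,1]$ is the sample path of $X_{s_k}$ at $\omega$. $\delta_z$ is the unit mass concentrated at the point $z$, and $\stackrel{w}{\to}$ denotes weak convergence of finite measures (convergence of integrals of all bounded continuous functions). *)

(* Defs.v *)
From HB Require Import structures.
From mathcomp Require Import all_boot all_order all_algebra.
From mathcomp Require Import all_classical all_reals all_analysis.

Set Implicit Arguments.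
Unset Strict Implicit.
Unset Printing Implicit Defensive.

Import Order.TTheory GRing.Theory Num.Theory.
Import numFieldNormedType.Exports.

Local Open Scope classical_set_scope.
Local Open Scope ring_scope.

(** * Right-continuous functions with left limits *)

(** Both one-sided limits are taken within [A].  When no point of [A] lies on
    the relevant side of [x] near [x], the filter contains the empty set and the
    requirement is vacuous: no condition is imposed from the right at [1] for
    [A = `[0, 1]], nor from the left at [0]. *)
Definition cadlag (R : realType) (A : set R) (f : R -> R) : Prop :=
  forall x, A x ->
    f y @[y --> within A x^'+] --> f x /\
    exists l : R, f y @[y --> within A x^'-] --> l.

Lemma cadlagMl (R : realType) (A : set R) (c : R) (f : R -> R) :
  cadlag A f -> cadlag A (fun x => c * f x).
Proof.
move=> fA x /fA[fr [l fl]]; split; first exact: cvgM (cvg_cst _) fr.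
by exists (c * l); exact: cvgM (cvg_cst _) fl.
Qed.

Lemma cadlag_cst (R : realType) (A : set R) (c : R) : cadlag A (cst c).
Proof. by move=> x _; split; [|exists c]; exact: cvg_cst. Qed.

Lemma eq_cadlag (R : realType) (A : set R) (f g : R -> R) :
  {in A, f =1 g} -> cadlag A f -> cadlag A g.
Proof.
move=> fg fA x Ax; have [fr [l fl]] := fA x Ax.
have E (F : set_system R) : Filter F ->
    \forall y \near within A F, f y = g y.
  by move=> FF; rewrite near_withinE; apply: nearW => y Ay; rewrite fg ?inE.
split; last by exists l; apply: cvg_trans fl; apply: near_eq_cvg; exact: E.
rewrite -fg ?inE//; apply: cvg_trans fr; apply: near_eq_cvg; exact: E.
Qed.

(** * The Skorohod space D[0,1] *)

(** A real function on [0,1] is encoded by its extension by [0] to the line, so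
    that Leibniz equality is equality on [0,1]. *)
Record skorohod (R : realType) := Skorohod {
  skorohod_fun :> R -> R ;
  skorohod_cadlag : cadlag `[0, 1]%classic skorohod_fun ;
  skorohod_out : forall x, x \notin `[0, 1] -> skorohod_fun x = 0
}.

Definition skorohod0 (R : realType) : skorohod R :=
  @Skorohod R (cst 0) (@cadlag_cst R _ 0) (fun _ _ => erefl).

HB.instance Definition _ (R : realType) := gen_eqMixin (skorohod R).
HB.instance Definition _ (R : realType) := gen_choiceMixin (skorohod R).
HB.instance Definition _ (R : realType) :=
  isPointed.Build (skorohod R) (skorohod0 R).

Definition time_change (R : realType) (lam : R -> R) : Prop :=
  [/\ {in `[0, 1] &, {homo lam : x y / x < y}},
      set_bij `[0, 1]%classic `[0, 1]%classic lam &
      {within `[0, 1], continuous lam}].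

(** [J1_ball f e g] says that the Skorohod distance
    inf_lam max (sup_x |lam x - x|) (sup_x |f (lam x) - g x|)
    is less than [e]. *)
Definition J1_ball (R : realType) (f : skorohod R) (e : R) (g : skorohod R) :
    Prop :=
  exists lam r, [/\ time_change lam, r < e,
    forall x, x \in `[0, 1] -> `|lam x - x| <= r &
    forall x, x \in `[0, 1] -> `|f (lam x) - g x| <= r].

Section J1_topology.
Context {R : realType}.
Implicit Types (lam : R -> R) (f g h : skorohod R).

Lemma time_change_id : time_change (@id R).
Proof.
split=> //; last by apply: continuous_subspaceT => x; exact: cvg_id.
by split=> [x//|x y _ _|x xI]; [|exists x].
Qed.

Lemma time_change_mem lam x : time_change lam ->
  x \in `[0, 1] -> lam x \in `[0, 1].
Proof. by move=> [_ [h _ _] _] xI; exact: h. Qed.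

Lemma time_change_ends lam : time_change lam -> lam 0 = 0 /\ lam 1 = 1.
Proof.
move=> lamP; have [lt [_ _ surj] _] := lamP.
have I0 : 0 \in `[0, 1 : R] by rewrite in_itv/= lexx ler01.
have I1 : 1 \in `[0, 1 : R] by rewrite in_itv/= lexx ler01.
have le x y : x \in `[0, 1] -> y \in `[0, 1] -> x <= y -> lam x <= lam y.
  by move=> xI yI; rewrite le_eqVlt => /predU1P[->//|/lt/ltW]; exact.
split; apply/eqP; rewrite eq_le.
  have [x xI x0] := surj _ I0.
  have := time_change_mem lamP I0; rewrite in_itv/= => /andP[-> _].
  rewrite andbT -[leRHS]x0 le//.
  by move: xI; rewrite /= in_itv/= => /andP[].
have [x xI x1] := surj _ I1.
have := time_change_mem lamP I1; rewrite in_itv/= => /andP[_ ->]/=.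
rewrite -[leLHS]x1 le//.
by move: xI; rewrite /= in_itv/= => /andP[].
Qed.

Lemma time_changeI lam :
  {in `[0, 1] &, {homo lam : x y / x < y}} ->
  set_bij `[0, 1]%classic `[0, 1]%classic lam -> lam 0 = 0 -> lam 1 = 1 ->
  time_change lam.
Proof.
move=> lt bij l0 l1; split=> //.
apply: segment_inc_surj_continuous; last by rewrite l0 l1; case: bij.
by apply: le_mono_in => x y xI yI; exact: lt.
Qed.

Lemma time_change_comp lam mu :
  time_change lam -> time_change mu -> time_change (lam \o mu).
Proof.
move=> lamP muP.
have [[llt lb _] [mlt mb _]] := (lamP, muP).
have [[l0 l1] [m0 m1]] := (time_change_ends lamP, time_change_ends muP).
apply: time_changeI; rewrite /= ?m0 ?m1//.
- by move=> x y xI yI xy; apply: llt; rewrite ?time_change_mem//; exact: mlt.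
- exact: set_bij_comp mb lb.
Qed.

Lemma time_change_inv lam : time_change lam ->
  exists2 mu, time_change mu & forall x, x \in `[0, 1] -> lam (mu x) = x.
Proof.
move=> lamP; have [lt [_ inj surj] _] := lamP.
have [l0 l1] := time_change_ends lamP.
have /choice[mu muP] : forall x, exists y,
    x \in `[0, 1] -> y \in `[0, 1] /\ lam y = x.
  move=> x; have [xI|_] := boolP (x \in `[0, 1]); last by exists 0.
  by have [y yI yx] := surj _ xI; exists y.
have I0 : 0 \in `[0, 1 : R] by rewrite in_itv/= lexx ler01.
have I1 : 1 \in `[0, 1 : R] by rewrite in_itv/= lexx ler01.
have muK x : x \in `[0, 1] -> mu (lam x) = x.
  move=> xI; have lI := time_change_mem lamP xI.
  by apply: inj; rewrite ?inE/=; [case: (muP _ lI)|exact: xI|case: (muP _ lI)].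
exists mu; last by move=> x /muP[].
apply: time_changeI.
- move=> x y xI yI xy; rewrite ltNge; apply/negP.
  rewrite le_eqVlt => /predU1P[yx|].
    by move: xy; rewrite -(muP _ xI).2 -(muP _ yI).2 yx ltxx.
  move=> /lt; rewrite (muP _ xI).2 (muP _ yI).2 => /(_ (muP _ yI).1 (muP _ xI).1).
  by move=> /(lt_trans xy); rewrite ltxx.
- split=> [x /muP[]//|x y|x xI].
    rewrite !inE => xI yI xy.
    by rewrite -(muP _ xI).2 -(muP _ yI).2 xy.
  by exists (lam x); [exact: time_change_mem|exact: muK].
- by rewrite -[X in mu X]l0 muK.
- by rewrite -[X in mu X]l1 muK.
Qed.

Lemma J1_ball_center f e : 0 < e -> J1_ball f e f.
Proof.
move=> e0; exists id, 0; split=> //; first exact: time_change_id.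
  by move=> x _; rewrite subrr normr0.
by move=> x _; rewrite subrr normr0.
Qed.

Lemma J1_ball_sym f g e : J1_ball f e g -> J1_ball g e f.
Proof.
move=> [lam [r [lamP re lamr fgr]]].
have [mu muP muK] := time_change_inv lamP.
exists mu, r; split=> // x xI; have mI := time_change_mem muP xI.
  by have := lamr _ mI; rewrite muK// distrC.
by have := fgr _ mI; rewrite muK// distrC.
Qed.

Lemma J1_ball_triangle f g h e1 e2 :
  J1_ball f e1 g -> J1_ball g e2 h -> J1_ball f (e1 + e2) h.
Proof.
move=> [lam [r [lamP re lamr fgr]]] [mu [q [muP qe muq ghq]]].
exists (lam \o mu), (r + q).
split=> [||x xI|x xI]; [exact: time_change_comp|exact: ltrD| |];
  have mI := time_change_mem muP xI.
  by rewrite (le_trans (ler_distD (mu x) _ _))// lerD// ?lamr ?muq.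
by rewrite (le_trans (ler_distD (g (mu x)) _ _))// lerD// ?fgr ?ghq.
Qed.

HB.instance Definition _ := hasNbhs.Build (skorohod R)
  (nbhs_ (entourage_ (@J1_ball R))).
HB.instance Definition _ := @Nbhs_isPseudoMetric.Build R (skorohod R)
  (entourage_ (@J1_ball R)) erefl (@J1_ball R)
  J1_ball_center J1_ball_sym J1_ball_triangle erefl.

End J1_topology.

Lemma cadlag_restrict (R : realType) (f : R -> R) :
  cadlag `[0, 1]%classic f -> cadlag `[0, 1]%classic (f \_ `[0, 1]%classic).
Proof. by apply: eq_cadlag => x xI; rewrite patchE xI. Qed.

Lemma restrict_out (R : realType) (f : R -> R) x :
  x \notin `[0, 1] -> (f \_ `[0, 1]%classic) x = 0.
Proof. by move=> xI; rewrite patchE mem_setE (negbTE xI). Qed.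

(** Functions that are not càdlàg on [0,1] are sent to [0]. *)
Definition to_skorohod (R : realType) (f : R -> R) : skorohod R :=
  if pselect (cadlag `[0, 1]%classic f) is left fP then
    Skorohod (cadlag_restrict fP) (@restrict_out R f)
  else skorohod0 R.

Lemma scale_out (R : realType) (c : R) (f : skorohod R) x :
  x \notin `[0, 1] -> c * f x = 0.
Proof. by move=> xI; rewrite skorohod_out// mulr0. Qed.

(** * Borel measures and weak convergence *)

Definition borel (T : ptopologicalType) : Type := g_sigma_algebraType (@open T).

HB.instance Definition _ (T : ptopologicalType) := Measurable.on (borel T).

Definition weak_cvg (R : realType) (T : ptopologicalType)
    (mu_ : nat -> {measure set (borel T) -> \bar R})
    (mu : {measure set (borel T) -> \bar R}) : Prop :=
  forall F : T -> R, continuous F -> (exists M, forall x, `|F x| <= M) ->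
    (\int[mu_ n]_x (F x)%:E @[n --> \oo] --> \int[mu]_x (F x)%:E)%E.

Definition skorohod_scale (R : realType) (c : R) (f : borel (skorohod R)) :
    borel (skorohod R) :=
  Skorohod (cadlagMl c (@skorohod_cadlag R f)) (@scale_out R c f).

Section scale_measurable.
Context {R : realType} (c : R).

Lemma continuous_skorohod_scale :
  continuous (@skorohod_scale R c : skorohod R -> skorohod R).
Proof.
move=> f; apply/(@cvg_ballP R (skorohod R) (skorohod R) (nbhs f)) => e e0.
have c0 : 0 < `|c| + 1 by rewrite ltr_wpDl.
have m0 : 0 < Num.min e (e / (`|c| + 1)) by rewrite lt_min e0 divr_gt0.
have := @nbhsx_ballx R (skorohod R) f _ m0.
apply: (@filterS _ (nbhs (f : skorohod R))) => g.
move=> [lam [r [lamP re lamr fgr]]].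
have r0 : 0 <= r.
  by apply: le_trans (lamr 0 _); rewrite ?normr_ge0// in_itv/= lexx ler01.
move: re; rewrite lt_min => /andP[re]; rewrite ltr_pdivlMr// => rce.
exists lam, (r * (`|c| + 1) : R); split=> // x xI.
  by rewrite (le_trans (lamr _ xI))// ler_peMr// lerDr.
rewrite /= -mulrBr normrM mulrC ler_pM//; first exact: fgr.
by rewrite lerDl.
Qed.

Lemma measurable_skorohod_scale : measurable_fun setT (@skorohod_scale R c).
Proof.
apply: (@measurability _ _ (borel (skorohod R)) (borel (skorohod R)) setT _
  (@open (skorohod R))) => //.
move=> _ [B oB <-]; rewrite setTI; apply: sub_sigma_algebra.
by apply: open_comp => // x _; exact: continuous_skorohod_scale.
Qed.

HB.instance Definition _ := @isMeasurableFun.Build _ _ _ _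
  (@skorohod_scale R c) measurable_skorohod_scale.

End scale_measurable.

(** * Processes with independent increments *)

Section processes.
Context {R : realType} {d : measure_display} {T : measurableType d}.
Variable P : probability T R.

(** Subfamilies are covered by taking [A i = setT] for the other indices. *)
Definition mutually_independent (n : nat) (X : 'I_n -> T -> R) : Prop :=
  forall A : 'I_n -> set R, (forall i, measurable (A i)) ->
    P (\bigcap_i (X i @^-1` A i)) = (\prod_(i < n) P (X i @^-1` A i))%E.

(** [D] is the time set; the values of [X] at times outside [D] are
    irrelevant. *)
Definition independent_increments (D : set R) (X : R -> T -> R) : Prop :=
  forall (n : nat) (t : nat -> R),
    (forall i, (i <= n)%N -> D (t i)) ->
    (forall i, (i < n)%N -> t i <= t i.+1) ->
    mutually_independent (fun i : 'I_n => X (t i.+1) \- X (t i)).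

Definition homogeneous (X : R -> T -> R) : Prop :=
  forall t t' h : R, 0 <= t -> 0 <= t' -> 0 <= h ->
  forall A : set R, measurable A ->
    pushforward P (X (t + h) \- X t) A = pushforward P (X (t' + h) \- X t') A.

Definition centered (X : R -> T -> R) : Prop :=
  forall t : R, 0 <= t ->
    P.-integrable setT (EFin \o X t) /\ ('E_P[X t] = 0)%E.

(** A random element of D[0,1], so that its distribution is a Borel measure
    there. *)
Definition standard_wiener (W : {mfun T >-> borel (skorohod R)}) : Prop :=
  let X (t : R) (w : T) : R := (W w : skorohod R) t in
  [/\ {ae P, forall w, X 0 w = 0},
      {ae P, forall w, {within `[0, 1], continuous (X ^~ w)}},
      independent_increments `[0, 1]%classic X &
      forall t u : R, 0 <= t -> t < u -> u <= 1 ->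
      forall A : set R, measurable A ->
        pushforward P (X u \- X t) A = normal_prob 0 (Num.sqrt (u - t)) A].

End processes.

(** * The rescaled paths and their logarithmic averages *)

Definition rescaled (R : realType) (T : Type) (V : R -> T -> R) (t : R)
    (w : T) : borel (skorohod R) :=
  to_skorohod (fun x => (Num.sqrt t)^-1 * V (t * x) w).

Lemma inv_ln_nat_ge0 (R : realType) (n : nat) : 0 <= (ln n%:R : R)^-1.
Proof.
rewrite invr_ge0; case: n => [|n]; first by rewrite ln0.
by rewrite ln_ge0// ler1n.
Qed.

(** The [k]-th summand, [k < n], is the one of index [k.+1] in
    (ln n)^-1 * \sum_(1 <= k <= n) k^-1 * delta_(X_(s k)). *)
Definition log_average (R : realType) (T : Type) (V : R -> T -> R)
    (s : nat -> R) (n : nat) (w : T) :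
    {measure set (borel (skorohod R)) -> \bar R} :=
  mscale (NngNum (inv_ln_nat_ge0 R n))
    (msum (fun k => mscale (k.+1%:R^-1)%:nng (dirac (rescaled V (s k.+1) w)))
      n).

(* Main.v *)
Require Import Defs.
From HB Require Import structures.
From mathcomp Require Import all_boot all_order all_algebra.
From mathcomp Require Import all_classical all_reals all_analysis.
From mathcomp Require Import measurable_realfun.
From mathcomp Require Import ring lra.

Set Implicit Arguments.
Unset Strict Implicit.
Unset Printing Implicit Defensive.

Import Order.TTheory GRing.Theory Num.Theory.
Import numFieldNormedType.Exports.

Local Open Scope classical_set_scope.
Local Open Scope ring_scope.

(** It suffices to bound the lower limit of the averages of a continuous bounded
    F >= 0 from below, and to apply this to M + F and M - F.  At a continuous path
    F is the supremum of the functionals (q - L sup |x - f|)^+ that lie below F,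
    where f is a step function on a dyadic grid and the values of f and q are
    rational; there are countably many of them, so it suffices to treat one finite
    maximum Psi of such functionals at a time.

    The lower limit of E Psi(X_t) is at least E Psi(sigma W): on the grid, Lindeberg's
    exchange argument compares the increments of V with those of W, and between
    the grid points Ottaviani's inequality controls the oscillation of V.
    Replacing V(tx) by V(max(tx, s)) - V(s) makes X_t independent of X_s and, again
    by Ottaviani's inequality, costs an error of order (s/t)^(1/3); hence
    |Cov(Psi(X_s), Psi(X_t))| <= K (s/t)^(1/3).  As s_j / s_k <= (j/k)^beta, the
    variance of the logarithmic average of Psi(X_(s_k)) is O(1 / ln n), so the
    averages converge almost surely along n = 2^(i^2), and then for all n because
    they vary slowly. *)

(** * Independence and maximal inequalities *)

(** The exceptional null set must not depend on [F], while the bounded continuous functions on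
    D[0,1] have no countable uniformly dense subset; approximation from below by cones asks for much
    less. The cones use the uniform distance, which dominates Skorohod's, so a narrow cone around a
    path is supported in a [J1_ball]. Continuity of the path is used only where the cone touches
    [F], and there the path is one of sigma W. Reading the uniform distance on finer and finer
    dyadic grids makes each functional a monotone limit of functions of finitely many values of the
    process, so its measurability and its expectation reduce to those values.

    Between grid points Chebyshev's inequality bounds the oscillation in each of the 2^m blocks by a
    multiple of 2^-m only, which does not become small after summation. Passing to the normal law
    first and using its third moment gives 2^(-3m/2) per block, hence 2^(-m/2) in all.

    The exponent 1/3 is a balance: an error larger than r has probability of order (s/t)/r^2, and
    this equals r for r = (s/t)^(1/3). *)

Section independence.
Context {R : realType} {d : measure_display} {T : measurableType d}.
Variable P : probability T R.

Definition bounded_meas (f : T -> R) :=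
  measurable_fun setT f /\ exists M : R, forall x, `|f x| <= M.

Lemma bounded_meas_integrable f :
  bounded_meas f -> P.-integrable setT (EFin \o f).
Proof.
move=> [mf [M fM]]; apply: measurable_bounded_integrable => //.
  by rewrite (le_lt_trans (probability_le1 _ _))// ltry.
exists M; split; first by rewrite num_real.
by move=> x Mx t _; exact: le_trans (fM t) (ltW Mx).
Qed.

Lemma Rintegral_prob_cst (c : R) : \int[P]_w c = c.
Proof.
rewrite Rintegral_cst//.
have /= -> : P setT = 1%E by exact: probability_setT.
by rewrite mulr1.
Qed.

Definition independent_sets (G H : set (set T)) :=
  forall A B, G A -> H B -> P (A `&` B) = (P A * P B)%E.

Lemma independent_setsC G H : independent_sets G H -> independent_sets H G.
Proof. by move=> GH A B HA GB; rewrite setIC GH// muleC. Qed.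

(** For fixed [A] in [G], both [P (A & B)] and [P A * P B] are finite measures in [B]; they agree on
    the pi-system [H], which contains [setT], hence on what it generates. *)
Lemma independent_sets_sigmar (G H : set (set T)) :
  G `<=` measurable -> H `<=` measurable -> setI_closed H -> H setT ->
  independent_sets G H -> independent_sets G <<s H >>.
Proof.
move=> mG mH HI HT GH A B GA HB.
have mA : measurable A by exact: mG.
pose r : {nonneg R} := NngNum (fine_ge0 (measure_ge0 P A)).
have rE : r%:num%:E = P A by rewrite /= fineK// fin_num_measure.
have := @g_sigma_algebra_measure_unique _ _ _ H mH (fun=> setT)
  (fun=> HT) _ (mrestr P mA) (mscale r P) HI.
move=> /(_ _ _ _ B HB) h; rewrite setIC -rE; apply: h.
- by rewrite bigcup_const//; exists 0%N.
- by move=> C HC; rewrite /= /mrestr /mscale setIC GH// rE.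
- by move=> _; rewrite /= /mrestr setTI (le_lt_trans (probability_le1 _ _))// ltry.
Qed.

Lemma independent_sets_sigma (G H : set (set T)) :
  G `<=` measurable -> H `<=` measurable ->
  setI_closed G -> setI_closed H -> G setT -> H setT ->
  independent_sets G H -> independent_sets <<s G >> <<s H >>.
Proof.
move=> mG mH GI HI GT HT GH.
have sH : <<s H >> `<=` measurable.
  apply: smallest_sub => //; split; first exact: measurable0.
    by move=> A mA; rewrite setTD; exact: measurableC.
  by move=> F mF; exact: bigcupT_measurable.
apply/independent_setsC/independent_sets_sigmar => //.
exact/independent_setsC/independent_sets_sigmar.
Qed.

End independence.

Section independent_pair.
Context {R : realType} {d d' d1 d2 : measure_display}.
Context {T : measurableType d} {T' : measurableType d'}.
Context {T1 : measurableType d1} {T2 : measurableType d2}.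
Variables (P : probability T R) (P' : probability T' R).

(** The hypothesis says at once that [X] and [Y] are independent and that [Y'], possibly on another
    space, has the law of [Y]: by uniqueness of product measures the law of the pair is the product
    of the laws of [X] and [Y']. Replacing [Y] by a copy is what the exchange argument does at each
    step. *)
Lemma independent_pair_Fubini (X : T -> T1) (Y : T -> T2) (Y' : T' -> T2)
    (h : T1 * T2 -> R) (M : R) :
  measurable_fun setT X -> measurable_fun setT Y -> measurable_fun setT Y' ->
  (forall A B, measurable A -> measurable B ->
    P (X @^-1` A `&` Y @^-1` B) = (P (X @^-1` A) * P' (Y' @^-1` B))%E) ->
  measurable_fun setT h -> (forall w w', `|h (X w, Y' w')| <= M) ->
  (forall w, `|h (X w, Y w)| <= M) ->
  (\int[P]_w (h (X w, Y w))%:E = \int[P]_w \int[P']_w' (h (X w, Y' w'))%:E)%E.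
Proof.
move=> mX mY mY' XY mh hM hM'.
pose X1 : {mfun T >-> T1} := mfun_Sub (mem_set mX).
pose Y1 : {mfun T' >-> T2} := mfun_Sub (mem_set mY').
have mZ : measurable_fun setT (fun w => (X w, Y w)) by exact/measurable_fun_pair.
pose Z : {mfun T >-> (T1 * T2)%type} := mfun_Sub (mem_set mZ).
have mU : measurable_fun setT (fun w : T * T' => (X w.1, Y' w.2)).
  by apply/measurable_fun_pair; exact: measurableT_comp.
pose U : {mfun (T * T')%type >-> (T1 * T2)%type} := mfun_Sub (mem_set mU).
pose PP : probability (T * T')%type R := (P \x P')%E.
have iZ : P.-integrable setT (EFin \o h \o Z).
  apply: (@bounded_meas_integrable _ _ _ P (h \o Z)); split.
    exact: measurableT_comp.
  by exists M => w; exact: hM'.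
have iU : PP.-integrable setT (EFin \o h \o U).
  apply: (@bounded_meas_integrable _ _ _ PP (h \o U)); split.
    exact: measurableT_comp.
  by exists M => w; exact: hM.
transitivity (\int[distribution P Z]_z (h z)%:E)%E.
  by rewrite integral_distribution//; exact/measurable_EFinP.
transitivity (\int[distribution PP U]_z (h z)%:E)%E; last first.
  rewrite integral_distribution//; last exact/measurable_EFinP.
  by rewrite -integral12_prod_meas1.
apply: eq_measure_integral => A mA _.
have e1 := @product_measure_unique _ _ _ _ _ (distribution P X1)
  (distribution P' Y1) (distribution P Z).
have e2 := @product_measure_unique _ _ _ _ _ (distribution P X1)
  (distribution P' Y1) (distribution PP U).
rewrite -e1 ?e2//.
- move=> B C mB mC.
  transitivity (PP ((X @^-1` B) `*` (Y' @^-1` C))); first by [].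
  rewrite /PP/= product_measure1E//.
  + by rewrite -[X in measurable X]setTI; exact (mX measurableT _ mB).
  + by rewrite -[X in measurable X]setTI; exact (mY' measurableT _ mC).
Qed.

End independent_pair.

Section product_of_independent.
Context {R : realType} {d d' : measure_display}.
Context {T : measurableType d} {T' : measurableType d'}.
Variables (P : probability T R) (P' : probability T' R).

Definition same_law (X : T -> R) (X' : T' -> R) :=
  forall A, measurable A -> P (X @^-1` A) = P' (X' @^-1` A).

Lemma same_law_Rintegral X X' (f : R -> R) (M : R) :
  measurable_fun setT X -> measurable_fun setT X' ->
  same_law X X' -> measurable_fun setT f -> (forall x, `|f x| <= M) ->
  \int[P]_w f (X w) = \int[P']_w f (X' w).
Proof.
move=> mX mX' XX' mf fM; rewrite /Rintegral; congr fine.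
pose X1 : {mfun T >-> R} := mfun_Sub (mem_set mX).
pose X2 : {mfun T' >-> R} := mfun_Sub (mem_set mX').
transitivity (\int[distribution P X1]_z (f z)%:E)%E.
  rewrite integral_distribution//; first exact/measurable_EFinP.
  apply: (@bounded_meas_integrable _ _ _ P (f \o X)).
  by split; [exact: measurableT_comp|exists M => w; exact: fM].
transitivity (\int[distribution P' X2]_z (f z)%:E)%E; last first.
  rewrite integral_distribution//; first exact/measurable_EFinP.
  apply: (@bounded_meas_integrable _ _ _ P' (f \o X')).
  by split; [exact: measurableT_comp|exists M => w; exact: fM].
by apply: eq_measure_integral => A mA _; exact: XX'.
Qed.

Lemma ge0_same_law_integral X X' (f : R -> \bar R) :
  measurable_fun setT X -> measurable_fun setT X' ->
  same_law X X' -> measurable_fun setT f -> (forall x, (0 <= f x)%E) ->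
  (\int[P]_w f (X w) = \int[P']_w f (X' w))%E.
Proof.
move=> mX mX' XX' mf f0.
pose X1 : {mfun T >-> R} := mfun_Sub (mem_set mX).
pose X2 : {mfun T' >-> R} := mfun_Sub (mem_set mX').
transitivity (\int[distribution P X1]_z f z)%E.
  by rewrite ge0_integral_distribution.
transitivity (\int[distribution P' X2]_z f z)%E; last first.
  by rewrite ge0_integral_distribution.
by apply: eq_measure_integral => A mA _; exact: XX'.
Qed.

End product_of_independent.

Section independent_bounded.
Context {R : realType} {d : measure_display} {T : measurableType d}.
Variable P : probability T R.

Lemma independent_Rintegral_mul (f g : T -> R) :
  bounded_meas f -> bounded_meas g ->
  (forall A B, measurable A -> measurable B ->
    P (f @^-1` A `&` g @^-1` B) = (P (f @^-1` A) * P (g @^-1` B))%E) ->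
  \int[P]_w (f w * g w) = \int[P]_w f w * \int[P]_w g w.
Proof.
move=> bf bg fg; have [mf [M fM]] := bf; have [mg [N gN]] := bg.
have fi := bounded_meas_integrable P bf; have gi := bounded_meas_integrable P bg.
have mh : measurable_fun setT (fun z : R * R => z.1 * z.2).
  by apply: measurable_funM.
have b w w' : `|f w * g w'| <= M * N by rewrite normrM ler_pM.
rewrite /Rintegral (independent_pair_Fubini (Y' := g) mf mg mg fg mh b)/=//.
transitivity (fine (\int[P]_w ((\int[P]_w' g w')%:E * (f w)%:E))%E).
  congr fine; apply: eq_integral => w _.
  under eq_integral do rewrite EFinM.
  by rewrite integralZl// muleC /Rintegral fineK//; exact: integrable_fin_num.
rewrite integralZl// fineM//; last exact: integrable_fin_num.
by rewrite mulrC.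
Qed.

End independent_bounded.

Section cylinders.
Context {R : realType} {d : measure_display} {T : measurableType d}.
Variables (P : probability T R) (n : nat) (xi : 'I_n -> T -> R).
Hypothesis mxi : forall i, measurable_fun setT (xi i).

(** A pi-system generating the sigma-algebra of the variables [xi i] with [D i]. All indices are
    kept, the others being left free by [setT], to match the form of [mutually_independent]. *)
Definition cylinders (D : pred 'I_n) : set (set T) :=
  [set A | exists B : 'I_n -> set R, [/\ forall i, measurable (B i),
    forall i, ~~ D i -> B i = setT & A = \bigcap_i (xi i @^-1` B i)]].

Lemma cylinders_measurable D : cylinders D `<=` measurable.
Proof.
move=> _ [B [mB _ ->]]; apply: fin_bigcap_measurable; first exact: finite_finset.
by move=> i _; rewrite -[X in measurable X]setTI; exact: mxi.
Qed.

Lemma cylindersI D : setI_closed (cylinders D).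
Proof.
move=> _ _ [B [mB DB ->]] [C [mC DC ->]].
exists (fun i => B i `&` C i); split.
- by move=> i; exact: measurableI.
- by move=> i Di; rewrite DB// DC// setIT.
- by rewrite -bigcapI; apply: eq_bigcapr => i _; rewrite preimage_setI.
Qed.

Lemma cylindersT D : cylinders D setT.
Proof.
exists (fun=> setT); split => //.
by rewrite bigcapT//; apply/esym/seteqP; split.
Qed.

Lemma measurable_fun_cylinders (D : pred 'I_n) i : D i ->
  measurable_fun [set: g_sigma_algebraType (cylinders D)] (xi i).
Proof.
move=> Di _ B mB; rewrite setTI; apply: sub_sigma_algebra.
exists (fun j => if j == i then B else setT); split.
- by move=> j; case: ifP.
- by move=> j; case: eqVneq => // ->; rewrite Di.
- apply/seteqP; split => [w Bw j _|w /(_ i I)]; last by rewrite eqxx.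
  by case: eqVneq => [->|].
Qed.

Lemma cylinders_sub_measurable D d1 (T1 : measurableType d1) (f : T -> T1) :
  measurable_fun [set: g_sigma_algebraType (cylinders D)] f ->
  measurable_fun [set: T] f.
Proof.
move=> mf _ B mB; have := mf measurableT B mB; rewrite !setTI.
apply: smallest_sub; last exact: cylinders_measurable.
split; first exact: measurable0.
  by move=> A mA; rewrite setTD; exact: measurableC.
by move=> F mF; exact: bigcupT_measurable.
Qed.

Hypothesis ind : mutually_independent P xi.

Lemma cylinders_independent (D D' : pred 'I_n) :
  (forall i, D i -> D' i -> False) ->
  independent_sets P (cylinders D) (cylinders D').
Proof.
move=> DD' _ _ [B [mB DB ->]] [C [mC DC ->]].
have -> : \bigcap_i (xi i @^-1` B i) `&` \bigcap_i (xi i @^-1` C i) =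
    \bigcap_i (xi i @^-1` (B i `&` C i)).
  by rewrite -bigcapI; apply: eq_bigcapr => i _; rewrite preimage_setI.
rewrite !ind//; last by move=> i; exact: measurableI.
rewrite -big_split/=; apply: eq_bigr => i _.
have [Di|/DB ->] := boolP (D i); last first.
  by rewrite setTI preimage_setT probability_setT mul1e.
rewrite DC; last by apply/negP => D'i; exact: DD' D'i.
by rewrite setIT preimage_setT probability_setT mule1.
Qed.

Lemma cylinders_independent_fun (D D' : pred 'I_n) (d1 d2 : measure_display)
    (T1 : measurableType d1) (T2 : measurableType d2)
    (f : T -> T1) (g : T -> T2) :
  (forall i, D i -> D' i -> False) ->
  measurable_fun [set: g_sigma_algebraType (cylinders D)] f ->
  measurable_fun [set: g_sigma_algebraType (cylinders D')] g ->
  forall A B, measurable A -> measurable B ->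
    P (f @^-1` A `&` g @^-1` B) = (P (f @^-1` A) * P (g @^-1` B))%E.
Proof.
move=> DD' mf mg A B mA mB.
apply: (independent_sets_sigma (@cylinders_measurable D)
  (@cylinders_measurable D') (@cylindersI D) (@cylindersI D') (cylindersT D)
  (cylindersT D')).
- exact: cylinders_independent.
- by have := mf measurableT A mA; rewrite setTI.
- by have := mg measurableT B mB; rewrite setTI.
Qed.

(** Factors are split off one at a time: the product of the first [m] is measurable for the
    cylinders over the indices below [m], hence independent of the next factor. *)
Lemma mutually_independent_Rintegral_prod (f : 'I_n -> R -> R) (M : R) :
  (forall i, measurable_fun setT (f i)) -> (forall i x, `|f i x| <= M) ->
  \int[P]_w (\prod_(i < n) f i (xi i w)) = \prod_(i < n) \int[P]_w f i (xi i w).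
Proof.
move=> mf fM.
have bf i : bounded_meas (f i \o xi i).
  by split; [exact: measurableT_comp|exists M => w; exact: fM].
suff H m : (m <= n)%N ->
    \int[P]_w (\prod_(i < n | (i < m)%N) f i (xi i w)) =
    \prod_(i < n | (i < m)%N) \int[P]_w f i (xi i w).
  have := H n (leqnn n).
  under eq_Rintegral do under eq_bigl do rewrite ltn_ord.
  by under eq_bigl do rewrite ltn_ord.
elim: m => [_|m IH mn].
  under eq_Rintegral do rewrite big_pred0//.
  by rewrite big_pred0// Rintegral_prob_cst.
pose k := Ordinal mn.
have eqk (F : 'I_n -> R) : \prod_(i < n | (i < m.+1)%N) F i =
    \prod_(i < n | (i < m)%N) F i * F k.
  rewrite (bigD1 k)//= mulrC; congr (_ * _); apply: eq_bigl => i.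
  by rewrite -val_eqE/= ltnS [RHS]ltn_neqAle andbC.
rewrite eqk -(IH (ltnW mn)).
under eq_Rintegral do rewrite eqk.
have mp : measurable_fun
    [set: g_sigma_algebraType (cylinders (fun i => (i < m)%N))]
    (fun w => \prod_(i < n | (i < m)%N) f i (xi i w)).
  have -> : (fun w => \prod_(i < n | (i < m)%N) f i (xi i w)) =
      (fun w => \prod_(i < n) (if (i < m)%N then f i (xi i w) else 1)).
    by apply/funext => w; exact: big_mkcond.
  apply: measurable_prod => i _; case: (boolP (i < m)%N) => im //.
  by apply: measurableT_comp => //; exact: measurable_fun_cylinders.
have mk : measurable_fun [set: g_sigma_algebraType (cylinders (pred1 k))]
    (f k \o xi k).
  apply: measurableT_comp => //; apply: measurable_fun_cylinders.
  by rewrite /= eqxx.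
apply: independent_Rintegral_mul => //; last 2 first.
- exact: bf.
- have DD' (i : 'I_n) : (i < m)%N -> pred1 k i -> False.
    by move=> im /eqP ik; move: im; rewrite ik ltnn.
  exact: (cylinders_independent_fun DD' mp mk).
split; first exact: cylinders_sub_measurable mp.
exists (\prod_(i < n | (i < m)%N) M) => w.
by rewrite normr_prod; apply: ler_prod => i _; rewrite normr_ge0 fM.
Qed.

End cylinders.

Section independent_pair_ge0.
Context {R : realType} {d d' d1 d2 : measure_display}.
Context {T : measurableType d} {T' : measurableType d'}.
Context {T1 : measurableType d1} {T2 : measurableType d2}.
Variables (P : probability T R) (P' : probability T' R).

(** Serves for second moments before they are known to be finite. *)
Lemma ge0_independent_pair_Fubini (X : T -> T1) (Y : T -> T2) (Y' : T' -> T2)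
    (h : T1 * T2 -> \bar R) :
  measurable_fun setT X -> measurable_fun setT Y -> measurable_fun setT Y' ->
  (forall A B, measurable A -> measurable B ->
    P (X @^-1` A `&` Y @^-1` B) = (P (X @^-1` A) * P' (Y' @^-1` B))%E) ->
  measurable_fun setT h -> (forall z, (0 <= h z)%E) ->
  (\int[P]_w h (X w, Y w) = \int[P]_w \int[P']_w' h (X w, Y' w'))%E.
Proof.
move=> mX mY mY' XY mh h0.
pose X1 : {mfun T >-> T1} := mfun_Sub (mem_set mX).
pose Y1 : {mfun T' >-> T2} := mfun_Sub (mem_set mY').
have mZ : measurable_fun setT (fun w => (X w, Y w)) by exact/measurable_fun_pair.
pose Z : {mfun T >-> (T1 * T2)%type} := mfun_Sub (mem_set mZ).
transitivity (\int[distribution P Z]_z h z)%E.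
  by rewrite ge0_integral_distribution.
transitivity (\int[(distribution P X1 \x distribution P' Y1)%E]_z h z)%E.
  apply: eq_measure_integral => A mA _; apply/esym.
  by apply: product_measure_unique => // B C mB mC; exact: XY.
rewrite fubini_tonelli1// ge0_integral_distribution//=.
- apply: eq_integral => w _; rewrite /fubini_F ge0_integral_distribution//.
  by apply: measurableT_comp => //; exact: pair1_measurable.
- exact: measurable_fun_fubini_tonelli_F.
- by move=> y; exact: integral_ge0.
Qed.

End independent_pair_ge0.

Section ottaviani.
Context {R : realType} {d : measure_display} {T : measurableType d}.
Variables (P : probability T R) (n : nat) (xi : 'I_n -> T -> R).
Hypothesis mxi : forall i, measurable_fun setT (xi i).
Hypothesis ind : mutually_independent P xi.

Let S k w := \sum_(l < n | (l < k)%N) xi l w.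

Lemma measurable_partial_sum (D : pred 'I_n) :
  measurable_fun [set: g_sigma_algebraType (cylinders xi D)]
    (fun w => \sum_(l < n | D l) xi l w).
Proof.
have -> : (fun w => \sum_(l < n | D l) xi l w) =
    (fun w => \sum_(l < n) (if D l then xi l w else 0)).
  by apply/funext => w; exact: big_mkcond.
apply: measurable_sum => i; case: (boolP (D i)) => // Di.
exact: measurable_fun_cylinders.
Qed.

(** When [|S k|] first exceeds [2 * lam], the remaining sum [S n - S k] is independent of the past
    and stays within [lam] with probability at least 1/2; in that case [|S n|] exceeds [lam]. *)
Lemma ottaviani (lam : R) : 0 < lam ->
  (forall k, (k <= n)%N ->
    P [set w | (lam < `|S n w - S k w|)%R] <= (2^-1)%:E)%E ->
  (P [set w | exists2 k, (k <= n)%N & (2 * lam < `|S k w|)%R] <=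
   2%:E * P [set w | (lam < `|S n w|)%R])%E.
Proof.
move=> lam0 half.
pose B k : set T := [set w | exists2 j, (j <= k)%N & 2 * lam < `|S j w|].
pose C : set T := [set w | lam < `|S n w|].
have mS k : measurable_fun
    [set: g_sigma_algebraType (cylinders xi (fun i => (i < k)%N))] (S k).
  exact: measurable_partial_sum.
have cT k (A : set T) : <<s cylinders xi (fun i => (i < k)%N) >> A ->
    measurable A.
  move=> HA.
  have := @cylinders_sub_measurable _ _ _ _ _ mxi (fun i => (i < k)%N) _ _
    (idfun : T -> g_sigma_algebraType (cylinders xi (fun i => (i < k)%N))).
  move=> /(_ (@measurable_id _ _ _)) /(_ measurableT A HA).
  by rewrite setTI.
have gtE (f : T -> R) (a : R) : [set w | a < `|f w|] =
    f @^-1` [set x | a < `|x|] by [].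
have mgt (a : R) : measurable [set x : R | a < `|x|].
  rewrite (_ : [set _ | _] = Num.norm @^-1` `]a, +oo[%classic).
    rewrite -[X in measurable X]setTI.
    by apply: (@normr_measurable R setT).
  by apply/seteqP; split => x /=; rewrite in_itv/= andbT.
have mSgt k (a : R) : <<s cylinders xi (fun i => (i < k)%N) >>
    [set w | a < `|S k w|].
  by have := mS k measurableT _ (mgt a); rewrite setTI.
have cmono k j (A : set T) : (j <= k)%N ->
    <<s cylinders xi (fun i => (i < j)%N) >> A ->
    <<s cylinders xi (fun i => (i < k)%N) >> A.
  move=> jk; apply: sub_sigma_algebra2 => _ [D [mD DD ->]].
  exists D; split => // i ik; apply: DD; apply: contra ik => ij.
  exact: leq_trans ij jk.
have BS k : B k.+1 = B k `|` [set w | 2 * lam < `|S k.+1 w|].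
  apply/seteqP; split=> [w [j]|w [[j jk jS]|kS]].
  - rewrite leq_eqVlt => /predU1P[->|jk] jS; [by right|].
    by left; exists j.
  - by exists j => //; exact: leq_trans jk (leqnSn _).
  - by exists k.+1.
have mB k : <<s cylinders xi (fun i => (i < k)%N) >> (B k).
  elim: k => [|k IH].
    rewrite (_ : B 0%N = set0); first exact: sigma_algebra0.
    apply/seteqP; split => // w [j]; rewrite leqn0 => /eqP ->.
    by rewrite /S big_pred0// normr0 ltNge mulr_ge0// ltW.
  rewrite BS; apply: (@measurableU _
    (g_sigma_algebraType (cylinders xi (fun i => (i < k.+1)%N)))).
    by apply: (cmono _ k).
  exact: mSgt.
have mC : measurable C by exact: cT (mSgt n lam).
have main k : (k <= n)%N -> ((2^-1)%:E * P (B k) <= P (B k `&` C))%E.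
  elim: k => [_|k IH kn].
    rewrite (_ : B 0%N = set0) ?set0I ?measure0 ?mule0//.
    apply/seteqP; split => // w [j]; rewrite leqn0 => /eqP ->.
    by rewrite /S big_pred0// normr0 ltNge mulr_ge0// ltW.
  (* The event that the first passage happens at time [k.+1]: it depends on the first [k.+1]
     variables, and [G] on the others. *)
  pose A := [set w | 2 * lam < `|S k.+1 w|] `\` B k.
  have sA : <<s cylinders xi (fun i => (i < k.+1)%N) >> A.
    apply: (@measurableD _
      (g_sigma_algebraType (cylinders xi (fun i => (i < k.+1)%N)))).
      exact: mSgt.
    by apply: (cmono _ k).
  have BA : B k.+1 = B k `|` A by rewrite BS /A setDE setUIr setUv setIT.
  have dBA : B k `&` A = set0 by rewrite /A setDE setICA setICr setI0.
  have mBk := cT _ _ (mB k); have mA := cT _ _ sA.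
  pose G := [set w | lam < `|S n w - S k.+1 w|].
  have Sd w : S n w - S k.+1 w = \sum_(l < n | (k < l)%N) xi l w.
    rewrite /S (bigID (fun l : 'I_n => (l < k.+1)%N))/= addrAC.
    rewrite (eq_bigl (fun l : 'I_n => (l < k.+1)%N)); last first.
      by move=> l; rewrite ltn_ord.
    by rewrite subrr add0r; apply: eq_bigl => l; rewrite ltn_ord -leqNgt.
  have sG : <<s cylinders xi (fun i => (k < i)%N) >> (~` G).
    have -> : ~` G = ~` ((fun w => \sum_(l < n | (k < l)%N) xi l w) @^-1`
        [set x : R | lam < `|x|]).
      congr (~` _); apply/seteqP; split => w; rewrite /G /= Sd//.
    apply: (@measurableC _
      (g_sigma_algebraType (cylinders xi (fun i => (k < i)%N)))).
    have := @measurable_partial_sum (fun i => (k < i)%N) measurableT _ (mgt lam).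
    by rewrite setTI.
  have mG : measurable G.
    rewrite -[G]setCK; apply: measurableC.
    have := @cylinders_sub_measurable _ _ _ _ _ mxi (fun i => (k < i)%N) _ _
      (idfun : T -> g_sigma_algebraType (cylinders xi (fun i => (k < i)%N))).
    move=> /(_ (@measurable_id _ _ _)) /(_ measurableT _ sG).
    by rewrite setTI.
  have AG : P (A `&` ~` G) = (P A * P (~` G))%E.
    apply: (independent_sets_sigma (@cylinders_measurable _ _ _ _ _ mxi _)
      (@cylinders_measurable _ _ _ _ _ mxi _) (@cylindersI _ _ _ _ _ _)
      (@cylindersI _ _ _ _ _ _) (cylindersT _ _) (cylindersT _ _)) sA sG.
    apply: cylinders_independent => // i; rewrite ltnS => ik ki.
    by move: ki; rewrite ltnNge ik.
  have G12 : ((2^-1)%:E <= P (~` G))%E.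
    rewrite probability_setC// leeBrDr//; last by rewrite fin_num_measure.
    have -> : (1 = (2^-1)%:E + (2^-1)%:E :> \bar R)%E.
      by rewrite -EFinD; congr EFin; lra.
    by rewrite leeD2l//; exact: half.
  rewrite BA setIUl !measureU//; [|exact: measurableI|exact: measurableI|]; last first.
    by rewrite setIACA dBA set0I.
  rewrite ge0_muleDr//; apply: leeD; first exact/IH/ltnW.
  apply: (@le_trans _ _ (P (A `&` ~` G))).
    by rewrite AG muleC lee_wpmul2l.
  apply: le_measure; rewrite ?inE; [apply: measurableI => //|exact: measurableI|].
    exact: measurableC.
  move=> w [[/= kS nB] /negP]; rewrite -leNgt => nS; split=> //.
  rewrite /C/=.
  have := ler_distD (S n w) (S k.+1 w) 0; rewrite !subr0 distrC.
  lra.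
have -> : P [set w | exists2 k, (k <= n)%N & 2 * lam < `|S k w|] = P (B n) by [].
have h : ((2^-1)%:E * P (B n) <= P C)%E.
  apply: (le_trans (main n (leqnn n))); apply: le_measure; rewrite ?inE//.
  by apply: measurableI => //; exact: cT (mB n).
have -> : P (B n) = (2%:E * ((2^-1)%:E * P (B n)))%E.
  by rewrite muleA -EFinM divff ?mul1e.
by rewrite lee_wpmul2l.
Qed.

End ottaviani.

Section second_moments.
Context {R : realType} {d : measure_display} {T : measurableType d}.
Variable P : probability T R.

Definition moment2 (X : T -> R) : \bar R := (\int[P]_w (X w ^+ 2)%:E)%E.

Lemma moment2_ge0 X : (0 <= moment2 X)%E.
Proof. by apply: integral_ge0 => w _; rewrite lee_fin sqr_ge0. Qed.

(** An identity in the extended reals: if [Y] is not square integrable, neither is [x + Y], and both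
    sides are infinite. This is needed since only the increment over [0,1] is known at first to have
    a finite second moment. *)
Lemma moment2_shift (x : R) (Y : T -> R) :
  P.-integrable setT (EFin \o Y) -> (\int[P]_w (Y w)%:E = 0)%E ->
  (\int[P]_w ((x + Y w) ^+ 2)%:E = (x ^+ 2)%:E + moment2 Y)%E.
Proof.
move=> iY Y0; have mY : measurable_fun setT Y.
  exact/measurable_EFinP/(measurable_int P).
have ix : P.-integrable setT (EFin \o cst (x ^+ 2)).
  exact: finite_measure_integrable_cst.
have i2 : P.-integrable setT (fun w => (2 * x)%:E * (Y w)%:E)%E.
  exact: integrableZl.
have e w : (((x + Y w) ^+ 2)%:E = (x ^+ 2)%:E + ((2 * x)%:E * (Y w)%:E +
    (Y w ^+ 2)%:E))%E.
  by rewrite -EFinM -!EFinD; congr EFin; ring.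
have e' w : ((Y w ^+ 2)%:E = ((x + Y w) ^+ 2)%:E - ((x ^+ 2)%:E +
    ((2 * x)%:E * (Y w)%:E)))%E.
  by rewrite -EFinM; congr EFin; rewrite /=; ring.
have [i3|ni3] := pselect (P.-integrable setT (fun w => (Y w ^+ 2)%:E)).
  under eq_integral do rewrite e.
  rewrite integralD//; last exact: integrableD.
  rewrite integralD// integralZl// Y0 mule0 add0e; congr (_ + _)%E.
  by rewrite integral_cst// [X in (_ * X)%E](_ : _ = 1%E) ?mule1//;
    exact: probability_setT.
have oo (f : T -> R) : measurable_fun setT f -> (forall w, 0 <= f w) ->
    ~ P.-integrable setT (EFin \o f) -> (\int[P]_w (f w)%:E = +oo)%E.
  move=> mf f0 nif; apply/eqP; rewrite -leye_eq leNgt; apply/negP => h.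
  apply: nif; apply/integrableP; split; first exact/measurable_EFinP.
  by under eq_integral do rewrite /= ger0_norm//.
rewrite /moment2 (oo (fun w => Y w ^+ 2))//; last 2 first.
- exact: measurable_funX.
- by move=> w; exact: sqr_ge0.
rewrite addey// oo//.
- by apply: measurable_funX; exact: measurable_funD.
- by move=> w; exact: sqr_ge0.
- move=> i4; apply: ni3.
  have : P.-integrable setT ((fun w => ((x + Y w) ^+ 2)%:E) \-
      ((fun w => (x ^+ 2)%:E) \+ (fun w => ((2 * x)%:E * (Y w)%:E))))%E.
    by apply: integrableB => //; exact: integrableD.
  by apply: eq_integrable => // w _; rewrite /= e'.
Qed.

Lemma moment2_add (X Y : T -> R) : measurable_fun setT X ->
  P.-integrable setT (EFin \o Y) -> (\int[P]_w (Y w)%:E = 0)%E ->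
  (forall A B, measurable A -> measurable B ->
    P (X @^-1` A `&` Y @^-1` B) = (P (X @^-1` A) * P (Y @^-1` B))%E) ->
  (moment2 (fun w => X w + Y w)%R = moment2 X + moment2 Y)%E.
Proof.
move=> mX iY Y0 XY; have mY : measurable_fun setT Y.
  exact/measurable_EFinP/(measurable_int P).
have mh : measurable_fun setT (fun z : R * R => ((z.1 + z.2) ^+ 2)%:E).
  by apply/measurable_EFinP; apply: measurable_funX; exact: measurable_funD.
have h0 z : (0 <= (fun z : R * R => ((z.1 + z.2) ^+ 2)%:E) z)%E.
  by rewrite lee_fin sqr_ge0.
rewrite /moment2 (ge0_independent_pair_Fubini mX mY mY XY mh h0)/=.
under eq_integral do rewrite moment2_shift//.
have sq0 w : (0 <= (X w ^+ 2)%:E)%E by rewrite lee_fin sqr_ge0.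
have mX2 : measurable_fun setT (fun w => (X w ^+ 2)%:E).
  by apply/measurable_EFinP; exact: measurable_funX.
have Y20 := moment2_ge0 Y.
rewrite (ge0_integralD _ _ (f2 := fun=> moment2 Y))//=.
congr (_ + _)%E; rewrite integral_cst//.
rewrite [X in (_ * X)%E](_ : _ = 1%E) ?mule1//.
exact: probability_setT.
Qed.

Lemma chebyshev2 (X : T -> R) (a : R) : measurable_fun setT X -> 0 < a ->
  ((a ^+ 2)%:E * P [set w | (a < `|X w|)%R] <= moment2 X)%E.
Proof.
move=> mX a0; pose X1 : {mfun T >-> R} := mfun_Sub (mem_set mX).
have : ((a ^+ 2)%:E * P [set x | a%:E <= `| (X1 x)%:E | ] <=
    'E_P[(fun x => x ^+ 2)%R \o (fun x => `| x |%R) \o X1])%E.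
  apply: markov => //.
    by move=> r _; exact: sqr_ge0.
  by move=> x y; rewrite !nnegrE => x0 y0; rewrite ler_sqr.
rewrite unlock /= => h; apply: le_trans (le_trans h _).
  rewrite lee_wpmul2l ?lee_fin ?sqr_ge0//; apply: le_measure; rewrite ?inE.
  - rewrite (_ : [set _ | _] = (Num.norm \o X) @^-1` `]a, +oo[%classic).
      rewrite -[X in measurable X]setTI.
      by apply: (measurableT_comp (@normr_measurable R setT) mX).
    by apply/seteqP; split => x /=; rewrite in_itv/= andbT.
  - rewrite (_ : [set _ | _] = (Num.norm \o X) @^-1` `[a, +oo[%classic).
      rewrite -[X in measurable X]setTI.
      by apply: (measurableT_comp (@normr_measurable R setT) mX).
    by apply/seteqP; split => x /=; rewrite in_itv/= andbT.
  - by move=> w /= /ltW; rewrite lee_fin.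
rewrite le_eqVlt; apply/orP; left; apply/eqP.
by apply: eq_integral => w _; rewrite real_normK// num_real.
Qed.

End second_moments.

(** * Increments of the process: second moments and a maximal inequality *)

Definition increment (R : realType) (T : Type) (X : R -> T -> R) (s t : R)
  (w : T) : R := X t w - X s w.

Section increments.
Context {R : realType} {d : measure_display} {T : measurableType d}.
Variables (P : probability T R) (D : set R) (X : R -> T -> R).
Hypothesis indX : independent_increments P D X.

Lemma increments_pair (r s t : R) : D r -> D s -> D t -> r <= s -> s <= t ->
  forall A B, measurable A -> measurable B ->
    P (increment X r s @^-1` A `&` increment X s t @^-1` B) =
    (P (increment X r s @^-1` A) * P (increment X s t @^-1` B))%E.
Proof.
move=> Dr Ds Dt rs st A B mA mB.
have := indX (n := 2) (t := fun i => nth 0 [:: r; s; t] i).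
move=> /(_ _ _ (fun i => if val i == 0%N then A else B))/=.
rewrite !big_ord_recl big_ord0/= mule1 => <- //.
- congr (P _); apply/seteqP; split => [w [Aw Bw] [[|[|//]] ?] _//|w h].
  by split; [exact: (h ord0)|exact: (h (lift ord0 ord0))].
- by case=> [|[|[|//]]].
- by case=> [|[|//]].
- by move=> i; case: ifP.
Qed.

End increments.

(** Regularity of the paths is kept apart: it enters only when grid values are compared with
    elements of D[0,1]. *)
Record square_integrable_levy (R : realType) (d : measure_display)
    (T : measurableType d) (P : probability T R) (V : R -> T -> R)
    (sigma : R) : Prop := SquareIntegrableLevy {
  levy_meas : forall t : R, 0 <= t -> measurable_fun setT (V t) ;
  levy_centered : centered P V ;
  levy_homogeneous : homogeneous P V ;
  levy_independent : independent_increments P `[0, +oo[%classic V ;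
  levy_start : {ae P, forall w, V 0 w = 0} ;
  levy_variance : 'E_P[fun w => (V 1 w ^+ 2)%R]%E = (sigma ^+ 2)%:E }.

Section levy.
Context {R : realType} {d : measure_display} {T : measurableType d}.
Variables (P : probability T R) (V : R -> T -> R) (sigma : R).
Hypothesis levyV : square_integrable_levy P V sigma.

Lemma measurable_increment s t : 0 <= s -> 0 <= t ->
  measurable_fun setT (increment V s t).
Proof. by move=> s0 t0; apply: measurable_funB; exact: (levy_meas levyV). Qed.

Lemma integrable_increment s t : 0 <= s -> 0 <= t ->
  P.-integrable setT (EFin \o increment V s t).
Proof.
move=> s0 t0; have [iVs _] := levy_centered levyV s0.
by have [iVt _] := levy_centered levyV t0; exact: (integrableB _ iVt iVs).
Qed.

Lemma mean_increment s t : 0 <= s -> 0 <= t ->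
  (\int[P]_w (increment V s t w)%:E = 0)%E.
Proof.
move=> s0 t0; have [iVs] := levy_centered levyV s0.
have [iVt] := levy_centered levyV t0; rewrite unlock => Et Es.
transitivity (\int[P]_w ((V t w)%:E - (V s w)%:E))%E; first by [].
by rewrite integralB// Et Es subee.
Qed.

Lemma same_law_increment s t : 0 <= s -> s <= t ->
  same_law P P (increment V s t) (increment V 0 (t - s)).
Proof.
move=> s0 st A mA; have ts0 : 0 <= t - s by rewrite subr_ge0.
have := levy_homogeneous levyV s0 (lexx 0) ts0 mA.
by rewrite subrKC add0r.
Qed.

Let v h := moment2 P (increment V 0 h).

Lemma moment2_increment s t : 0 <= s -> s <= t ->
  moment2 P (increment V s t) = moment2 P (increment V 0 (t - s)).
Proof.
move=> s0 st; apply: (@ge0_same_law_integral _ _ _ _ _ _ _ _ _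
  (fun x => (x ^+ 2)%:E)).
- by apply: measurable_increment => //; exact: le_trans st.
- by apply: measurable_increment => //; rewrite subr_ge0.
- exact: same_law_increment.
- by apply/measurable_EFinP; exact: measurable_funX.
- by move=> x; rewrite lee_fin sqr_ge0.
Qed.

Lemma levy_increments_pair (r s t : R) : 0 <= r -> r <= s -> s <= t ->
  forall A B, measurable A -> measurable B ->
    P (increment V r s @^-1` A `&` increment V s t @^-1` B) =
    (P (increment V r s @^-1` A) * P (increment V s t @^-1` B))%E.
Proof.
move=> r0 rs st; have s0 := le_trans r0 rs; have t0 := le_trans s0 st.
by apply: (increments_pair (levy_independent levyV)) => //=;
  rewrite in_itv/= ?r0 ?s0 ?t0.
Qed.

Lemma moment2_incrementD h k : 0 <= h -> 0 <= k -> (v (h + k) = v h + v k)%E.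
Proof.
move=> h0 k0; have hk0 : 0 <= h + k by rewrite addr_ge0.
have hhk : h <= h + k by rewrite lerDl.
rewrite /v -[in moment2 _ (_ _ _ k)](_ : h + k - h = k); last by ring.
rewrite -moment2_increment// -moment2_add.
- by congr (moment2 P); apply/funext => w; rewrite /increment; ring.
- exact: measurable_increment.
- exact: integrable_increment.
- exact: mean_increment.
- exact: levy_increments_pair.
Qed.

Lemma moment2_increment1 : v 1 = (sigma ^+ 2)%:E.
Proof.
rewrite -(levy_variance levyV) unlock; apply: ae_eq_integral => //.
- apply/measurable_EFinP/measurable_funX; exact: measurable_increment.
- apply/measurable_EFinP/measurable_funX; exact: (levy_meas levyV).
- apply: filterS (levy_start levyV) => w V0w _.
  by rewrite /increment V0w subr0.
Qed.

Lemma moment2_increment_nat (n : nat) : v n%:R = (n%:R * sigma ^+ 2)%:E.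
Proof.
elim: n => [|n IH].
  rewrite mul0r /v /moment2; under eq_integral do rewrite /increment subrr expr0n.
  exact: integral0.
rewrite -natr1 moment2_incrementD// IH moment2_increment1 -EFinD.
by congr EFin; ring.
Qed.

(** The second moment [v] is additive in the length and nonnegative, hence monotone, and it is known
    at integers. Rounding the length up costs the summand 1, which is harmless because lengths are
    later multiplied by a large [t]. *)
Lemma moment2_increment_le s t : 0 <= s -> s <= t ->
  (moment2 P (increment V s t) <= (sigma ^+ 2 * (t - s + 1))%:E)%E.
Proof.
move=> s0 st; rewrite moment2_increment//.
have h0 : 0 <= t - s by rewrite subr_ge0.
have /andP[h1 h2] := truncn_itv h0.
set n := Num.truncn _ in h1 h2.
apply: (@le_trans _ _ (v n.+1%:R)).
  rewrite -[n.+1%:R](subrKC (t - s)) moment2_incrementD//.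
    by rewrite leeDl// moment2_ge0.
  by rewrite subr_ge0 ltW.
rewrite moment2_increment_nat lee_fin mulrC ler_wpM2l ?sqr_ge0//.
by rewrite -natr1 lerD2r.
Qed.

Lemma chebyshev_increment s t a : 0 <= s -> s <= t -> 0 < a ->
  (P [set w | (a < `|increment V s t w|)%R] <=
   (sigma ^+ 2 * (t - s + 1) / a ^+ 2)%:E)%E.
Proof.
move=> s0 st a0; have t0 := le_trans s0 st.
have a20 : 0 < a ^+ 2 by rewrite exprn_gt0.
have := chebyshev2 P (measurable_increment s0 t0) a0.
move=> /le_trans/(_ (moment2_increment_le s0 st)).
by rewrite muleC -lee_pdivlMr// -EFinM mulrC.
Qed.

Lemma levy_grid_independent (n : nat) (t : nat -> R) : 0 <= t 0%N ->
  (forall i, (i < n)%N -> t i <= t i.+1) ->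
  mutually_independent P (fun i : 'I_n => increment V (t i) (t i.+1)).
Proof.
move=> t0 tS; apply: (levy_independent levyV) => // i.
elim: i => [_|i IH ni] /=; rewrite in_itv/= andbT//.
have := IH (ltnW ni); rewrite /= in_itv/= andbT => /le_trans; apply.
exact: tS.
Qed.

Lemma grid_ge0 (n : nat) (t : nat -> R) : 0 <= t 0%N ->
  (forall i, (i < n)%N -> t i <= t i.+1) -> forall i, (i <= n)%N -> 0 <= t i.
Proof.
move=> t0 tS; elim=> [//|i IH ni]; apply: le_trans (tS _ ni).
exact/IH/ltnW.
Qed.

Lemma grid_le (n : nat) (t : nat -> R) :
  (forall i, (i < n)%N -> t i <= t i.+1) ->
  forall i j, (i <= j)%N -> (j <= n)%N -> t i <= t j.
Proof.
move=> tS i; elim=> [|j IH]; first by rewrite leqn0 => /eqP ->.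
rewrite leq_eqVlt => /predU1P[->//|ij] jn.
by apply: le_trans (tS _ jn); exact: IH (ltnW jn).
Qed.

Lemma sum_increment (n k : nat) (t : nat -> R) (w : T) : (k <= n)%N ->
  \sum_(l < n | (l < k)%N) increment V (t l) (t l.+1) w =
  increment V (t 0%N) (t k) w.
Proof.
move=> kn; rewrite -(big_ord_widen _ (fun l => increment V (t l) (t l.+1) w) kn).
by rewrite -(big_mkord xpredT (fun l => increment V (t l) (t l.+1) w))
  telescope_sumr.
Qed.

(** The numerical condition is the one under which Chebyshev's inequality bounds every tail
    probability required by [ottaviani] by 1/2. *)
Lemma levy_maximal (n : nat) (t : nat -> R) (lam : R) : 0 < lam ->
  0 <= t 0%N -> (forall i, (i < n)%N -> t i <= t i.+1) ->
  2 * (sigma ^+ 2 * (t n - t 0%N + 1)) <= lam ^+ 2 ->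
  (P [set w | exists2 k, (k <= n)%N &
        (2 * lam < `|increment V (t 0%N) (t k) w|)%R] <=
   2%:E * P [set w | (lam < `|increment V (t 0%N) (t n) w|)%R])%E.
Proof.
move=> lam0 t0 tS hl; have tge := grid_ge0 t0 tS.
have lam20 : 0 < lam ^+ 2 by rewrite exprn_gt0.
have := @ottaviani _ _ _ P n (fun i : 'I_n => increment V (t i) (t i.+1)) _
  (levy_grid_independent t0 tS) _ lam0.
move=> /(_ (fun i => measurable_increment (tge _ (ltnW (ltn_ord i)))
  (tge _ (ltn_ord i)))).
set A := [set w | exists2 k, _ & _]; set B := [set w | _].
set A' := [set w | exists2 k, _ & _]; set B' := [set w | _].
have -> : A = A'.
  by apply/seteqP; split=> w [k kn h]; exists k => //; move: h;
    rewrite sum_increment.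
have -> : B = B' by apply/seteqP; split=> w; rewrite /B /B' /= sum_increment.
apply => k kn.
rewrite (_ : [set _ | _] = [set w | (lam < `|increment V (t k) (t n) w|)]);
  last first.
  apply/seteqP; split=> w /=; rewrite !sum_increment// /increment;
  by rewrite opprB addrA subrK.
apply: (le_trans (chebyshev_increment (tge _ kn) (grid_le tS kn (leqnn n)) lam0)).
rewrite lee_fin ler_pdivrMr//.
have t0k : t 0%N <= t k by exact: (grid_le tS).
have : sigma ^+ 2 * (t n - t k + 1) <= sigma ^+ 2 * (t n - t 0%N + 1).
  by rewrite ler_wpM2l ?sqr_ge0//; lra.
lra.
Qed.

End levy.

(** * Moments of the normal law *)

Section exp_bounds.
Context {R : realType}.
Implicit Types y u : R.

Lemma expR_normE y : expR `|y| <= expR y + expR (- y).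
Proof.
have [y0|y0] := ger0P y; first by rewrite lerDl expR_ge0.
by rewrite lerDr expR_ge0.
Qed.

Lemma norm_exprn_le_expR y (n : nat) :
  `|y| ^+ n.+1 <= n.+1`!%:R * (expR y + expR (- y)).
Proof.
apply: le_trans (ler_wpM2l _ (expR_normE y)) => //.
have := expR_ge1Dxn n (normr_ge0 y) => /(le_trans _) h.
have : `|y| ^+ n.+1 / n.+1`!%:R <= expR `|y| by apply: h; rewrite lerDr.
by rewrite ler_pdivrMr ?ltr0n ?fact_gt0// mulrC.
Qed.

(** This is 2 cosh(2u) - 2 = (2 sinh u)^2, with 2 sinh u written so that 1 - e^(-2u) can be put
    between 2u / (1 + 2u) and 2u. *)
Let sinh2E u : expR (2 * u) + expR (- (2 * u)) - 2 =
  (expR u * (1 - expR (- (2 * u)))) ^+ 2.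
Proof.
have -> : expR (- (2 * u)) = (expR u)^-1 ^+ 2.
  by rewrite -expRN -expRM_natl mulrN.
have -> : expR (2 * u) = expR u ^+ 2 by rewrite -expRM_natl.
have : expR u != 0 by rewrite gt_eqF// expR_gt0.
by move=> e0; field.
Qed.

Let cosh_bounds_pos u : 0 <= u ->
  4 * u ^+ 2 * (1 - 4 * u) <= expR (2 * u) + expR (- (2 * u)) - 2 /\
  expR (2 * u) + expR (- (2 * u)) - 2 <= 4 * u ^+ 2 * expR (2 * u).
Proof.
move=> u0; rewrite sinh2E; have e1 : 1 <= expR u by rewrite -expR0 ler_expR.
have h1 : 1 - expR (- (2 * u)) <= 2 * u.
  by have := expR_ge1Dx (- (2 * u)); lra.
have h2 : 0 <= 1 - expR (- (2 * u)).
  by rewrite subr_ge0 -expR0 ler_expR oppr_le0 mulr_ge0.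
have h3 : 2 * u / (1 + 2 * u) <= 1 - expR (- (2 * u)).
  have p : 0 < 1 + 2 * u by lra.
  have -> : 2 * u / (1 + 2 * u) = 1 - (1 + 2 * u)^-1.
    by field; rewrite gt_eqF.
  rewrite lerD2l lerN2 expRN lef_pV2 ?posrE ?expR_gt0//.
  exact: expR_ge1Dx.
split.
- apply: (@le_trans _ _ ((2 * u / (1 + 2 * u)) ^+ 2)); last first.
    rewrite ler_sqr ?nnegrE ?mulr_ge0 ?expR_ge0//; last first.
      by rewrite invr_ge0 addr_ge0// mulr_ge0.
    apply: (le_trans h3); by rewrite ler_peMl.
  rewrite exprMn exprVn ler_pdivlMr; last by rewrite exprn_gt0//; lra.
  have -> : (2 * u) ^+ 2 = 4 * u ^+ 2 by ring.
  have -> : 4 * u ^+ 2 * (1 - 4 * u) * (1 + 2 * u) ^+ 2 =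
      4 * u ^+ 2 * (1 - 12 * u ^+ 2 - 16 * u ^+ 3) by ring.
  apply: ler_piMr; first by rewrite mulr_ge0// sqr_ge0.
  have := exprn_ge0 2 u0; have := exprn_ge0 3 u0; lra.
- rewrite exprMn -expRM_natl mulrC ler_wpM2r ?expR_ge0//.
  have -> : 4 * u ^+ 2 = (2 * u) ^+ 2 by ring.
  by rewrite ler_sqr ?nnegrE// mulr_ge0.
Qed.

(** Both bounds equal y^2 up to a relative error of order |y|; for y = b z and small b they recover
    the second moment of z from its moment generating function. *)
Lemma cosh_bounds y :
  y ^+ 2 * (1 - 2 * `|y|) <= expR y + expR (- y) - 2 <= y ^+ 2 * expR `|y|.
Proof.
wlog y0 : y / 0 <= y.
  move=> H; have [/H//|y0] := leP 0 y.
  have := H (- y); rewrite oppr_ge0 => /(_ (ltW y0)).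
  by rewrite sqrrN normrN opprK [expR y + _]addrC.
have := @cosh_bounds_pos (y / 2).
rewrite (_ : 2 * (y / 2) = y); last by field.
rewrite (_ : 4 * (y / 2) ^+ 2 = y ^+ 2); last by field.
rewrite (_ : 4 * (y / 2) = 2 * y); last by field.
by move=> [|h1 h2]; rewrite ?divr_ge0// ger0_norm// h1 h2.
Qed.

Lemma expR_le1DxMexpR y : 0 <= y -> expR y <= 1 + y * expR y.
Proof.
move=> y0; have := expR_ge1Dx (- y); rewrite expRN => h.
have e0 := expR_gt0 y.
have : (1 - y) * expR y <= 1 by rewrite -ler_pdivlMr// mul1r.
by lra.
Qed.

Lemma le_of_forall_linear (x y C : R) :
  (forall b, 0 < b -> b <= 1 -> x <= y + C * b) -> x <= y.
Proof.
move=> H; apply/ler_addgt0Pr => e e0.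
pose b := Num.min 1 (e / (`|C| + 1)).
have C0 : 0 < `|C| + 1 by rewrite ltr_wpDl.
have b0 : 0 < b by rewrite lt_min ltr01 divr_gt0.
have b1 : b <= 1 by rewrite ge_min lexx.
apply: (le_trans (H b b0 b1)); rewrite lerD2l.
apply: (@le_trans _ _ ((`|C| + 1) * b)).
  by rewrite ler_wpM2r ?(ltW b0)//; have := ler_norm C; lra.
by rewrite mulrC -ler_pdivlMr// /b ge_min lexx orbT.
Qed.

End exp_bounds.

Section gaussian_mgf.
Context {R : realType} {d : measure_display} {T : measurableType d}.
Variables (P : probability T R) (z : T -> R).
Hypothesis mz : measurable_fun setT z.
Hypothesis mgfz : forall b : R,
  (\int[P]_w (expR (b * z w))%:E = (expR (b ^+ 2 / 2))%:E)%E.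

Let mE b : measurable_fun setT (fun w => expR (b * z w)).
Proof. by apply: measurableT_comp => //; exact: measurable_funM. Qed.

Let iE b : P.-integrable setT (EFin \o (fun w => expR (b * z w))).
Proof.
apply/integrableP; split; first exact/measurable_EFinP.
under eq_integral do rewrite /= ger0_norm ?expR_ge0//.
by rewrite mgfz ltry.
Qed.

Let EE b : \int[P]_w expR (b * z w) = expR (b ^+ 2 / 2).
Proof. by rewrite /Rintegral mgfz. Qed.

Let ch b w := expR (b * z w) + expR (- (b * z w)).

Let ich b : P.-integrable setT (EFin \o ch b).
Proof.
have := integrableD measurableT (iE b) (iE (- b)).
by apply: eq_integrable => // w _; rewrite /ch /= mulNr EFinD.
Qed.

Let Ech b : \int[P]_w ch b w = 2 * expR (b ^+ 2 / 2).
Proof.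
rewrite /ch; under eq_Rintegral do rewrite -mulNr.
by rewrite RintegralD// !EE sqrrN; ring.
Qed.

Let ich_le (C b : R) (f : T -> R) : measurable_fun setT f ->
  (forall w, `|f w| <= C * ch b w) -> P.-integrable setT (EFin \o f).
Proof.
move=> mf fC.
apply: (le_integrable measurableT _ _ (integrableZl measurableT C (ich b))).
  exact/measurable_EFinP.
move=> w _ /=; rewrite lee_fin; apply: le_trans (fC w) _.
exact: ler_norm.
Qed.

Let ipow (n : nat) : P.-integrable setT (EFin \o (fun w => `|z w| ^+ n.+1)).
Proof.
apply: (@ich_le n.+1`!%:R 1).
  by apply: measurable_funX; exact: measurableT_comp.
move=> w; rewrite ger0_norm ?exprn_ge0// /ch mul1r.
exact: norm_exprn_le_expR.
Qed.

Let Epow (n : nat) : \int[P]_w (`|z w| ^+ n.+1) <= n.+1`!%:R * (2 * expR (2^-1)).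
Proof.
have -> : 2 * expR (2^-1) = \int[P]_w ch 1 w by rewrite Ech expr1n div1r.
rewrite -RintegralZl//; apply: le_Rintegral => //.
- by have := integrableZl measurableT n.+1`!%:R (ich 1).
- by move=> w _; rewrite /ch mul1r; exact: norm_exprn_le_expR.
Qed.

Let iz : P.-integrable setT (EFin \o z).
Proof.
apply: (@ich_le 1 1) => // w.
by have := norm_exprn_le_expR (z w) 0; rewrite expr1 (_ : 1`! = 1)%N// /ch !mul1r.
Qed.

Let iz2 : P.-integrable setT (EFin \o (fun w => z w ^+ 2)).
Proof.
by have := ipow 1; apply: eq_integrable => // w _; rewrite /= real_normK ?num_real.
Qed.

Lemma gaussian_mgf_integrable : P.-integrable setT (EFin \o z).
Proof. exact: iz. Qed.

Let expb (b : R) : 0 < b -> b <= 1 ->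
  expR (b ^+ 2 / 2) - 1 <= b ^+ 2 / 2 * expR (2^-1).
Proof.
move=> b0 b1; have b2 : 0 <= b ^+ 2 / 2 by rewrite divr_ge0// sqr_ge0.
have := expR_le1DxMexpR b2 => h.
have : b ^+ 2 / 2 * expR (b ^+ 2 / 2) <= b ^+ 2 / 2 * expR (2^-1).
  rewrite ler_wpM2l// ler_expR ler_pdivrMr// mulVf//.
  by rewrite exprn_ile1// ltW.
by lra.
Qed.

(** From 1 + b c z <= e^(b c z) one gets b c E z <= e^(b^2/2) - 1, which is of order b^2; divide by
    b and let b tend to 0. *)
Let mean_le (c : R) : c = 1 \/ c = -1 -> c * \int[P]_w z w <= 0.
Proof.
move=> c1; apply: (@le_of_forall_linear _ _ _ (expR (2^-1) / 2)) => b b0 b1.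
rewrite add0r.
have : b * (c * \int[P]_w z w) <= \int[P]_w expR (b * c * z w) - 1.
  have i1 : P.-integrable setT (EFin \o cst (1:R)).
    exact: finite_measure_integrable_cst.
  rewrite -[X in _ - X](Rintegral_prob_cst P 1) -RintegralB//.
  rewrite mulrA -RintegralZl//; apply: le_Rintegral => //.
  - by have := integrableZl measurableT (b * c) iz.
  - by have := integrableB measurableT (iE (b * c)) i1.
  - by move=> w _; rewrite lerBrDl; exact: expR_ge1Dx.
rewrite EE exprMn (_ : c ^+ 2 = 1); last by case: c1 => ->; ring.
rewrite mulr1 => /le_trans/(_ (expb b0 b1)).
move=> h; rewrite -(ler_pM2l b0); apply: (le_trans h).
by rewrite le_eqVlt; apply/orP; left; apply/eqP; field.
Qed.

Lemma gaussian_mgf_mean : \int[P]_w z w = 0.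
Proof.
have := mean_le (or_introl erefl); have := mean_le (or_intror erefl).
by rewrite mul1r mulN1r oppr_le0 => h1 h2; apply/eqP; rewrite eq_le h1 h2.
Qed.

(** The mean of [ch b - 2] is 2 (e^(b^2/2) - 1) = b^2 + O(b^4), and by [cosh_bounds] it differs from
    b^2 E z^2 by O(b^3); divide by b^2 and let b tend to 0. *)
Lemma gaussian_mgf_variance : \int[P]_w (z w ^+ 2) = 1.
Proof.
set q := LHS.
have i2 : P.-integrable setT (EFin \o cst (2:R)).
  exact: finite_measure_integrable_cst.
have ic2 b : P.-integrable setT (EFin \o (fun w => ch b w - 2)).
  by have := integrableB measurableT (ich b) i2.
have Ec2 b : \int[P]_w (ch b w - 2) = 2 * (expR (b ^+ 2 / 2) - 1).
  by rewrite RintegralB// Ech Rintegral_prob_cst; ring.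
have i3 (C : R) : P.-integrable setT (EFin \o (fun w => C * `|z w| ^+ 3)).
  by have := integrableZl measurableT C (ipow 2).
have iz2C (C : R) : P.-integrable setT (EFin \o (fun w => C * z w ^+ 2)).
  by have := integrableZl measurableT C iz2.
have ichC (C b : R) : P.-integrable setT (EFin \o (fun w => C * ch b w)).
  by have := integrableZl measurableT C (ich b).
apply/eqP; rewrite eq_le; apply/andP; split.
- pose K := \int[P]_w (`|z w| ^+ 3).
  apply: (@le_of_forall_linear _ _ _ (2 * K + expR 2^-1)) => b b0 b1.
  have : b ^+ 2 * q - 2 * b ^+ 3 * K <= 2 * (expR (b ^+ 2 / 2) - 1).
    rewrite -Ec2 /q /K -!RintegralZl//.
    rewrite -RintegralB//; apply: le_Rintegral => //.
      by have := integrableB measurableT (iz2C (b ^+ 2)) (i3 (2 * b ^+ 3)).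
    move=> w _; have /andP[h _] := cosh_bounds (b * z w).
    apply: le_trans h; rewrite normrM (gtr0_norm b0) exprMn.
    have -> : `|z w| ^+ 3 = z w ^+ 2 * `|z w|.
      by rewrite exprSr real_normK ?num_real.
    by rewrite le_eqVlt; apply/orP; left; apply/eqP; ring.
  have b20 : 0 < b ^+ 2 by rewrite exprn_gt0.
  have := expb b0 b1; have e0 := expR_gt0 (2^-1 : R).
  have h3 : expR (b ^+ 2 / 2) - 1 <= b ^+ 2 / 2 * (1 + b * expR 2^-1).
    have b2 : 0 <= b ^+ 2 / 2 by rewrite divr_ge0// sqr_ge0.
    have := expR_le1DxMexpR b2 => h.
    have : b ^+ 2 / 2 * expR (b ^+ 2 / 2) <= b ^+ 2 / 2 * (1 + b * expR 2^-1).
      rewrite ler_wpM2l//.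
      have := expb b0 b1.
      have : b ^+ 2 / 2 * expR 2^-1 <= b * expR 2^-1.
        rewrite ler_wpM2r ?(ltW e0)// ler_pdivrMr// expr2 ler_pM2l//.
        lra.
      by lra.
    by lra.
  move=> _ h4; rewrite -(ler_pM2l b20).
  have -> : b ^+ 2 * (1 + (2 * K + expR 2^-1) * b) =
    2 * (b ^+ 2 / 2 * (1 + b * expR 2^-1)) + 2 * b ^+ 3 * K by field.
  by lra.
(* The remainder |z|^3 e^|z| is at most 6 e^(2|z|), hence at most [6 * ch 2], whose mean is this
   constant. *)
- apply: (@le_of_forall_linear _ _ _ (12 * expR (2 ^+ 2 / 2))) => b b0 b1.
  have b20 : 0 < b ^+ 2 by rewrite exprn_gt0.
  have b30 : 0 < b ^+ 3 by rewrite exprn_gt0.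
  have h1 : 2 * (expR (b ^+ 2 / 2) - 1) <=
      b ^+ 2 * q + b ^+ 3 * 6 * (2 * expR (2 ^+ 2 / 2)).
    rewrite -Ec2 -Ech /q -!RintegralZl// -RintegralD//; apply: le_Rintegral => //.
      by have := integrableD measurableT (iz2C (b ^+ 2)) (ichC (b ^+ 3 * 6) 2).
    move=> w _; have /andP[_ h] := cosh_bounds (b * z w).
    apply: (le_trans h); have y0 := normr_ge0 (b * z w).
    have := expR_le1DxMexpR y0 => h2.
    apply: (@le_trans _ _ ((b * z w) ^+ 2 * (1 + `|b * z w| * expR `|b * z w|))).
      by rewrite ler_wpM2l ?sqr_ge0.
    rewrite mulrDr mulr1 exprMn lerD2l normrM (gtr0_norm b0).
    have -> : b ^+ 2 * z w ^+ 2 * (b * `|z w| * expR (b * `|z w|)) =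
        b ^+ 3 * (`|z w| ^+ 3 * expR (b * `|z w|)).
      rewrite [`|z w| ^+ 3]exprSr real_normK ?num_real//; ring.
    rewrite -[leRHS]mulrA ler_pM2l//.
    have e1 : expR (b * `|z w|) <= expR `|z w|.
      by rewrite ler_expR ler_piMl.
    have e2 : `|z w| ^+ 3 <= 6 * expR `|z w|.
      have := expR_ge1Dxn 2 (normr_ge0 (z w)).
      rewrite (_ : 3`! = 6)// => h5.
      have : `|z w| ^+ 3 / 6 <= expR `|z w| by lra.
      by rewrite ler_pdivrMr// mulrC.
    apply: (@le_trans _ _ (6 * expR `|z w| * expR `|z w|)).
      by rewrite ler_pM// ?expR_ge0// exprn_ge0.
    rewrite -[leLHS]mulrA ler_pM2l// -expRD /ch.
    have -> : `|z w| + `|z w| = `|2 * z w|.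
      by rewrite normrM ger0_norm//; ring.
    exact: expR_normE.
  have h2 := expR_ge1Dx (b ^+ 2 / 2).
  rewrite -(ler_pM2l b20).
  have -> : b ^+ 2 * (q + 12 * expR (2 ^+ 2 / 2) * b) =
    b ^+ 2 * q + b ^+ 3 * 6 * (2 * expR (2 ^+ 2 / 2)) by ring.
  by apply: le_trans h1; lra.
Qed.

Lemma gaussian_mgf_moment3 :
  P.-integrable setT (EFin \o (fun w => `|z w| ^+ 3)).
Proof. exact: ipow. Qed.

Lemma gaussian_mgf_moment3_le :
  \int[P]_w (`|z w| ^+ 3) <= 3`!%:R * (2 * expR 2^-1).
Proof. exact: Epow. Qed.

Lemma gaussian_mgf_moment2_integrable :
  P.-integrable setT (EFin \o (fun w => z w ^+ 2)).
Proof. exact: iz2. Qed.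

End gaussian_mgf.

Section normal_law.
Context {R : realType}.
Local Notation mu := (@lebesgue_measure R).

(** The change of variables involves the Radon-Nikodym derivative; it agrees almost everywhere with
    the density, as both have the same integral over every measurable set. *)
Lemma integral_normal_prob (m s : R) (f : R -> \bar R) : s != 0 ->
  measurable_fun setT f -> (forall x, (0 <= f x)%E) ->
  (\int[normal_prob m s]_x f x = \int[mu]_x (f x * (normal_pdf m s x)%:E))%E.
Proof.
move=> s0 mf f0; have dom := normal_prob_dominates m s.
rewrite -(Radon_Nikodym_SigmaFinite.change_of_variables dom f0 measurableT mf).
have ip := integrable_normal_pdf m s.
have iF := Radon_Nikodym_SigmaFinite.f_integrable dom.
apply: ae_eq_integral => //.
- by apply: emeasurable_funM => //; exact: (measurable_int mu iF).
- by apply: emeasurable_funM => //; exact: (measurable_int mu ip).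
- apply: ae_eqe_mul2l; apply: integral_ae_eq => //.
    exact: (measurable_int mu ip).
  by move=> E _ mE; rewrite -(Radon_Nikodym_SigmaFinite.f_integral dom).
Qed.

Lemma normal_mgf (s b : R) : 0 < s ->
  (\int[normal_prob 0 s]_x (expR (b * (x / s)))%:E = (expR (b ^+ 2 / 2))%:E)%E.
Proof.
move=> s0; have sn0 : s != 0 by rewrite gt_eqF.
rewrite integral_normal_prob//; last first.
  apply/measurable_EFinP; apply: measurableT_comp => //.
  by apply: measurable_funM => //; exact: measurable_funM.
(* Completing the square turns the exponential weight into a translation of the density by
   [b * s]. *)
transitivity (\int[mu]_x ((expR (b ^+ 2 / 2))%:E * (normal_pdf (b * s) s x)%:E))%E.
  apply: eq_integral => x _; rewrite -!EFinM; congr EFin.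
  rewrite !normal_pdfE// mulrCA [RHS]mulrCA; congr (_ * _).
  rewrite /normal_fun -!expRD; congr expR.
  by field.
have mp : measurable_fun setT (fun x => (normal_pdf (b * s) s x)%:E).
  by apply/measurable_EFinP; exact: measurable_normal_pdf.
have p0 x : (0 <= (normal_pdf (b * s) s x)%:E)%E.
  by rewrite lee_fin normal_pdf_ge0.
by rewrite ge0_integralZl ?lee_fin ?expR_ge0// integral_normal_pdf mule1.
Qed.

End normal_law.

Section normal_variable.
Context {R : realType} {d : measure_display} {T : measurableType d}.
Variables (P : probability T R) (eta : T -> R) (s : R).
Hypothesis meta : measurable_fun setT eta.
Hypothesis s0 : 0 < s.
Hypothesis law : forall A, measurable A -> P (eta @^-1` A) = normal_prob 0 s A.

Let z w := eta w / s.

Let mz : measurable_fun setT z.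
Proof. exact: measurable_funM. Qed.

Let etaE w : eta w = s * z w.
Proof. by rewrite /z mulrCA divff ?mulr1// gt_eqF. Qed.

Let cubeE w : `|eta w| ^+ 3 = s ^+ 3 * `|z w| ^+ 3.
Proof. by rewrite -exprMn -{1}(gtr0_norm s0) -normrM -etaE. Qed.

Let mgfz b : (\int[P]_w (expR (b * z w))%:E = (expR (b ^+ 2 / 2))%:E)%E.
Proof.
have meta' : @measurable_fun _ _ T (measurableTypeR R) setT eta.
  by move=> mT B mB; exact: meta.
pose X := @mfun_Sub _ _ T (measurableTypeR R) eta (mem_set meta').
rewrite -(normal_mgf b s0).
transitivity (\int[distribution P X]_x (expR (b * (x / s)))%:E)%E.
  rewrite ge0_integral_distribution//.
  apply/measurable_EFinP; apply: measurableT_comp => //.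
  by apply: measurable_funM => //; exact: measurable_funM.
by apply: eq_measure_integral => A mA _; exact: law.
Qed.

Lemma normal_integrable : P.-integrable setT (EFin \o eta).
Proof.
have := integrableZl measurableT s (gaussian_mgf_integrable mz mgfz).
by apply: eq_integrable => // w _; rewrite /= -EFinM -etaE.
Qed.

Lemma normal_mean : \int[P]_w eta w = 0.
Proof.
under eq_Rintegral do rewrite etaE.
by rewrite RintegralZl// ?gaussian_mgf_mean// ?mulr0//;
  exact: gaussian_mgf_integrable.
Qed.

Lemma normal_sq_integrable : P.-integrable setT (EFin \o (fun w => eta w ^+ 2)).
Proof.
have := integrableZl measurableT (s ^+ 2) (gaussian_mgf_moment2_integrable mz mgfz).
by apply: eq_integrable => // w _; rewrite /= -EFinM -exprMn -etaE.
Qed.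

Lemma normal_variance : \int[P]_w (eta w ^+ 2) = s ^+ 2.
Proof.
under eq_Rintegral do rewrite etaE exprMn.
by rewrite RintegralZl// ?gaussian_mgf_variance// ?mulr1//;
  exact: gaussian_mgf_moment2_integrable.
Qed.

Lemma normal_cube_integrable :
  P.-integrable setT (EFin \o (fun w => `|eta w| ^+ 3)).
Proof.
have := integrableZl measurableT (s ^+ 3) (gaussian_mgf_moment3 mz mgfz).
apply: eq_integrable => // w _; by rewrite /= -EFinM -cubeE.
Qed.

Lemma normal_cube_le :
  \int[P]_w (`|eta w| ^+ 3) <= 12 * expR (2^-1) * s ^+ 3.
Proof.
under eq_Rintegral do rewrite cubeE.
rewrite RintegralZl//; last exact: gaussian_mgf_moment3.
rewrite mulrC ler_pM2r ?exprn_gt0//.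
apply: le_trans (gaussian_mgf_moment3_le mz mgfz) _.
by rewrite (_ : 3`! = 6)%N//; lra.
Qed.

End normal_variable.

Section bounded_integrals.
Context {R : realType} {d : measure_display} {T : measurableType d}.
Variable P : probability T R.

Lemma bounded_meas_norm_le (f : T -> R) (M : R) : measurable_fun setT f ->
  (forall w, `|f w| <= M) -> P.-integrable setT (EFin \o f).
Proof. by move=> mf fM; apply: bounded_meas_integrable; split => //; exists M. Qed.

Lemma Rintegral_norm_le (f : T -> R) (M : R) : measurable_fun setT f ->
  (forall w, `|f w| <= M) -> `|\int[P]_w f w| <= M.
Proof.
move=> mf fM; have fi := bounded_meas_norm_le mf fM.
apply: (le_trans (le_normr_Rintegral measurableT fi)).
rewrite -[leRHS](Rintegral_prob_cst P M); apply: le_Rintegral => //.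
  by have := integrable_abse fi.
exact: finite_measure_integrable_cst.
Qed.

Lemma Rintegral_dist_le (f g h : T -> R) :
  P.-integrable setT (EFin \o f) -> P.-integrable setT (EFin \o g) ->
  P.-integrable setT (EFin \o h) ->
  (forall w, `|f w - g w| <= h w) ->
  `|\int[P]_w f w - \int[P]_w g w| <= \int[P]_w h w.
Proof.
move=> fi gi hi fg; rewrite -RintegralB//.
have fgi : P.-integrable setT (EFin \o (fun w => f w - g w)).
  by have := integrableB measurableT fi gi.
apply: (le_trans (le_normr_Rintegral measurableT fgi)).
by apply: le_Rintegral => //; have := integrable_abse fgi.
Qed.

End bounded_integrals.

Section bounded_Fubini.
Context {R : realType} {d d' : measure_display}.
Context {T : measurableType d} {T' : measurableType d'}.
Variables (P : probability T R) (P' : probability T' R).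
Variables (g : T * T' -> R) (M : R).
Hypothesis mg : measurable_fun setT g.
Hypothesis gM : forall z, `|g z| <= M.

Let PP : probability (T * T')%type R := (P \x P')%E.

Let gi : PP.-integrable setT (EFin \o g).
Proof. exact: bounded_meas_norm_le gM. Qed.

Let g1i w : P'.-integrable setT (EFin \o (fun w' => g (w, w'))).
Proof.
by apply: (@bounded_meas_norm_le _ _ _ _ _ M) => //; exact: measurableT_comp.
Qed.

Let g2i w' : P.-integrable setT (EFin \o (fun w => g (w, w'))).
Proof.
by apply: (@bounded_meas_norm_le _ _ _ _ _ M) => //; exact: measurableT_comp.
Qed.

Let E1 w : (\int[P']_w' (g (w, w'))%:E)%E = (\int[P']_w' g (w, w'))%:E.
Proof.
rewrite /Rintegral fineK//.
exact: (integrable_fin_num measurableT (g1i w)).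
Qed.

Let E2 w' : (\int[P]_w (g (w, w'))%:E)%E = (\int[P]_w g (w, w'))%:E.
Proof.
rewrite /Rintegral fineK//.
exact: (integrable_fin_num measurableT (g2i w')).
Qed.

Lemma bounded_Fubini_measurable :
  measurable_fun setT (fun w => \int[P']_w' g (w, w')).
Proof.
apply/measurable_EFinP.
have := measurable_fubini_F gi; apply: eq_measurable_fun => w _.
by rewrite /fubini_F/= E1.
Qed.

Lemma bounded_Fubini :
  \int[P]_w \int[P']_w' g (w, w') = \int[P']_w' \int[P]_w g (w, w').
Proof.
rewrite /Rintegral; congr fine.
transitivity (\int[P]_w \int[P']_w' (g (w, w'))%:E)%E.
  by apply: eq_integral => w _; rewrite E1.
rewrite (Fubini gi).
by apply: eq_integral => w' _; rewrite /= E2.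
Qed.

End bounded_Fubini.

(** * The central limit theorem *)

Section walks.
Context {R : realType} {d d' : measure_display}.
Context {T : measurableType d} {T' : measurableType d'}.

Lemma independent_pair_Rintegral (P : probability T R) (P' : probability T' R)
    (X Y : T -> R) (Y' : T' -> R) (h : R * R -> R) (M : R) :
  measurable_fun setT X -> measurable_fun setT Y -> measurable_fun setT Y' ->
  (forall A B, measurable A -> measurable B ->
    P (X @^-1` A `&` Y @^-1` B) = (P (X @^-1` A) * P (Y @^-1` B))%E) ->
  same_law P P' Y Y' ->
  measurable_fun setT h -> (forall z, `|h z| <= M) ->
  \int[P]_w h (X w, Y w) = \int[P]_w \int[P']_w' h (X w, Y' w').
Proof.
move=> mX mY mY' XY YY' mh hM; rewrite /Rintegral; congr fine.
rewrite (@independent_pair_Fubini _ _ _ _ _ _ _ _ _ P P' X Y Y' h M)//.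
  apply: eq_integral => w _; rewrite fineK//; apply: integrable_fin_num => //.
  apply: (@bounded_meas_norm_le _ _ _ _ _ M) => //.
  by apply: measurableT_comp => //; exact: measurable_fun_pair.
by move=> A B mA mB; rewrite XY// YY'.
Qed.

End walks.

(** Only what one exchange uses is recorded: the position at time [k] is independent of the next
    step, which has the law of [xi]. *)
Definition random_walk (R : realType) d (T : measurableType d)
    (P : probability T R) (n : nat) (S : nat -> T -> R) (xi : T -> R) :=
  [/\ forall w, S 0%N w = 0, forall k, (k <= n)%N -> measurable_fun setT (S k),
    forall k, (k < n)%N -> forall A B, measurable A -> measurable B ->
      P (S k @^-1` A `&` (fun w => S k.+1 w - S k w)%R @^-1` B) =
      (P (S k @^-1` A) * P ((fun w => S k.+1 w - S k w)%R @^-1` B))%E &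
    forall k, (k < n)%N -> same_law P P (fun w => S k.+1 w - S k w) xi].

Section lindeberg.
Context {R : realType} {d d' : measure_display}.
Context {T : measurableType d} {T' : measurableType d'}.
Variables (P : probability T R) (P' : probability T' R).

(** Induction on the number of steps. The bound is uniform in the starting point [x], so that a step
    already exchanged can be absorbed into [x] before the induction hypothesis is applied. *)
Lemma lindeberg_exchange (n : nat) (S : nat -> T -> R) (xi : T -> R)
    (Z : nat -> T' -> R) (eta : T' -> R) (f : R -> R) (M e : R) :
  random_walk P n S xi -> random_walk P' n Z eta ->
  measurable_fun setT xi -> measurable_fun setT eta ->
  measurable_fun setT f -> (forall x, `|f x| <= M) ->
  (forall x, `|\int[P]_w f (x + xi w) - \int[P']_w f (x + eta w)| <= e) ->
  forall k x, (k <= n)%N ->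
    `|\int[P]_w f (x + S k w) - \int[P']_w f (x + Z k w)| <= k%:R * e.
Proof.
move=> [S0 mS iS lS] [Z0 mZ iZ lZ] mxi meta mf fM step.
have mf3 x : measurable_fun setT (fun z : R * R => f (x + (z.1 + z.2))).
  apply: measurableT_comp => //; apply: measurable_funD => //.
  exact: measurable_funD.
elim=> [|k IH] x kn.
  under eq_Rintegral do rewrite S0; under [X in _ - X]eq_Rintegral do rewrite Z0.
  by rewrite !Rintegral_prob_cst subrr normr0 mul0r.
have SE : \int[P]_w f (x + S k.+1 w) =
    \int[P]_w \int[P]_w' f (x + S k w + xi w').
  have E := @independent_pair_Rintegral _ _ _ _ _ P P (S k)
    (fun w => S k.+1 w - S k w) xi (fun z => f (x + (z.1 + z.2))) M (mS _ (ltnW kn))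
    (measurable_funB (mS _ kn) (mS _ (ltnW kn))) mxi (iS k kn) (lS k kn) (mf3 x)
    (fun z => fM _).
  apply: etrans (etrans E _); apply: eq_Rintegral => w _ /=.
    by rewrite subrKC.
  by apply: eq_Rintegral => w' _; rewrite addrA.
have ZE : \int[P']_w f (x + Z k.+1 w) =
    \int[P']_w \int[P']_w' f (x + eta w' + Z k w).
  have E := @independent_pair_Rintegral _ _ _ _ _ P' P' (Z k)
    (fun w => Z k.+1 w - Z k w) eta (fun z => f (x + (z.1 + z.2))) M (mZ _ (ltnW kn))
    (measurable_funB (mZ _ kn) (mZ _ (ltnW kn))) meta (iZ k kn) (lZ k kn) (mf3 x)
    (fun z => fM _).
  apply: etrans (etrans E _); apply: eq_Rintegral => w _ /=.
    by rewrite subrKC.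
  by apply: eq_Rintegral => w' _; congr f; ring.
have kn' := ltnW kn.
have mg1 : measurable_fun setT (fun z : T * T => f (x + S k z.1 + xi z.2)).
  apply: measurableT_comp => //; apply: measurable_funD.
    by apply: measurable_funD => //; apply: measurableT_comp => //; exact: mS.
  exact: measurableT_comp.
have mg2 : measurable_fun setT (fun z : T * T' => f (x + S k z.1 + eta z.2)).
  apply: measurableT_comp => //; apply: measurable_funD.
    by apply: measurable_funD => //; apply: measurableT_comp => //; exact: mS.
  exact: measurableT_comp.
have mg3 : measurable_fun setT (fun z : T' * T' => f (x + eta z.2 + Z k z.1)).
  apply: measurableT_comp => //; apply: measurable_funD.
    by apply: measurable_funD => //; exact: measurableT_comp.
  by apply: measurableT_comp => //; exact: mZ.
have mg2' : measurable_fun setT (fun z : T' * T => f (x + S k z.2 + eta z.1)).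
  apply: measurableT_comp => //; apply: measurable_funD.
    by apply: measurable_funD => //; apply: measurableT_comp => //; exact: mS.
  exact: measurableT_comp.
have mg3' : measurable_fun setT (fun z : T' * T' => f (x + eta z.1 + Z k z.2)).
  apply: measurableT_comp => //; apply: measurable_funD.
    by apply: measurable_funD => //; exact: measurableT_comp.
  by apply: measurableT_comp => //; exact: mZ.
(* The walk [S] for [k] steps, followed by one step of [Z]. Exchanging the last step costs [e];
   integrating over [eta] last, the induction hypothesis at [x + eta] costs [k%:R * e]. *)
pose mid := \int[P]_w \int[P']_w' f (x + S k w + eta w').
have b1 d1 (T1 : measurableType d1) (Q : probability T1 R) (u : T1 -> R) :
    measurable_fun setT u -> forall y, `|\int[Q]_w f (y + u w)| <= M.
  move=> mu y; apply: Rintegral_norm_le => //; apply: measurableT_comp => //.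
  exact: measurable_funD.
have h1 : `|\int[P]_w f (x + S k.+1 w) - mid| <= e.
  rewrite SE /mid -[leRHS](Rintegral_prob_cst P e); apply: Rintegral_dist_le.
  - apply: (@bounded_meas_norm_le _ _ _ _ _ M).
      exact: (bounded_Fubini_measurable P P mg1 (fun z => fM _)).
    by move=> w; exact: b1.
  - apply: (@bounded_meas_norm_le _ _ _ _ _ M).
      exact: (bounded_Fubini_measurable P P' mg2 (fun z => fM _)).
    by move=> w; exact: b1.
  - exact: finite_measure_integrable_cst.
  - by move=> w; exact: step.
have h2 : `|mid - \int[P']_w f (x + Z k.+1 w)| <= k%:R * e.
  rewrite ZE /mid (bounded_Fubini P P' mg2 (fun z => fM _)).
  rewrite (bounded_Fubini P' P' mg3 (fun z => fM _))/=.
  rewrite -[leRHS](Rintegral_prob_cst P'); apply: Rintegral_dist_le.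
  - apply: (@bounded_meas_norm_le _ _ _ _ _ M).
      exact: (bounded_Fubini_measurable P' P mg2' (fun z => fM _)).
    move=> w; under eq_Rintegral do rewrite addrAC.
    by apply: b1; exact: mS.
  - apply: (@bounded_meas_norm_le _ _ _ _ _ M).
      exact: (bounded_Fubini_measurable P' P' mg3' (fun z => fM _)).
    by move=> w; apply: b1; exact: mZ.
  - exact: finite_measure_integrable_cst.
  - move=> w; under eq_Rintegral do rewrite addrAC.
    exact: IH.
rewrite -natr1 mulrDl mul1r [leRHS]addrC.
apply: le_trans (lerD h1 h2); rewrite -[X in `|X|](subrKA mid).
exact: ler_normD.
Qed.

End lindeberg.

(** * Test functions with a second-order Taylor expansion *)

Section smooth_functions.
Context {R : realType}.

(** The expansion itself is required in place of derivatives: [a] stands for f' and [b] for f''/2,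
    with a cubic remainder that is uniform in [x]. *)
Definition smooth (f : R -> R) : Prop :=
  [/\ measurable_fun setT f, exists M, forall x, `|f x| <= M &
  exists (a b : R -> R) (A B C : R), [/\ forall x, `|a x| <= A,
    forall x, `|b x| <= B &
    forall x u, `|f (x + u) - f x - a x * u - b x * u ^+ 2| <= C * `|u| ^+ 3]].

Lemma smoothB f g : smooth f -> smooth g -> smooth (fun x => f x - g x).
Proof.
move=> [mf [M fM] [a [b [A [B [C [aA bB fC]]]]]]].
move=> [mg [M' gM] [a' [b' [A' [B' [C' [aA' bB' gC]]]]]]]; split.
- exact: measurable_funB.
- by exists (M + M') => x; rewrite (le_trans (ler_normB _ _))// lerD.
- exists (fun x => a x - a' x), (fun x => b x - b' x), (A + A'), (B + B'), (C + C').
  split.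
  + by move=> x; rewrite (le_trans (ler_normB _ _))// lerD.
  + by move=> x; rewrite (le_trans (ler_normB _ _))// lerD.
  + move=> x u; rewrite [leRHS]mulrDl.
    apply: le_trans (lerD (fC x u) (gC x u)).
    apply: le_trans (ler_normB _ _).
    by rewrite le_eqVlt; apply/orP; left; apply/eqP; congr `|_|; ring.
Qed.

Lemma smooth_affine f (c e : R) : smooth f -> smooth (fun x => f (c * x + e)).
Proof.
move=> [mf [M fM] [a [b [A [B [C [aA bB fC]]]]]]]; split.
- have mh : measurable_fun setT (fun x : R => c * x + e).
    by apply: measurable_funD => //; exact: measurable_funM.
  exact: measurableT_comp mf mh.
- by exists M => x.
- exists (fun x => c * a (c * x + e)), (fun x => c ^+ 2 * b (c * x + e)).
  exists (`|c| * A), (`|c| ^+ 2 * B), (`|c| ^+ 3 * C); split.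
  + by move=> x; rewrite normrM ler_wpM2l.
  + by move=> x; rewrite normrM normrX ler_wpM2l ?exprn_ge0.
  + move=> x u; have := fC (c * x + e) (c * u).
    have -> : C * `|c * u| ^+ 3 = `|c| ^+ 3 * C * `|u| ^+ 3.
      by rewrite normrM exprMn; ring.
    apply: le_trans.
    rewrite le_eqVlt; apply/orP; left; apply/eqP; congr `|_|.
    rewrite (_ : c * (x + u) + e = c * x + e + c * u); last by ring.
    by rewrite !exprMn; ring.
Qed.

Lemma smooth_lipschitz f : smooth f ->
  exists2 L, 0 <= L & forall x y, `|f x - f y| <= L * `|x - y|.
Proof.
move=> [_ [M fM] [a [b [A [B [C [aA bB fC]]]]]]].
have M0 : 0 <= M by exact: le_trans (fM 0).
have A0 : 0 <= A by exact: le_trans (aA 0).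
have B0 : 0 <= B by exact: le_trans (bB 0).
have C0 : 0 <= C.
  have := le_trans (normr_ge0 _) (fC 0 1).
  by rewrite normr1 expr1n mulr1.
exists (A + B + C + 2 * M); first by rewrite !addr_ge0// mulr_ge0.
move=> x y; set u := x - y; have -> : x = y + u by rewrite /u subrKC.
have n0 := normr_ge0 u.
have [u1|u1] := leP `|u| 1.
- have := fC y u; set r := _ - _ - _ => hr.
  have -> : f (y + u) - f y = r + (a y * u + b y * u ^+ 2) by rewrite /r; ring.
  have h1 : `|a y * u| <= A * `|u| by rewrite normrM ler_wpM2r.
  have u2 : `|u| ^+ 2 <= `|u| by rewrite expr2 ler_piMr.
  have u3 : `|u| ^+ 3 <= `|u| by rewrite exprS ler_piMr// exprn_ile1.
  have h2 : `|b y * u ^+ 2| <= B * `|u|.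
    by rewrite normrM normrX ler_pM// ?exprn_ge0.
  have h3 : `|r| <= C * `|u| by apply: (le_trans hr); rewrite ler_wpM2l.
  apply: (le_trans (ler_normD _ _)); have := ler_normD (a y * u) (b y * u ^+ 2).
  have : 0 <= 2 * M * `|u| by rewrite !mulr_ge0.
  by lra.
- apply: (le_trans (ler_normB _ _)); have := fM (y + u); have := fM y.
  have : M * 1 <= M * `|u| by rewrite ler_wpM2l// ltW.
  have : 0 <= (A + B + C) * `|u| by rewrite mulr_ge0// !addr_ge0.
  by lra.
Qed.

(** The cubic remainder is the good one for small steps, but increments of V have only two moments;
    for |u| > 1 every term of the expansion is at most a multiple of u^2. *)
Lemma smooth_taylor f : smooth f -> exists (a b : R -> R) (C : R), 0 <= C /\
  forall x u, `|f (x + u) - f x - a x * u - b x * u ^+ 2| <=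
    C * Num.min (u ^+ 2) (`|u| ^+ 3).
Proof.
move=> [_ [M fM] [a [b [A [B [C [aA bB fC]]]]]]].
have M0 : 0 <= M by exact: le_trans (fM 0).
have A0 : 0 <= A by exact: le_trans (aA 0).
have B0 : 0 <= B by exact: le_trans (bB 0).
have C0 : 0 <= C.
  have := le_trans (normr_ge0 _) (fC 0 1).
  by rewrite normr1 expr1n mulr1.
exists a, b, (A + B + C + 2 * M); split; first by rewrite !addr_ge0// mulr_ge0.
move=> x u; have n0 := normr_ge0 u.
have usq : u ^+ 2 = `|u| ^+ 2 by rewrite real_normK ?num_real.
have [u1|u1] := leP `|u| 1.
- have -> : Num.min (u ^+ 2) (`|u| ^+ 3) = `|u| ^+ 3.
    by apply/min_idPr; rewrite usq exprS ler_piMl// exprn_ge0.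
  apply: (le_trans (fC x u)); rewrite ler_wpM2r ?exprn_ge0//; lra.
- have -> : Num.min (u ^+ 2) (`|u| ^+ 3) = u ^+ 2.
    by apply/min_idPl; rewrite usq [leRHS]exprS ler_peMl ?exprn_ge0// ltW.
  have h1 : `|a x * u| <= A * u ^+ 2.
    by rewrite normrM usq ler_pM// expr2 ler_peMl// ltW.
  have h2 : `|b x * u ^+ 2| <= B * u ^+ 2.
    by rewrite normrM (ger0_norm (sqr_ge0 u)) ler_wpM2r ?sqr_ge0.
  have h3 : M * 1 <= M * u ^+ 2.
    by rewrite ler_wpM2l// usq exprn_ege1// ltW.
  have h4 : 0 <= C * u ^+ 2 by rewrite mulr_ge0// sqr_ge0.
  have := fM (x + u); have := fM x.
  have := ler_normB (f (x + u) - f x - a x * u) (b x * u ^+ 2).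
  have := ler_normB (f (x + u) - f x) (a x * u).
  have := ler_normB (f (x + u)) (f x).
  by lra.
Qed.

Let S (y : R) : R := y ^+ 3 * (10 - 15 * y + 6 * y ^+ 2).

(* [y ^ 3 * (10 - 15 y + 6 y ^ 2)] has vanishing first and second derivatives at
   0 and at 1. *)
Definition smoothstep (x : R) : R :=
  let y := Num.max 0 (Num.min x 1) in y ^+ 3 * (10 - 15 * y + 6 * y ^+ 2).

Let clamp (x : R) : R := Num.max 0 (Num.min x 1).

Let clamp_itv (x : R) : 0 <= clamp x <= 1.
Proof.
by rewrite /clamp le_max lexx/= ge_max ler01/= ge_min lexx orbT.
Qed.

Let clampP (x : R) : [\/ x <= 0 /\ clamp x = 0, 1 <= x /\ clamp x = 1 |
  0 <= x /\ x <= 1 /\ clamp x = x].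
Proof.
rewrite /clamp; have [x0|x0] := leP x 0.
  constructor 1; split=> //; apply/max_idPl; rewrite ge_min x0//.
have [x1|x1] := leP 1 x.
  constructor 2; split=> //; exact/max_idPr.
constructor 3; split; [exact: ltW|split; first exact: ltW].
by apply/max_idPr/ltW.
Qed.

Lemma smoothstep_le0 (x : R) : x <= 0 -> smoothstep x = 0.
Proof.
move=> x0; rewrite /smoothstep -/(clamp x); case: (clampP x) => [[_ ->]|[x1]|].
- by rewrite expr0n mul0r.
- lra.
- move=> [x0' [_ ->]]; have -> : x = 0 by lra.
  by rewrite exprS !mul0r.
Qed.

Lemma smoothstep_ge1 (x : R) : 1 <= x -> smoothstep x = 1.
Proof.
move=> x0; rewrite /smoothstep -/(clamp x); case: (clampP x) => [[? ?]|[_ ->]|].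
- lra.
- ring.
- move=> [_ [x1 ->]]; have -> : x = 1 by lra.
  ring.
Qed.

Lemma smoothstep_itv (x : R) : 0 <= smoothstep x <= 1.
Proof.
rewrite /smoothstep -/(clamp x); have := clamp_itv x; move: (clamp x) => y /andP[y0 y1].
have h (z : R) : 0 <= 10 - 15 * z + 6 * z ^+ 2.
  have -> : 10 - 15 * z + 6 * z ^+ 2 = 6 * (z - 5 / 4) ^+ 2 + 5 / 8 by field.
  by have := sqr_ge0 (z - 5 / 4); lra.
apply/andP; split; first by rewrite mulr_ge0// exprn_ge0.
have y1' : 0 <= 1 - y by lra.
have := mulr_ge0 (exprn_ge0 3 y1') (h (1 - y)).
have -> : (1 - y) ^+ 3 * (10 - 15 * (1 - y) + 6 * (1 - y) ^+ 2) =
  1 - y ^+ 3 * (10 - 15 * y + 6 * y ^+ 2) by ring.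
by lra.
Qed.

(** [S1] is the derivative of [S], and [S2] is half its second derivative. *)
Let S1 (p : R) := 30 * p ^+ 2 * (1 - p) ^+ 2.
Let S2 (p : R) := 30 * (p * (1 - p) * (1 - 2 * p)).

Let S_taylor (p q : R) : 0 <= p <= 1 -> 0 <= q <= 1 ->
  `|S q - S p - S1 p * (q - p) - S2 p * (q - p) ^+ 2| <= 200 * `|q - p| ^+ 3.
Proof.
move=> /andP[p0 p1] /andP[q0 q1].
have -> : S q - S p - S1 p * (q - p) - S2 p * (q - p) ^+ 2 =
    (q - p) ^+ 3 * (10 - 60 * p + 60 * p ^+ 2 + (- 15 + 30 * p) * (q - p) +
      6 * (q - p) ^+ 2) by rewrite /S /S1 /S2; ring.
rewrite normrM normrX mulrC ler_wpM2r ?exprn_ge0//.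
have pp : 0 <= p ^+ 2 <= 1 by rewrite sqr_ge0 exprn_ile1.
have v1 : `|q - p| <= 1 by rewrite ler_norml; apply/andP; split; lra.
have v2 : (q - p) ^+ 2 <= 1.
  by rewrite -real_normK ?num_real// exprn_ile1.
have v20 := sqr_ge0 (q - p).
have h : `|(- 15 + 30 * p) * (q - p)| <= 15.
  rewrite normrM -[leRHS]mulr1 ler_pM// ler_norml; apply/andP; split; lra.
move: h; rewrite !ler_norml => /andP[h1 h2]; apply/andP; split; lra.
Qed.

Lemma smooth_smoothstep : smooth smoothstep.
Proof.
have mc : measurable_fun setT clamp.
  by apply: measurable_maxr => //; exact: measurable_minr.
split.
- rewrite (_ : smoothstep = (fun x => clamp x ^+ 3 *
    (10 - 15 * clamp x + 6 * clamp x ^+ 2)))//.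
  apply: measurable_funM; first exact: measurable_funX.
  apply: measurable_funD.
    by apply: measurable_funB => //; exact: measurable_funM.
  by apply: measurable_funM => //; exact: measurable_funX.
- exists 1 => x; have /andP[h0 h1] := smoothstep_itv x.
  by rewrite ger0_norm.
- exists (fun x => S1 (clamp x)), (fun x => S2 (clamp x)), 30, 30, 300; split.
  + move=> x; have /andP[c0 c1] := clamp_itv x.
    have d0 : 0 <= 1 - clamp x by lra.
    have d1 : 1 - clamp x <= 1 by lra.
    have cd : clamp x ^+ 2 * (1 - clamp x) ^+ 2 <= 1.
      by rewrite mulr_ile1 ?sqr_ge0// exprn_ile1.
    rewrite /S1 -mulrA ger0_norm ?mulr_ge0 ?sqr_ge0//.
    by rewrite -[leRHS]mulr1 ler_wpM2l.
  + move=> x; have /andP[c0 c1] := clamp_itv x.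
    rewrite /S2 normrM ger0_norm// ler_piMr// !normrM.
    have h1 : `|clamp x| <= 1 by rewrite ger0_norm.
    have h2 : `|1 - clamp x| <= 1 by rewrite ger0_norm; lra.
    have h3 : `|1 - 2 * clamp x| <= 1 by rewrite ler_norml; apply/andP; split; lra.
    by rewrite !mulr_ile1// mulr_ge0.
  + move=> x u; set p := clamp x; set q := clamp (x + u).
    have pI : 0 <= p <= 1 := clamp_itv x; have qI : 0 <= q <= 1 := clamp_itv (x + u).
    have -> : smoothstep (x + u) = S q by [].
    have -> : smoothstep x = S p by [].
    have lip : `|q - p| <= `|u|.
      rewrite /p /q; case: (clampP x) => [[? ->]|[? ->]|[? [? ->]]];
      case: (clampP (x + u)) => [[? ->]|[? ->]|[? [? ->]]];
      rewrite ?subrr ?normr0// ler_norml; apply/andP;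
      have := ler_norm u; have := ler_norm (- u); rewrite normrN => ? ?; split; lra.
    have St : `|S q - S p - S1 p * (q - p) - S2 p * (q - p) ^+ 2| <=
        200 * `|u| ^+ 3.
      apply: (le_trans (S_taylor pI qI)).
      rewrite ler_wpM2l// lerXn2r ?nnegrE//.
    have S10 : S1 0 = 0 by rewrite /S1 expr0n/= mulr0 mul0r.
    have S11 : S1 1 = 0 by rewrite /S1 subrr expr0n/= mulr0.
    have S20 : S2 0 = 0 by rewrite /S2 mul0r mul0r mulr0.
    have S21 : S2 1 = 0 by rewrite /S2 subrr mulr0 mul0r mulr0.
    have fin : `|S1 p * (q - p - u)| <= 30 * `|u| ^+ 3 ->
        `|S2 p * ((q - p) ^+ 2 - u ^+ 2)| <= 30 * `|u| ^+ 3 ->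
        `|S q - S p - S1 p * u - S2 p * u ^+ 2| <= 300 * `|u| ^+ 3.
      move=> h1 h2.
      have -> : S q - S p - S1 p * u - S2 p * u ^+ 2 =
        (S q - S p - S1 p * (q - p) - S2 p * (q - p) ^+ 2) +
        (S1 p * (q - p - u) + S2 p * ((q - p) ^+ 2 - u ^+ 2)) by ring.
      apply: (le_trans (ler_normD _ _)).
      have := ler_normD (S1 p * (q - p - u)) (S2 p * ((q - p) ^+ 2 - u ^+ 2)).
      have := exprn_ge0 3 (normr_ge0 u).
      by lra.
    have u30 : 0 <= 30 * `|u| ^+ 3 by rewrite mulr_ge0// exprn_ge0.
    case: (clampP x) => [[x0 pE]|[x1 pE]|[x0 [x1 pE]]].
    * by apply: fin; rewrite /p pE ?S10 ?S20 mul0r normr0.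
    * by apply: fin; rewrite /p pE ?S11 ?S21 mul0r normr0.
    (* If clamping moves [x + u] but not [x], an endpoint of [0,1] lies within |u| of [p]. There
       [S1] vanishes to second order and [S2] to first, so replacing [q - p] by [u] in the expansion
       costs O(|u|^3). *)
    have edge : q - p = u \/ (`|S1 p| <= 30 * `|u| ^+ 2 /\ `|S2 p| <= 30 * `|u| /\
        `|q - p - u| <= `|u|).
      have gen (t s : R) : 0 <= t -> t <= 1 -> t + s = 1 -> t <= `|u| ->
          `|30 * (t ^+ 2 * s ^+ 2)| <= 30 * `|u| ^+ 2 /\
          `|30 * (t * (s * (s - t)))| <= 30 * `|u|.
        move=> t0 t1 ts tu; have s0 : 0 <= s by lra.
        have s1 : s <= 1 by lra.
        split.
          rewrite ger0_norm ?mulr_ge0 ?sqr_ge0// ler_pM2l//.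
          rewrite -[leRHS]mulr1 ler_pM ?sqr_ge0// ?exprn_ile1//.
          by rewrite lerXn2r ?nnegrE.
        rewrite normrM (ger0_norm (_ : 0 <= 30))// ler_pM2l//.
        rewrite normrM (ger0_norm t0) -[leRHS]mulr1 ler_pM//.
        rewrite normrM (ger0_norm s0) mulr_ile1//.
        by rewrite ler_norml; apply/andP; split; lra.
      have px : p = x by rewrite /p pE.
      have p0 : 0 <= p by rewrite px.
      have p1 : p <= 1 by rewrite px.
      have nu := ler_norm u; have nNu := ler_norm (- u); rewrite normrN in nNu.
      case: (clampP (x + u)) => [[y0 qE]|[y1 qE]|[y0 [y1 qE]]].
      - right; have -> : q = 0 by rewrite /q qE.
        have ps : p + (1 - p) = 1 by ring.
        have pu : p <= `|u| by lra.
        have [h1 h2] := gen p (1 - p) p0 p1 ps pu.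
        split; first by rewrite /S1 -mulrA.
        split.
          move: h2; rewrite /S2; congr (`|_| <= _); ring.
        have u0 : u <= 0 by lra.
        by rewrite (ler0_norm u0) ler_norml; apply/andP; split; lra.
      - right; have -> : q = 1 by rewrite /q qE.
        have ps : 1 - p + p = 1 by ring.
        have pu : 1 - p <= `|u| by lra.
        have q0 : 0 <= 1 - p by lra.
        have q1 : 1 - p <= 1 by lra.
        have [h1 h2] := gen (1 - p) p q0 q1 ps pu.
        split.
          move: h1; rewrite /S1; congr (`|_| <= _); ring.
        split.
          move: h2; rewrite -normrN /S2; congr (`|_| <= _); ring.
        have u0 : 0 <= u by lra.
        by rewrite (ger0_norm u0) ler_norml; apply/andP; split; lra.
      - by left; rewrite /q /p qE pE; ring.
    case: edge => [e|[h1 [h2 h3]]].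
      by apply: fin; rewrite e subrr mulr0 normr0.
    apply: fin.
      by rewrite normrM exprSr mulrA ler_pM.
    have h4 : `|(q - p) ^+ 2 - u ^+ 2| <= `|u| ^+ 2.
      have := sqr_ge0 (q - p); have : (q - p) ^+ 2 <= `|u| ^+ 2.
        by rewrite -(real_normK (num_real (q - p))) lerXn2r ?nnegrE.
      rewrite real_normK ?num_real// => k1 k2.
      by rewrite ler_norml; apply/andP; split; lra.
    by rewrite normrM exprS mulrA ler_pM.
Qed.

End smooth_functions.

Section dominated.
Context {R : realType} {d : measure_display} {T : measurableType d}.
Variable P : probability T R.

Lemma Rintegral_dominated_cvg_ae (f_ : nat -> T -> R) (f g : T -> R) :
  (forall n, measurable_fun setT (f_ n)) -> measurable_fun setT f ->
  P.-integrable setT (EFin \o g) ->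
  {ae P, forall w, f_ n w @[n --> \oo] --> f w} ->
  (forall n w, `|f_ n w| <= g w) ->
  \int[P]_w f_ n w @[n --> \oo] --> \int[P]_w f w.
Proof.
move=> mf_ mf gi cf fg.
have mE_ n : measurable_fun setT (fun w => (f_ n w)%:E).
  exact/measurable_EFinP.
have mE : measurable_fun setT (fun w => (f w)%:E) by exact/measurable_EFinP.
have cE : {ae P, forall w, setT w -> (f_ n w)%:E @[n --> \oo] --> (f w)%:E}.
  by apply: filterS cf => w cw _; apply: cvg_EFin; [exact: nearW|exact: cw].
have gE : {ae P, forall w n, setT w -> (`|(f_ n w)%:E| <= (g w)%:E)%E}.
  by apply: aeW => w n _; exact: fg.
have [fi _ h] := dominated_convergence measurableT mE_ mE cE gi gE.
apply: fine_cvg; rewrite fineK//.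
exact: (integrable_fin_num measurableT fi).
Qed.

Lemma Rintegral_dominated_cvg (f_ : nat -> T -> R) (f g : T -> R) :
  (forall n, measurable_fun setT (f_ n)) -> measurable_fun setT f ->
  P.-integrable setT (EFin \o g) ->
  (forall w, f_ n w @[n --> \oo] --> f w) ->
  (forall n w, `|f_ n w| <= g w) ->
  \int[P]_w f_ n w @[n --> \oo] --> \int[P]_w f w.
Proof.
by move=> mf_ mf gi cf; apply: (Rintegral_dominated_cvg_ae mf_ mf gi); exact: aeW.
Qed.

End dominated.

Definition kappa (R : realType) (u : R) : R := Num.min (u ^+ 2) (`|u| ^+ 3).

Section taylor_expectation.
Context {R : realType} {d : measure_display} {T : measurableType d}.

Lemma kappa_ge0 (u : R) : 0 <= kappa u.
Proof. by rewrite /kappa le_min sqr_ge0 exprn_ge0. Qed.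

Lemma measurable_kappa : measurable_fun setT (@kappa R).
Proof.
apply: measurable_minr; first exact: measurable_funX.
by apply: measurable_funX; exact: normr_measurable.
Qed.

Lemma integrable_kappa (P : probability T R) (xi : T -> R) :
  measurable_fun setT xi ->
  P.-integrable setT (EFin \o (fun w => xi w ^+ 2)) ->
  P.-integrable setT (EFin \o (fun w => kappa (xi w))).
Proof.
move=> mxi i2; apply: le_integrable i2 => //.
  by apply/measurable_EFinP; apply: measurableT_comp => //; exact: measurable_kappa.
move=> w _ /=; rewrite lee_fin ger0_norm ?kappa_ge0// ger0_norm ?sqr_ge0//.
by rewrite /kappa ge_min lexx.
Qed.

Lemma taylor_expectation (P : probability T R) (xi : T -> R) (f a b : R -> R)
    (M C : R) : measurable_fun setT f -> (forall x, `|f x| <= M) ->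
  (forall x u, `|f (x + u) - f x - a x * u - b x * u ^+ 2| <= C * kappa u) ->
  P.-integrable setT (EFin \o xi) -> \int[P]_w xi w = 0 ->
  P.-integrable setT (EFin \o (fun w => xi w ^+ 2)) ->
  forall x, `|\int[P]_w f (x + xi w) - (f x + b x * \int[P]_w (xi w ^+ 2))| <=
    C * \int[P]_w kappa (xi w).
Proof.
move=> mf fM fC i1 E1 i2 x.
have mxi : measurable_fun setT xi by exact/measurable_EFinP/(measurable_int P).
have ik := integrable_kappa mxi i2.
have i0 (c : R) : P.-integrable setT (EFin \o cst c).
  exact: finite_measure_integrable_cst.
have iax : P.-integrable setT (EFin \o (fun w => a x * xi w)).
  by have := integrableZl measurableT (a x) i1.
have ibx : P.-integrable setT (EFin \o (fun w => b x * xi w ^+ 2)).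
  by have := integrableZl measurableT (b x) i2.
have iab : P.-integrable setT (EFin \o (fun w => a x * xi w + b x * xi w ^+ 2)).
  by have := integrableD measurableT iax ibx.
have iq : P.-integrable setT
    (EFin \o (fun w => f x + (a x * xi w + b x * xi w ^+ 2))).
  by have := integrableD measurableT (i0 (f x)) iab.
have -> : f x + b x * \int[P]_w (xi w ^+ 2) =
    \int[P]_w (f x + (a x * xi w + b x * xi w ^+ 2)).
  rewrite (RintegralD measurableT (i0 (f x)) iab) Rintegral_prob_cst.
  by rewrite (RintegralD measurableT iax ibx) !RintegralZl// E1 mulr0 add0r.
rewrite -RintegralZl//; apply: Rintegral_dist_le => //.
- apply: (@bounded_meas_norm_le _ _ _ _ _ M) => //.
  by apply: measurableT_comp => //; exact: measurable_funD.
- by have := integrableZl measurableT C ik.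
- move=> w; apply: le_trans (fC x (xi w)).
  by rewrite le_eqVlt; apply/orP; left; apply/eqP; congr `|_|; ring.
Qed.

End taylor_expectation.

Section taylor_step.
Context {R : realType} {d d' : measure_display}.
Context {T : measurableType d} {T' : measurableType d'}.

(** Centered variables with equal variances have the same second-order expansion, so only the two
    remainders are left. The constant is chosen before the variables, since these will depend on the
    number of steps. *)
Lemma taylor_step (P : probability T R) (P' : probability T' R)
    (f : R -> R) : smooth f ->
  exists2 C, 0 <= C & forall (xi : T -> R) (eta : T' -> R),
  P.-integrable setT (EFin \o xi) -> \int[P]_w xi w = 0 ->
  P.-integrable setT (EFin \o (fun w => xi w ^+ 2)) ->
  P'.-integrable setT (EFin \o eta) -> \int[P']_w eta w = 0 ->
  P'.-integrable setT (EFin \o (fun w => eta w ^+ 2)) ->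
  \int[P]_w (xi w ^+ 2) = \int[P']_w (eta w ^+ 2) ->
  forall x, `|\int[P]_w f (x + xi w) - \int[P']_w f (x + eta w)| <=
    C * (\int[P]_w kappa (xi w) + \int[P']_w kappa (eta w)).
Proof.
move=> sf; have [mf [M fM] _] := sf; have [a [b [C [C0 fC]]]] := smooth_taylor sf.
exists C => // xi eta i1 E1 i2 i1' E1' i2' E2 x.
have h := taylor_expectation mf fM fC i1 E1 i2 x.
have h' := taylor_expectation mf fM fC i1' E1' i2' x.
rewrite E2 in h; rewrite mulrDr.
set m := f x + _ in h h'; rewrite distrC in h'.
rewrite -[X in `|X| <= _](subrKA m).
exact: le_trans (ler_normD _ _) (lerD h h').
Qed.

End taylor_step.

(** The finite-dimensional content of [standard_wiener], free of the path space; the value at 0 is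
    left open because only increments are compared. *)
Record brownian (R : realType) (d : measure_display) (T : measurableType d)
    (P : probability T R) (B : R -> T -> R) : Prop := Brownian {
  brownian_meas : forall t : R, 0 <= t -> t <= 1 -> measurable_fun setT (B t) ;
  brownian_independent : independent_increments P `[0, 1]%classic B ;
  brownian_normal : forall t u : R, 0 <= t -> t < u -> u <= 1 ->
    forall A : set R, measurable A ->
      P (increment B t u @^-1` A) = normal_prob 0 (Num.sqrt (u - t)) A }.

Section scaled_walk.
Context {R : realType} {d : measure_display} {T : measurableType d}.
Variable P : probability T R.

Lemma random_walk_scale (c : R) n (S : nat -> T -> R) (xi : T -> R) :
  random_walk P n S xi ->
  random_walk P n (fun k w => c * S k w) (fun w => c * xi w).
Proof.
have mc (A : set R) : measurable A -> measurable ((fun x => c * x) @^-1` A).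
  move=> mA; rewrite -[X in measurable X]setTI.
  have : measurable_fun setT (fun x : R => c * x) by exact: measurable_funM.
  by apply.
move=> [S0 mS iS lS]; split.
- by move=> w; rewrite S0 mulr0.
- by move=> k kn; apply: measurable_funM => //; exact: mS.
- move=> k kn A B mA mB.
  rewrite (_ : (fun w => c * S k.+1 w - c * S k w) =
    (fun x => c * x) \o (fun w => S k.+1 w - S k w)); last first.
    by apply/funext => w /=; ring.
  exact: (iS k kn _ _ (mc A mA) (mc B mB)).
- move=> k kn A mA.
  rewrite (_ : (fun w => c * S k.+1 w - c * S k w) =
    (fun x => c * x) \o (fun w => S k.+1 w - S k w)); last first.
    by apply/funext => w /=; ring.
  exact: (lS k kn _ (mc A mA)).
Qed.

End scaled_walk.

Section walks_of_processes.
Context {R : realType} {d : measure_display} {T : measurableType d}.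

Lemma levy_walk (P : probability T R) (V : R -> T -> R) (sigma : R) n :
  square_integrable_levy P V sigma ->
  random_walk P n (fun k => increment V 0 k%:R) (increment V 0 1).
Proof.
move=> lV; have e k : (fun w => increment V 0 k.+1%:R w - increment V 0 k%:R w) =
    increment V k%:R k.+1%:R.
  by apply/funext => w; rewrite /increment; ring.
split.
- by move=> w; rewrite /increment subrr.
- by move=> k kn; apply: (measurable_increment lV).
- move=> k kn A B mA mB; rewrite e.
  by apply: (levy_increments_pair lV) => //; rewrite ler_nat.
- move=> k kn A mA; rewrite e (same_law_increment lV)// ?ler_nat//.
  by rewrite -natr1 addrC addKr.
Qed.

Variables (P : probability T R) (B : R -> T -> R).
Hypothesis bB : brownian P B.

Lemma brownian_measurable_increment s t : 0 <= s -> s <= 1 -> 0 <= t -> t <= 1 ->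
  measurable_fun setT (increment B s t).
Proof. by move=> *; apply: measurable_funB; exact: (brownian_meas bB). Qed.

Lemma brownian_walk (t0 h : R) (n : nat) : 0 <= t0 -> 0 < h ->
  t0 + n%:R * h <= 1 ->
  random_walk P n (fun k => increment B t0 (t0 + k%:R * h))
    (increment B t0 (t0 + h)).
Proof.
move=> t00 h0 th1.
have e k : (fun w => increment B t0 (t0 + k.+1%:R * h) w -
    increment B t0 (t0 + k%:R * h) w) =
    increment B (t0 + k%:R * h) (t0 + k.+1%:R * h).
  by apply/funext => w; rewrite /increment; ring.
have le1 k : (k <= n)%N -> t0 + k%:R * h <= 1.
  move=> kn; apply: le_trans th1; rewrite lerD2l ler_pM2r// ler_nat//.
have ge0 k : 0 <= t0 + k%:R * h by rewrite addr_ge0// mulr_ge0// ltW.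
have t01 : t0 <= 1 by have := le1 0%N (leq0n n); rewrite mul0r addr0.
have lekS k : t0 + k%:R * h < t0 + k.+1%:R * h.
  by rewrite ltrD2l ltr_pM2r// ltr_nat.
split.
- by move=> w; rewrite mul0r addr0 /increment subrr.
- by move=> k kn; apply: brownian_measurable_increment => //; exact: le1.
- move=> k kn A C mA mC; rewrite e.
  apply: (increments_pair (brownian_independent bB)) => //=.
  + by rewrite in_itv/= t00.
  + by rewrite in_itv/= ge0 le1// ltnW.
  + by rewrite in_itv/= ge0 le1.
  + by rewrite lerDl mulr_ge0// ltW.
  + exact/ltW/lekS.
- move=> k kn A mA; rewrite e.
  have th : t0 + h <= 1.
    by have := le1 1%N (leq_ltn_trans (leq0n k) kn); rewrite mul1r.
  have tth : t0 < t0 + h by rewrite ltrDl.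
  rewrite (brownian_normal bB (ge0 k) (lekS k) (le1 _ kn) mA).
  rewrite (brownian_normal bB t00 tth th mA).
  have -> : t0 + k.+1%:R * h - (t0 + k%:R * h) = h by rewrite -natr1; ring.
  by have -> : t0 + h - t0 = h by ring.
Qed.

Lemma brownian_increment_moments t u : 0 <= t -> t < u -> u <= 1 ->
  [/\ P.-integrable setT (EFin \o increment B t u),
    \int[P]_w increment B t u w = 0,
    P.-integrable setT (EFin \o (fun w => increment B t u w ^+ 2)),
    \int[P]_w (increment B t u w ^+ 2) = u - t &
    P.-integrable setT (EFin \o (fun w => `|increment B t u w| ^+ 3)) /\
    \int[P]_w (`|increment B t u w| ^+ 3) <=
      12 * expR (2^-1) * (Num.sqrt (u - t)) ^+ 3].
Proof.
move=> t0 tu u1; have mI : measurable_fun setT (increment B t u).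
  by apply: brownian_measurable_increment => //; lra.
have s0 : 0 < Num.sqrt (u - t) by rewrite sqrtr_gt0 subr_gt0.
have law := brownian_normal bB t0 tu u1.
split.
- exact: (normal_integrable mI s0 law).
- exact: (normal_mean mI s0 law).
- exact: (normal_sq_integrable mI s0 law).
- by rewrite (normal_variance mI s0 law) sqr_sqrtr// subr_ge0 ltW.
- split; first exact: (normal_cube_integrable mI s0 law).
  exact: (normal_cube_le mI s0 law).
Qed.

End walks_of_processes.

Section clt.
Context {R : realType} {d d' : measure_display}.
Context {T : measurableType d} {T' : measurableType d'}.
Variables (P : probability T R) (V : R -> T -> R) (sigma : R).
Variables (P' : probability T' R) (B : R -> T' -> R).
Hypothesis lV : square_integrable_levy P V sigma.
Hypothesis bB : brownian P' B.

Lemma levy_increment1_moments :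
  [/\ P.-integrable setT (EFin \o increment V 0 1),
    \int[P]_w increment V 0 1 w = 0,
    P.-integrable setT (EFin \o (fun w => increment V 0 1 w ^+ 2)) &
    \int[P]_w (increment V 0 1 w ^+ 2) = sigma ^+ 2].
Proof.
have m2 := moment2_increment1 lV; split.
- exact: (integrable_increment lV).
- by rewrite /Rintegral (mean_increment lV).
- apply/integrableP; split.
    by apply/measurable_EFinP/measurable_funX; exact: (measurable_increment lV).
  under eq_integral do rewrite /= ger0_norm ?sqr_ge0//.
  by move: m2; rewrite /moment2 => ->; rewrite ltry.
- by rewrite /Rintegral; move: m2; rewrite /moment2 => ->.
Qed.

(** Unit increments of V scaled by [c n] are exchanged for sigma times increments of B over
    intervals of length [h / n.+1%:R]; both have variance [sigma ^+ 2 * c n ^+ 2]. It remains to see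
    that [n.+1] times the remainders tends to 0. *)
Lemma clt_nat (f : R -> R) (t0 h : R) : smooth f ->
  0 <= t0 -> 0 < h -> t0 + h <= 1 ->
  (\int[P]_w f (Num.sqrt (h / n.+1%:R) * increment V 0 n.+1%:R w))
    @[n --> \oo] --> \int[P']_w f (sigma * increment B t0 (t0 + h) w).
Proof.
move=> sf t00 h0 th1; have [mf [M fM] _] := sf.
have [C C0 step] := taylor_step P P' sf.
have [i1 E1 i2 E2] := levy_increment1_moments.
set D := increment V 0 1 in i1 E1 i2 E2.
have mD : measurable_fun setT D by exact: (measurable_increment lV).
pose c n : R := Num.sqrt (h / n.+1%:R).
have hn n : 0 < h / n.+1%:R :> R by rewrite divr_gt0.
have c0 n : 0 < c n by rewrite sqrtr_gt0.
have c2 n : c n ^+ 2 = h / n.+1%:R by rewrite sqr_sqrtr// ltW.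
have cvgc : c n @[n --> \oo] --> (0:R).
  have hs : h / n.+1%:R @[n --> \oo] --> (0:R).
    by rewrite -(mulr0 h); apply: cvgMr; exact: cvg_harmonic.
  rewrite -[X in _ --> X](@sqrtr0 R).
  apply: (@cvg_comp _ _ _ (fun n => h / n.+1%:R) Num.sqrt _ _ _ hs).
  exact: sqrt_continuous.
(* This is [n.+1] times the remainder for V. It tends to 0 pointwise and is dominated by
   [h * D w ^+ 2], so two moments suffice. The Gaussian counterpart is explicit, as
   [n.+1%:R * c n ^+ 3 = h * c n]. *)
pose g n w : R := h * Num.min (D w ^+ 2) (c n * `|D w| ^+ 3).
have mg n : measurable_fun setT (g n).
  apply: measurable_funM => //; apply: measurable_minr.
    exact: measurable_funX.
  by apply: measurable_funM => //; apply: measurable_funX; exact: measurableT_comp.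
have g0 n w : 0 <= g n w.
  apply: mulr_ge0; first exact: ltW.
  by rewrite le_min sqr_ge0/= mulr_ge0 ?exprn_ge0// ltW.
have ghD n w : g n w <= h * D w ^+ 2 by rewrite ler_pM2l// ge_min lexx.
have ihD : P.-integrable setT (EFin \o (fun w => h * D w ^+ 2)).
  by have := integrableZl measurableT h i2.
have cvgg : \int[P]_w g n w @[n --> \oo] --> (0:R).
  rewrite -[X in _ --> X](Rintegral_prob_cst P 0).
  apply: (Rintegral_dominated_cvg (g := fun w => h * D w ^+ 2)) => //.
  - move=> w.
    have up : h * (c n * `|D w| ^+ 3) @[n --> \oo] --> (0:R).
      rewrite -(mulr0 h) -(mul0r (`|D w| ^+ 3)).
      by apply: cvgMr; exact: cvgMl.
    have lo : (fun=> 0 : R) n @[n --> \oo] --> (0:R) by exact: cvg_cst.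
    apply: (squeeze_cvgr _ lo up); apply: nearW => n.
    by rewrite g0/= ler_pM2l// ge_min lexx orbT.
  - by move=> n w; rewrite ger0_norm.
have kg n w : n.+1%:R * kappa (c n * D w) = g n w.
  have n0 : 0 < n.+1%:R :> R by [].
  have nn : n.+1%:R != 0 :> R by rewrite gt_eqF.
  rewrite /kappa /g !minr_pMr ?(ltW n0) ?(ltW h0)//; congr Num.min.
    by rewrite exprMn c2; field; exact: lt0r_neq0.
  rewrite normrM (gtr0_norm (c0 n)) exprMn.
  by rewrite [c n ^+ 3]exprSr c2; field; exact: lt0r_neq0.
pose K := 12 * expR (2^-1) : R.
apply/cvgrPdist_le => e e0.
pose r n := C * (\int[P]_w g n w + `|sigma| ^+ 3 * (K * (h * c n))).
have cvgr : r n @[n --> \oo] --> (0:R).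
  rewrite -(mulr0 C); apply: cvgMr; rewrite -[X in _ --> X]addr0.
  apply: cvgD => //; rewrite -(mulr0 (`|sigma| ^+ 3)); apply: cvgMr.
  rewrite -(mulr0 K); apply: cvgMr; rewrite -(mulr0 h); exact: cvgMr.
near=> n; rewrite distrC.
apply: (@le_trans _ _ (r n)); last first.
  near: n; move/cvgrPdist_le : cvgr => /(_ _ e0).
  by apply: filterS => n; rewrite sub0r normrN => /(le_trans (ler_norm _)).
pose delta := h / n.+1%:R.
have d0 : 0 < delta by exact: hn.
have nd : n.+1%:R * delta = h by rewrite /delta mulrCA divff ?mulr1.
have dh : delta <= h by rewrite ler_pdivrMr// ler_peMr ?(ltW h0)// ler1n.
have td1 : t0 + delta <= 1 by apply: le_trans th1; rewrite lerD2l.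
have ttd : t0 < t0 + delta by rewrite ltrDl.
have [b1 bE1 b2 bE2 [b3 bE3]] := brownian_increment_moments bB t00 ttd td1.
rewrite (addrC t0) addrK in bE2 bE3; rewrite (addrC delta) in bE2 bE3.
set I := increment B t0 (t0 + delta) in b1 bE1 b2 bE2 b3 bE3.
have mI : measurable_fun setT I.
  exact/measurable_EFinP/(measurable_int P').
have W1 := random_walk_scale (c n) (levy_walk n.+1 lV).
have W2 : random_walk P' n.+1 (fun k w => sigma * increment B t0 (t0 + k%:R * delta) w)
    (fun w => sigma * I w).
  by apply: random_walk_scale; apply: brownian_walk => //; rewrite nd.
have sq1 : P.-integrable setT (EFin \o (fun w => (c n * D w) ^+ 2)).
  have := integrableZl measurableT (c n ^+ 2) i2.
  by apply: eq_integrable => // w _; rewrite /= exprMn EFinM.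
have sq2 : P'.-integrable setT (EFin \o (fun w => (sigma * I w) ^+ 2)).
  have := integrableZl measurableT (sigma ^+ 2) b2.
  by apply: eq_integrable => // w _; rewrite /= exprMn EFinM.
have st : forall x, `|\int[P]_w f (x + c n * D w) -
    \int[P']_w f (x + sigma * I w)| <= r n / n.+1%:R.
  move=> x; have := step (fun w => c n * D w) (fun w => sigma * I w).
  move=> /(_ _ _ sq1 _ _ sq2 _ x)/le_trans; apply.
  - by have := integrableZl measurableT (c n) i1.
  - by rewrite RintegralZl// E1 mulr0.
  - by have := integrableZl measurableT sigma b1.
  - by rewrite RintegralZl// bE1 mulr0.
  - under eq_Rintegral do rewrite exprMn.
    under [RHS]eq_Rintegral do rewrite exprMn.
    by rewrite !RintegralZl// E2 bE2 c2 mulrC.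
  rewrite ler_pdivlMr// -mulrA ler_wpM2l// mulrDl lerD//.
    rewrite mulrC -RintegralZl//; last first.
      by apply: integrable_kappa sq1; exact: measurable_funM.
    by under eq_Rintegral do rewrite kg.
  have : \int[P']_w kappa (sigma * I w) <= `|sigma| ^+ 3 * (K * c n ^+ 3).
    apply: (@le_trans _ _ (\int[P']_w (`|sigma| ^+ 3 * `|I w| ^+ 3))).
      apply: le_Rintegral => //.
      - by apply: integrable_kappa sq2; exact: measurable_funM.
      - by have := integrableZl measurableT (`|sigma| ^+ 3) b3.
      - by move=> w _; rewrite -exprMn -normrM /kappa ge_min lexx orbT.
    by rewrite RintegralZl// ler_wpM2l// exprn_ge0.
  rewrite -(ler_pM2r (_ : 0 < n.+1%:R :> R))// => /le_trans; apply.
  have c3n : c n ^+ 3 * n.+1%:R = h * c n.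
    by rewrite exprSr c2; field; exact: lt0r_neq0.
  by rewrite -(mulrA (`|sigma| ^+ 3)) -(mulrA K) c3n mulrC.
have mxi : measurable_fun setT (fun w => c n * D w) by exact: measurable_funM.
have meta : measurable_fun setT (fun w => sigma * I w) by exact: measurable_funM.
have := lindeberg_exchange W1 W2 mxi meta mf fM st 0 (leqnn _).
rewrite nd mulrCA divff// mulr1.
under eq_Rintegral do rewrite add0r.
by under [X in _ - X]eq_Rintegral do rewrite add0r.
Unshelve. all: by end_near. Qed.

End clt.

Section levy_square.
Context {R : realType} {d : measure_display} {T : measurableType d}.
Variables (P : probability T R) (V : R -> T -> R) (sigma : R).
Hypothesis lV : square_integrable_levy P V sigma.

Lemma increment_sq_integrable s t : 0 <= s -> s <= t ->
  P.-integrable setT (EFin \o (fun w => increment V s t w ^+ 2)).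
Proof.
move=> s0 st; have t0 := le_trans s0 st; apply/integrableP; split.
  by apply/measurable_EFinP/measurable_funX; exact: (measurable_increment lV).
under eq_integral do rewrite /= ger0_norm ?sqr_ge0//.
by apply: le_lt_trans (moment2_increment_le lV s0 st) _; rewrite ltry.
Qed.

Lemma increment_sq_le s t : 0 <= s -> s <= t ->
  \int[P]_w (increment V s t w ^+ 2) <= sigma ^+ 2 * (t - s + 1).
Proof.
move=> s0 st; rewrite -lee_fin /Rintegral fineK.
  exact: (moment2_increment_le lV).
by apply: integrable_fin_num => //; exact: increment_sq_integrable.
Qed.

Lemma increment_sq_nat (n : nat) :
  \int[P]_w (increment V 0 n%:R w ^+ 2) = n%:R * sigma ^+ 2.
Proof. by rewrite /Rintegral [X in fine X](moment2_increment_nat lV). Qed.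

(** Passage from integer to real times. With n the integer part of t h, a = t^(-1/2) and b =
    (h/n)^(1/2), two errors arise: the increment over the fractional part, scaled by a, and the
    change of scale b - a applied to V(n). Both are O(a) in mean. *)
Lemma increment_rescaled_close (f : R -> R) (L h t : R) (m : nat) :
  0 <= L -> (forall x y, `|f x - f y| <= L * `|x - y|) ->
  (exists M, forall x, `|f x| <= M) -> measurable_fun setT f ->
  0 < h -> 0 < t -> m.+1%:R <= t * h -> t * h <= m.+2%:R ->
  `|\int[P]_w f ((Num.sqrt t)^-1 * increment V 0 (t * h) w) -
    \int[P]_w f (Num.sqrt (h / m.+1%:R) * increment V 0 m.+1%:R w)| <=
  L * ((Num.sqrt t)^-1 * (2 + 3 * sigma ^+ 2)).
Proof.
move=> L0 fL [M fM] mf h0 t0 m1 m2; set n : R := m.+1%:R.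
have n1 : 1 <= n by rewrite ler1n.
have n0 : 0 < n by [].
have th0 : 0 < t * h by rewrite mulr_gt0.
set a := (Num.sqrt t)^-1; set b := Num.sqrt (h / n).
have a0 : 0 < a by rewrite invr_gt0 sqrtr_gt0.
have b0 : 0 < b by rewrite sqrtr_gt0 divr_gt0.
have a2 : a ^+ 2 = t^-1 by rewrite exprVn sqr_sqrtr// ltW.
have b2 : b ^+ 2 = h / n by rewrite sqr_sqrtr// divr_ge0// ltW.
have ab : a <= b.
  rewrite -ler_sqr ?nnegrE ?(ltW a0) ?(ltW b0)// a2 b2 ler_pdivlMr// mulrC ler_pdivrMr//.
  by rewrite mulrC.
(* Since n (b^2 - a^2) = (t h - n) a^2 <= a^2 <= a (b + a); this compensates the second moment of
   [D], which grows like n. *)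
have key : (b - a) * n <= a.
  rewrite -(ler_pM2r (_ : 0 < b + a)); last by rewrite addr_gt0.
  have -> : (b - a) * n * (b + a) = n * (b ^+ 2 - a ^+ 2) by ring.
  have -> : n * (b ^+ 2 - a ^+ 2) = h - n * a ^+ 2.
    by rewrite b2; field; rewrite gt_eqF.
  apply: (@le_trans _ _ (a ^+ 2)); last first.
    by rewrite expr2 ler_pM2l// lerDr ltW.
  have ht : h = t * h * a ^+ 2 by rewrite a2; field; rewrite gt_eqF.
  rewrite {1}ht -mulrBl -[leRHS]mul1r ler_wpM2r ?sqr_ge0//.
  by move: m2; rewrite -natr1 -/n; lra.
set Z := increment V n (t * h); set D := increment V 0 n.
have iZ : P.-integrable setT (EFin \o (fun w => Z w ^+ 2)).
  by apply: increment_sq_integrable => //; exact: ltW.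
have iD : P.-integrable setT (EFin \o (fun w => D w ^+ 2)).
  by apply: increment_sq_integrable => //; exact: ltW.
have i1 : P.-integrable setT (EFin \o cst (1:R)).
  exact: finite_measure_integrable_cst.
have iZ1 : P.-integrable setT (EFin \o (fun w => 1 + Z w ^+ 2)).
  by have := integrableD measurableT i1 iZ.
have iD1 : P.-integrable setT (EFin \o (fun w => 1 + D w ^+ 2)).
  by have := integrableD measurableT i1 iD.
have iaZ : P.-integrable setT (EFin \o (fun w => a * (1 + Z w ^+ 2))).
  by have := integrableZl measurableT a iZ1.
have ibD : P.-integrable setT (EFin \o (fun w => (b - a) * (1 + D w ^+ 2))).
  by have := integrableZl measurableT (b - a) iD1.
have is' : P.-integrable setT
    (EFin \o (fun w => a * (1 + Z w ^+ 2) + (b - a) * (1 + D w ^+ 2))).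
  by have := integrableD measurableT iaZ ibD.
have mth : measurable_fun setT (increment V 0 (t * h)).
  by apply: (measurable_increment lV) => //; exact: ltW.
have mD : measurable_fun setT D.
  by apply: (measurable_increment lV) => //; exact: ltW.
(* Turns the Lipschitz bound, linear in the increments, into second moments. *)
have norm1 (y : R) : `|y| <= 1 + y ^+ 2.
  rewrite -(real_normK (num_real y)); have := sqr_ge0 (`|y| - 1).
  by have := normr_ge0 y; nra.
apply: (@le_trans _ _ (\int[P]_w (L * (a * (1 + Z w ^+ 2) +
    (b - a) * (1 + D w ^+ 2))))).
  apply: Rintegral_dist_le.
  - apply: (@bounded_meas_norm_le _ _ _ _ _ M) => //.
    by apply: measurableT_comp => //; exact: measurable_funM.
  - apply: (@bounded_meas_norm_le _ _ _ _ _ M) => //.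
    by apply: measurableT_comp => //; exact: measurable_funM.
  - by have := integrableZl measurableT L is'.
  - move=> w; apply: (le_trans (fL _ _)); rewrite ler_wpM2l//.
    have -> : a * increment V 0 (t * h) w - b * increment V 0 n w =
        a * Z w - (b - a) * D w by rewrite /Z /D /increment; ring.
    apply: (le_trans (ler_normB _ _)); rewrite !normrM (gtr0_norm a0).
    rewrite [`|b - a|]ger0_norm ?subr_ge0// lerD//.
      by rewrite ler_pM2l.
    by rewrite ler_wpM2l// subr_ge0.
rewrite RintegralZl// ler_wpM2l//.
rewrite (RintegralD measurableT iaZ ibD) !RintegralZl//.
rewrite (RintegralD measurableT i1 iZ) (RintegralD measurableT i1 iD).
rewrite !Rintegral_prob_cst increment_sq_nat.
have hZ : \int[P]_w (Z w ^+ 2) <= 2 * sigma ^+ 2.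
  apply: (le_trans (increment_sq_le (ltW n0) m1)).
  rewrite mulrC ler_wpM2r ?sqr_ge0//.
  by move: m2; rewrite -natr1 -/n; lra.
have h1 : a * (1 + \int[P]_w (Z w ^+ 2)) <= a * (1 + 2 * sigma ^+ 2).
  by rewrite ler_pM2l// lerD2l.
have h2 : (b - a) * (1 + n * sigma ^+ 2) <= a * (1 + sigma ^+ 2).
  apply: (@le_trans _ _ ((b - a) * n * (1 + sigma ^+ 2))); last first.
    by rewrite ler_wpM2r// addr_ge0// sqr_ge0.
  rewrite -mulrA ler_wpM2l ?subr_ge0// mulrDr mulr1 lerD2r//.
by lra.
Qed.

End levy_square.

Section clt_real.
Context {R : realType} {d d' : measure_display}.
Context {T : measurableType d} {T' : measurableType d'}.
Variables (P : probability T R) (V : R -> T -> R) (sigma : R).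
Variables (P' : probability T' R) (B : R -> T' -> R).
Hypothesis lV : square_integrable_levy P V sigma.
Hypothesis bB : brownian P' B.

Lemma clt_real (f : R -> R) (t0 h : R) : smooth f ->
  0 <= t0 -> 0 < h -> t0 + h <= 1 -> forall e, 0 < e -> exists A, forall t, A <= t ->
  `|\int[P]_w f ((Num.sqrt t)^-1 * increment V (t * t0) (t * (t0 + h)) w) -
    \int[P']_w f (sigma * increment B t0 (t0 + h) w)| <= e.
Proof.
move=> sf t00 h0 th1 e e0; have [L L0 fL] := smooth_lipschitz sf.
have [mf [M fM] _] := sf.
have e20 : 0 < e / 2 by rewrite divr_gt0.
have /cvgrPdist_le/(_ _ e20)[n0 _ Hn] := clt_nat lV bB sf t00 h0 th1.
pose K := L * (2 + 3 * sigma ^+ 2).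
have K0 : 0 <= K by rewrite mulr_ge0// addr_ge0// mulr_ge0// sqr_ge0.
(* The first term makes the integer part of [t * h] exceed [n0]; the second makes the error
   [K / Num.sqrt t] at most [e / 2]. *)
exists (Num.max (n0.+1%:R / h) ((2 * K / e) ^+ 2 + 1)) => t.
rewrite ge_max => /andP[t1 t2].
have s0 := sqr_ge0 (2 * K / e); have tp : 0 < t by lra.
have th0 : 0 <= t * h by rewrite mulr_ge0// ltW.
have /andP[h1 h2] := truncn_itv th0; set n := Num.truncn _ in h1 h2.
have hn : (n0 < n)%N.
  by rewrite truncn_ge_nat// -ler_pdivrMr.
case: n h1 h2 hn => // m h1 h2 hm.
have -> : \int[P]_w f ((Num.sqrt t)^-1 * increment V (t * t0) (t * (t0 + h)) w) =
    \int[P]_w f ((Num.sqrt t)^-1 * increment V 0 (t * h) w).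
  have tt0 : 0 <= t * t0 by rewrite mulr_ge0// ltW.
  have tth : t * t0 <= t * (t0 + h) by rewrite ler_pM2l// lerDl ltW.
  apply: (@same_law_Rintegral _ _ _ _ _ P P _ _
    (fun x => f ((Num.sqrt t)^-1 * x)) M).
  - by apply: (measurable_increment lV) => //; exact: le_trans tth.
  - exact: (measurable_increment lV).
  - have := same_law_increment lV tt0 tth.
    by rewrite (_ : t * (t0 + h) - t * t0 = t * h)//; ring.
  - by apply: measurableT_comp => //; exact: measurable_funM.
  - by move=> x.
have := increment_rescaled_close lV L0 fL (ex_intro _ M fM) mf h0 tp h1 (ltW h2).
have := Hn m hm; rewrite distrC.
set u := Rintegral _ _ _; set v := Rintegral _ _ _; set x := Rintegral _ _ _.
move=> k1 k2; rewrite -[X in `|X|](subrKA u).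
have : L * ((Num.sqrt t)^-1 * (2 + 3 * sigma ^+ 2)) <= e / 2.
  have -> : L * ((Num.sqrt t)^-1 * (2 + 3 * sigma ^+ 2)) = (Num.sqrt t)^-1 * K.
    by rewrite /K; ring.
  have st0 : 0 < Num.sqrt t by rewrite sqrtr_gt0.
  rewrite mulrC ler_pdivrMr// mulrC -ler_pdivrMr//.
  rewrite -[leLHS]ger0_norm; last by rewrite divr_ge0// ltW.
  rewrite -sqrtr_sqr ler_sqrt; last exact: ltW.
  rewrite (_ : K / (e / 2) = 2 * K / e); last by field; rewrite gt_eqF.
  by lra.
move=> k3; apply: (le_trans (ler_normD _ _)); lra.
Qed.

End clt_real.

(** * Approximation from below by sums of products of bumps *)

Section bump.
Context {R : realType}.
Variables (delta : R) (Z : nat).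
Hypothesis delta0 : 0 < delta.

(** A difference of consecutive translates of [smoothstep], so that sums telescope. It is supported
    within [delta] of its center, and the [2 * Z] bumps add up to 1 for x between
    [delta * (1 - Z%:R)] and [delta * Z%:R]. *)
Definition bump (z : nat) (x : R) : R :=
  smoothstep (delta^-1 * x + (Z%:R - z%:R)) -
  smoothstep (delta^-1 * x + (Z%:R - z.+1%:R)).

Definition bump_center (z : nat) : R := delta * (z%:R - Z%:R + 1).

Lemma smooth_bump z : smooth (bump z).
Proof. by apply: smoothB; apply: smooth_affine; exact: smooth_smoothstep. Qed.

Lemma bump_itv z x : 0 <= bump z x <= 1.
Proof.
rewrite /bump; set y := delta^-1 * x + (Z%:R - z%:R).
have -> : delta^-1 * x + (Z%:R - z.+1%:R) = y - 1 by rewrite /y -natr1; ring.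
have /andP[a0 a1] := smoothstep_itv y.
have /andP[b0 b1] := smoothstep_itv (y - 1).
have [y1|y1] := leP y 1.
  by rewrite [smoothstep (y - 1)]smoothstep_le0 ?subr0 ?a0//; lra.
by rewrite [smoothstep y]smoothstep_ge1 ?(ltW y1)//; apply/andP; split; lra.
Qed.

Lemma bump_support z x : delta < `|x - bump_center z| -> bump z x = 0.
Proof.
move=> h; rewrite /bump; set y := delta^-1 * x + (Z%:R - z%:R).
have -> : delta^-1 * x + (Z%:R - z.+1%:R) = y - 1 by rewrite /y -natr1; ring.
have : delta * 1 < delta * `|y - 1|.
  rewrite mulr1 -{2}(gtr0_norm delta0) -normrM; apply: lt_le_trans h _.
  rewrite le_eqVlt; apply/orP; left; apply/eqP; congr `|_|.
  by rewrite /bump_center /y; field; rewrite gt_eqF.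
rewrite ltr_pM2l// ltr_normr => /orP[h1|h1].
  by rewrite !smoothstep_ge1 ?subrr//; lra.
by rewrite !smoothstep_le0 ?subrr//; lra.
Qed.

Lemma sum_bumpE x : \sum_(z < (2 * Z)%N) bump z x =
  smoothstep (delta^-1 * x + Z%:R) - smoothstep (delta^-1 * x - Z%:R).
Proof.
pose u (z : nat) := smoothstep (delta^-1 * x + (Z%:R - z%:R)).
rewrite -(big_mkord xpredT (fun z => bump z x)).
under eq_bigr => z _ do rewrite -[bump z x]opprB.
rewrite sumrN (telescope_sumr (fun z => u z))// opprB /u subr0.
by congr (_ - smoothstep _); rewrite natrM; ring.
Qed.

Lemma sum_bump_itv x : 0 <= \sum_(z < (2 * Z)%N) bump z x <= 1.
Proof.
rewrite sumr_ge0/=; last by move=> z _; case/andP: (bump_itv z x).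
rewrite sum_bumpE; have /andP[a0 a1] := smoothstep_itv (delta^-1 * x + Z%:R).
have /andP[b0 b1] := smoothstep_itv (delta^-1 * x - Z%:R).
by lra.
Qed.

(** The defect of the partition of unity is bounded by a quadratic, so that second moments control
    the truncation. *)
Lemma sum_bump_ge x : (1 < Z)%N ->
  1 - (x / (delta * Z.-1%:R)) ^+ 2 <= \sum_(z < (2 * Z)%N) bump z x.
Proof.
move=> Z1; have K0 : 0 < delta * Z.-1%:R by rewrite mulr_gt0// ltr0n -ltnS prednK// ltnW.
have /andP[s0 _] := sum_bump_itv x.
have [h|h] := leP `|x| (delta * Z.-1%:R); last first.
  apply: le_trans s0; rewrite subr_le0 -real_normK ?num_real//.
  rewrite exprn_ege1// normrM normfV (gtr0_norm K0) ler_pdivlMr// mul1r.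
  exact: ltW.
rewrite sum_bumpE.
have ZE : Z%:R = Z.-1%:R + 1 :> R by rewrite natr1 prednK// ltnW.
have : `|delta^-1 * x| <= Z.-1%:R.
  by rewrite normrM gtr0_norm ?invr_gt0// ler_pdivrMl.
rewrite ler_norml => /andP[h1 h2].
rewrite smoothstep_ge1; last by rewrite ZE; lra.
rewrite smoothstep_le0; last by rewrite ZE; lra.
by rewrite subr0 gerBl sqr_ge0.
Qed.

End bump.

Section bump_interpolation.
Context {R : realType}.
Variables (N : nat) (G : ('I_N -> R) -> R) (M L delta : R) (Z : nat).
Hypothesis delta0 : 0 < delta.
Hypothesis Z1 : (1 < Z)%N.
Hypothesis G0 : forall x, 0 <= G x.
Hypothesis GM : forall x, G x <= M.
Hypothesis GL : forall x y (r : R), (forall i, `|x i - y i| <= r) ->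
  `|G x - G y| <= L * r.

(* The bumps form a partition of unity of mesh [delta]: a Lipschitz function of
   many variables is approximated from below by sums of products of functions of
   one variable. *)
Definition interpolation_coef (phi : {ffun 'I_N -> 'I_(2 * Z)}) : R :=
  Num.max 0 (G (fun i => bump_center delta Z (phi i)) - L * delta).

Definition interpolation (x : 'I_N -> R) : R :=
  \sum_(phi : {ffun 'I_N -> 'I_(2 * Z)})
    interpolation_coef phi * \prod_(i < N) bump delta Z (phi i) (x i).

Let prod_ge0 (x : 'I_N -> R) (phi : {ffun 'I_N -> 'I_(2 * Z)}) :
  0 <= \prod_(i < N) bump delta Z (phi i) (x i).
Proof. by apply: prodr_ge0 => i _; case/andP: (bump_itv delta Z (phi i) (x i)). Qed.

Let sum_prodE (x : 'I_N -> R) :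
  \sum_(phi : {ffun 'I_N -> 'I_(2 * Z)})
    \prod_(i < N) bump delta Z (phi i) (x i) =
  \prod_(i < N) \sum_(z < (2 * Z)%N) bump delta Z z (x i).
Proof.
by rewrite (bigA_distr_bigA (fun i (z : 'I_(2 * Z)) => bump delta Z z (x i))).
Qed.

Let close (x : 'I_N -> R) (phi : {ffun 'I_N -> 'I_(2 * Z)}) :
  \prod_(i < N) bump delta Z (phi i) (x i) = 0 \/
  `|G x - G (fun i => bump_center delta Z (phi i))| <= L * delta.
Proof.
have [/existsP[i h]|/existsPn h] := boolP [exists i,
  delta < `|x i - bump_center delta Z (phi i)|].
  by left; rewrite (bigD1 i)//= bump_support// mul0r.
by right; apply: GL => i; rewrite leNgt h.
Qed.

(** Where a product of bumps does not vanish, x is within [delta] of its center, so the coefficient,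
    lowered by [L * delta], is at most [G x]; the weights add up to at most 1. *)
Lemma interpolation_le x : interpolation x <= G x.
Proof.
rewrite /interpolation.
apply: (@le_trans _ _ (\sum_(phi : {ffun 'I_N -> 'I_(2 * Z)})
  G x * \prod_(i < N) bump delta Z (phi i) (x i))).
  apply: ler_sum => phi _; case: (close x phi) => [->|h]; first by rewrite !mulr0.
  rewrite ler_wpM2r// /interpolation_coef ge_max G0/=.
  by move: h; rewrite ler_norml => /andP[]; lra.
rewrite -mulr_sumr sum_prodE ler_piMr//; apply: prodr_ile1 => i _.
exact: sum_bump_itv.
Qed.

(** [L * delta] is lost twice, in the coefficient and in moving from x to the center. The last term
    is [M] times the missing weight, by 1 - prod p_i <= sum (1 - p_i). *)
Lemma interpolation_ge x : G x - 2 * (L * delta) -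
  M * \sum_(i < N) (x i / (delta * Z.-1%:R)) ^+ 2 <= interpolation x.
Proof.
have L0 : 0 <= L * delta.
  by have := @GL x x delta; rewrite subrr normr0; apply => i; rewrite subrr normr0 ltW.
set Pi := \prod_(i < N) \sum_(z < (2 * Z)%N) bump delta Z z (x i).
have M0 : 0 <= M := le_trans (G0 x) (GM x).
have Pi1 : 0 <= Pi <= 1.
  rewrite /Pi prodr_ge0/=; last by move=> i _; case/andP: (sum_bump_itv delta Z (x i)).
  by apply: prodr_ile1 => i _; exact: sum_bump_itv.
have hPi : 1 - \sum_(i < N) (x i / (delta * Z.-1%:R)) ^+ 2 <= Pi.
  have : 0 <= Pi <= 1 /\ 1 - \sum_(i < N) (x i / (delta * Z.-1%:R)) ^+ 2 <= Pi.
    rewrite /Pi; elim/big_rec2: _ => [|i a b _ [/andP[b0 b1] h]].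
      by rewrite subr0 ler01 lexx.
    have /andP[p0 p1] := sum_bump_itv delta Z (x i).
    have := sum_bump_ge delta0 (x i) Z1.
    set p := \sum_(z < _) _ in p0 p1 *; set q := (_ / _) ^+ 2 => pq.
    have pb : 0 <= p * b by rewrite mulr_ge0.
    have pb1 : p * b <= 1 by rewrite mulr_ile1.
    split; first by rewrite pb.
    have : (1 - p) * b <= 1 - p by rewrite ler_piMr// subr_ge0.
    lra.
  by case.
have h1 : (G x - 2 * (L * delta)) * Pi <= interpolation x.
  rewrite /interpolation /Pi -sum_prodE mulr_sumr; apply: ler_sum => phi _.
  case: (close x phi) => [->|h]; first by rewrite !mulr0.
  rewrite ler_wpM2r// /interpolation_coef le_max; apply/orP; right.
  by move: h; rewrite ler_norml => /andP[]; lra.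
apply: le_trans h1; move/andP: Pi1 => [P0 P1].
set q := \sum_(i < N) _ in hPi *.
have Mq : M * (1 - Pi) <= M * q by rewrite ler_wpM2l//; lra.
have : G x * (1 - Pi) <= M * (1 - Pi) by rewrite ler_wpM2r// subr_ge0.
have : (L * delta) * Pi <= L * delta by rewrite ler_piMr.
by lra.
Qed.

End bump_interpolation.

Section Rintegral_sum.
Context {R : realType} {d : measure_display} {T : measurableType d}.
Variable P : probability T R.

Lemma integrable_sum_EFin (I : Type) (r : seq I) (F : I -> T -> R) :
  (forall i, P.-integrable setT (EFin \o F i)) ->
  P.-integrable setT (EFin \o (fun w => \sum_(i <- r) F i w)).
Proof.
move=> iF; have := @integrable_sum _ _ _ P setT measurableT _ r xpredT
  (fun i => EFin \o F i) (fun i _ => iF i).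
by apply: eq_integrable => // w _; rewrite /= sumEFin.
Qed.

Lemma Rintegral_sum (I : Type) (r : seq I) (F : I -> T -> R) :
  (forall i, P.-integrable setT (EFin \o F i)) ->
  \int[P]_w (\sum_(i <- r) F i w) = \sum_(i <- r) \int[P]_w F i w.
Proof.
move=> iF; elim: r => [|i r IH].
  rewrite big_nil; under eq_Rintegral do rewrite big_nil.
  exact: Rintegral_prob_cst.
rewrite big_cons -IH -RintegralD//; last exact: integrable_sum_EFin.
by apply: eq_Rintegral => w _; rewrite big_cons.
Qed.

End Rintegral_sum.

(** * Finite-dimensional distributions *)

Section fdd.
Context {R : realType} {d d' : measure_display}.
Context {T : measurableType d} {T' : measurableType d'}.
Variables (P : probability T R) (V : R -> T -> R) (sigma : R).
Variables (P' : probability T' R) (B : R -> T' -> R).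
Hypothesis lV : square_integrable_levy P V sigma.
Hypothesis bB : brownian P' B.
Variable N : nat.
Hypothesis N0 : (0 < N)%N.

Let tau (i : nat) : R := i%:R / N%:R.

Definition levy_steps (t : R) (i : 'I_N) (w : T) : R :=
  (Num.sqrt t)^-1 * increment V (t * tau i) (t * tau i.+1) w.

Definition brownian_steps (i : 'I_N) (w : T') : R :=
  sigma * increment B (tau i) (tau i.+1) w.

Let N0R : 0 < N%:R :> R. Proof. by rewrite ltr0n. Qed.

Let tau_ge0 i : 0 <= tau i.
Proof. by rewrite divr_ge0. Qed.

Let tau_le1 i : (i <= N)%N -> tau i <= 1.
Proof. by move=> iN; rewrite ler_pdivrMr// mul1r ler_nat. Qed.

Let tauS i : tau i.+1 = tau i + N%:R^-1.
Proof. by rewrite /tau -natr1 mulrDl mul1r. Qed.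

Let tau_lt i : tau i < tau i.+1.
Proof. by rewrite tauS ltrDl invr_gt0. Qed.

Lemma measurable_levy_steps t i : 0 <= t -> measurable_fun setT (levy_steps t i).
Proof.
move=> t0; apply: measurable_funM => //.
by apply: (measurable_increment lV); rewrite mulr_ge0.
Qed.

Lemma measurable_brownian_steps i : measurable_fun setT (brownian_steps i).
Proof.
apply: measurable_funM => //; apply: (brownian_measurable_increment bB) => //.
- exact/tau_le1/ltnW/ltn_ord.
- exact: tau_le1.
Qed.

Lemma brownian_steps_sq i :
  P'.-integrable setT (EFin \o (fun w => brownian_steps i w ^+ 2)) /\
  \int[P']_w (brownian_steps i w ^+ 2) = sigma ^+ 2 / N%:R.
Proof.
have [_ _ i2 E2 _] := brownian_increment_moments bB (tau_ge0 i) (tau_lt i)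
  (tau_le1 (ltn_ord i)).
split.
  have := integrableZl measurableT (sigma ^+ 2) i2.
  by apply: eq_integrable => // w _; rewrite /= exprMn EFinM.
rewrite /brownian_steps; under eq_Rintegral do rewrite exprMn.
rewrite RintegralZl//; rewrite E2 tauS; congr (_ * _); ring.
Qed.

Let levy_prod t (f : 'I_N -> R -> R) : 0 <= t ->
  (forall i, measurable_fun setT (f i)) -> (forall i x, `|f i x| <= 1) ->
  \int[P]_w (\prod_(i < N) f i (levy_steps t i w)) =
  \prod_(i < N) \int[P]_w f i (levy_steps t i w).
Proof.
move=> t0 mf f1.
apply: (@mutually_independent_Rintegral_prod _ _ _ P N
  (fun i => increment V (t * tau i) (t * tau i.+1)) _ _
  (fun i x => f i ((Num.sqrt t)^-1 * x)) 1).
- by move=> i; apply: (measurable_increment lV); rewrite mulr_ge0.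
- apply: (levy_grid_independent lV (t := fun i => t * tau i)).
    by rewrite mulr_ge0.
  by move=> i _; rewrite ler_wpM2l// ltW.
- by move=> i; apply: measurableT_comp => //; exact: measurable_funM.
- by move=> i x.
Qed.

Let brownian_prod (f : 'I_N -> R -> R) :
  (forall i, measurable_fun setT (f i)) -> (forall i x, `|f i x| <= 1) ->
  \int[P']_w (\prod_(i < N) f i (brownian_steps i w)) =
  \prod_(i < N) \int[P']_w f i (brownian_steps i w).
Proof.
move=> mf f1.
apply: (@mutually_independent_Rintegral_prod _ _ _ P' N
  (fun i => increment B (tau i) (tau i.+1)) _ _
  (fun i x => f i (sigma * x)) 1).
- move=> i; apply: (brownian_measurable_increment bB) => //; apply: tau_le1 => //.
  exact: ltnW.
- apply: (brownian_independent bB (t := tau)) => i iN.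
    by rewrite /= in_itv/= tau_ge0 tau_le1.
  exact: ltW.
- by move=> i; apply: measurableT_comp => //; exact: measurable_funM.
- by move=> i x.
Qed.

Let clt_step (f : R -> R) (i : 'I_N) : smooth f ->
  \int[P]_w f (levy_steps t i w) @[t --> +oo] -->
  \int[P']_w f (brownian_steps i w).
Proof.
move=> sf; apply/cvgrPdist_le => e e0.
have h0 : 0 < N%:R^-1 :> R by rewrite invr_gt0.
have th1 : tau i + N%:R^-1 <= 1 by rewrite -tauS tau_le1.
have [A hA] := clt_real lV bB sf (tau_ge0 i) h0 th1 e0.
exists A; split; first exact: num_real.
move=> t At; rewrite distrC; have := hA t (ltW At).
by rewrite -tauS.
Qed.

(** By independence, the expectation of the interpolation is a finite combination of products of
    one-dimensional expectations, which converge. On the side of V the interpolation just has to lie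
    below [G]; what it loses is estimated on the Brownian side, where the variances are explicit. *)
Lemma fdd_liminf (G : ('I_N -> R) -> R) (M L : R) :
  (forall x, 0 <= G x) -> (forall x, G x <= M) ->
  (forall x y (r : R), (forall i, `|x i - y i| <= r) -> `|G x - G y| <= L * r) ->
  measurable_fun setT (fun w => G (brownian_steps ^~ w)) ->
  (forall t, 0 <= t -> measurable_fun setT (fun w => G (levy_steps t ^~ w))) ->
  forall e, 0 < e -> exists A, forall t, A <= t ->
    \int[P']_w G (brownian_steps ^~ w) - e <= \int[P]_w G (levy_steps t ^~ w).
Proof.
move=> G0 GM GL mGB mGV e e0.
have L0 : 0 <= L.
  have := le_trans (normr_ge0 _) (GL (fun=> 0) (fun=> 0) 1 _).
  by rewrite mulr1; apply => i; rewrite subrr normr0.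
have M0 : 0 <= M := le_trans (G0 (fun=> 0)) (GM _).
(* A quarter of [e] goes to the mesh, a quarter to the truncation and half to the convergence. *)
pose delta := e / (8 * (L + 1)).
have L1 : 0 < 8 * (L + 1) by rewrite mulr_gt0// ltr_wpDl.
have d0 : 0 < delta by rewrite divr_gt0.
have Ld : 2 * (L * delta) <= e / 4.
  have : 8 * (L + 1) * delta = e by rewrite /delta mulrCA divff ?mulr1 ?gt_eqF.
  by move: d0; lra.
(* The truncation costs [M * sigma ^+ 2 / k ^+ 2] with [k = delta * Z.-1%:R], so [k ^+ 2] has to
   reach [q]; for this [1 + q <= k] is enough. *)
pose q := 4 * (M * sigma ^+ 2) / e.
have q0 : 0 <= q.
  by rewrite divr_ge0 ?(ltW e0)// mulr_ge0// mulr_ge0// sqr_ge0.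
have [Z0 hZ0] : exists Z0 : nat, (1 + q) / delta < Z0%:R.
  exists (Num.truncn ((1 + q) / delta)).+1; exact: truncnS_gt.
pose Z := Z0.+2.
have Z1 : (1 < Z)%N by [].
have hZ : q <= (delta * Z.-1%:R) ^+ 2.
  have : 1 + q <= delta * Z.-1%:R.
    rewrite mulrC -ler_pdivrMr//; apply: (le_trans (ltW hZ0)).
    by rewrite ler_nat.
  set k := delta * _ => kq; have : (1 + q) ^+ 2 <= k ^+ 2.
    rewrite lerXn2r// ?nnegrE; [lra|lra].
  by have := sqr_ge0 q; rewrite sqrrD; lra.
pose H := interpolation G L delta Z.
pose b (z : nat) := bump delta Z z.
have mb z : measurable_fun setT (b z) by have [] := smooth_bump delta Z z.
have b1 z x : `|b z x| <= 1.
  by have /andP[h0 h1] := bump_itv delta Z z x; rewrite ger0_norm.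
pose FV t (phi : {ffun 'I_N -> 'I_(2 * Z)}) w :=
  interpolation_coef G L delta phi * \prod_(i < N) b (phi i) (levy_steps t i w).
pose FB (phi : {ffun 'I_N -> 'I_(2 * Z)}) w :=
  interpolation_coef G L delta phi * \prod_(i < N) b (phi i) (brownian_steps i w).
have prod1 (x : 'I_N -> R) (phi : {ffun 'I_N -> 'I_(2 * Z)}) :
    `|\prod_(i < N) b (phi i) (x i)| <= 1.
  by rewrite normr_prod; apply: prodr_ile1 => i _; rewrite normr_ge0 b1.
have iPV t (phi : {ffun 'I_N -> 'I_(2 * Z)}) : 0 <= t -> P.-integrable setT
    (EFin \o (fun w => \prod_(i < N) b (phi i) (levy_steps t i w))).
  move=> t0; apply: (@bounded_meas_norm_le _ _ _ _ _ 1) => //.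
  apply: measurable_prod => i _; apply: measurableT_comp => //.
  exact: measurable_levy_steps.
have iPB (phi : {ffun 'I_N -> 'I_(2 * Z)}) : P'.-integrable setT
    (EFin \o (fun w => \prod_(i < N) b (phi i) (brownian_steps i w))).
  apply: (@bounded_meas_norm_le _ _ _ _ _ 1) => //.
  apply: measurable_prod => i _; apply: measurableT_comp => //.
  exact: measurable_brownian_steps.
have iFV t (phi : {ffun 'I_N -> 'I_(2 * Z)}) : 0 <= t -> P.-integrable setT (EFin \o FV t phi).
  move=> t0; have := integrableZl measurableT (interpolation_coef G L delta phi)
    (iPV t phi t0).
  by apply: eq_integrable.
have iFB (phi : {ffun 'I_N -> 'I_(2 * Z)}) : P'.-integrable setT (EFin \o FB phi).
  have := integrableZl measurableT (interpolation_coef G L delta phi) (iPB phi).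
  by apply: eq_integrable.
have EV t : 0 <= t -> \int[P]_w H (levy_steps t ^~ w) =
    \sum_(phi : {ffun 'I_N -> 'I_(2 * Z)}) interpolation_coef G L delta phi *
      \prod_(i < N) \int[P]_w b (phi i) (levy_steps t i w).
  move=> t0; rewrite /H /interpolation Rintegral_sum => [|phi]; last exact: iFV.
  apply: eq_bigr => phi _; rewrite RintegralZl//; last exact: iPV.
  by rewrite (levy_prod (f := fun i => b (phi i)) t0).
have EB : \int[P']_w H (brownian_steps ^~ w) =
    \sum_(phi : {ffun 'I_N -> 'I_(2 * Z)}) interpolation_coef G L delta phi *
      \prod_(i < N) \int[P']_w b (phi i) (brownian_steps i w).
  rewrite /H /interpolation Rintegral_sum => [|phi]; last exact: iFB.
  apply: eq_bigr => phi _; rewrite RintegralZl//.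
  by rewrite (brownian_prod (f := fun i => b (phi i))).
have cvgH : \sum_(phi : {ffun 'I_N -> 'I_(2 * Z)}) interpolation_coef G L delta phi *
      \prod_(i < N) \int[P]_w b (phi i) (levy_steps t i w) @[t --> +oo] -->
    \int[P']_w H (brownian_steps ^~ w).
  rewrite EB; apply: cvg_big => [|phi _]; first exact: add_continuous.
  apply: cvgMr; apply: cvg_big => [|i _]; first exact: mul_continuous.
  by apply: clt_step; exact: smooth_bump.
have e20 : 0 < e / 2 by rewrite divr_gt0.
have /cvgrPdist_le/(_ _ e20)[A [_ hA]] := cvgH.
exists (Num.max 0 A + 1) => t At.
have : Num.max 0 A < t by lra.
rewrite gt_max => /andP[t0 {}At].
have iGV : P.-integrable setT (EFin \o (fun w => G (levy_steps t ^~ w))).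
  apply: (@bounded_meas_norm_le _ _ _ _ _ M); first exact/mGV/ltW.
  by move=> w; rewrite ger0_norm.
have iGB : P'.-integrable setT (EFin \o (fun w => G (brownian_steps ^~ w))).
  apply: (@bounded_meas_norm_le _ _ _ _ _ M) => //.
  by move=> w; rewrite ger0_norm.
have h1 : \int[P]_w H (levy_steps t ^~ w) <= \int[P]_w G (levy_steps t ^~ w).
  apply: le_Rintegral => //.
    have := integrable_sum_EFin (index_enum {ffun 'I_N -> 'I_(2 * Z)}) (F := FV t)
      (fun phi => iFV t phi (ltW t0)).
    by [].
  by move=> w _; exact: interpolation_le.
have h2 : `|\int[P']_w H (brownian_steps ^~ w) - \int[P]_w H (levy_steps t ^~ w)| <= e / 2.
  by rewrite (EV _ (ltW t0)); exact: hA.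
have h3 : \int[P']_w G (brownian_steps ^~ w) - e / 2 <=
    \int[P']_w H (brownian_steps ^~ w).
  have iHB : P'.-integrable setT (EFin \o (fun w => H (brownian_steps ^~ w))).
    exact: (integrable_sum_EFin (index_enum {ffun 'I_N -> 'I_(2 * Z)}) iFB).
  pose k := delta * Z.-1%:R.
  have k0 : 0 < k by rewrite mulr_gt0.
  have iS i : P'.-integrable setT (EFin \o (fun w => (brownian_steps i w / k) ^+ 2)).
    have := integrableZl measurableT (k ^- 2) (brownian_steps_sq i).1.
    apply: eq_integrable => // w _; rewrite /= -EFinM; congr EFin.
    by rewrite expr_div_n mulrC.
  have iSum : P'.-integrable setT
      (EFin \o (fun w => \sum_(i < N) (brownian_steps i w / k) ^+ 2)).
    exact: (integrable_sum_EFin (index_enum 'I_N) iS).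
  have iMS : P'.-integrable setT
      (EFin \o (fun w => M * \sum_(i < N) (brownian_steps i w / k) ^+ 2)).
    by have := integrableZl measurableT M iSum.
  have ic : P'.-integrable setT (EFin \o cst (2 * (L * delta))).
    exact: finite_measure_integrable_cst.
  have iGc : P'.-integrable setT
      (EFin \o (fun w => G (brownian_steps ^~ w) - 2 * (L * delta))).
    by have := integrableB measurableT iGB ic.
  have : \int[P']_w (G (brownian_steps ^~ w) - 2 * (L * delta) -
      M * \sum_(i < N) (brownian_steps i w / k) ^+ 2) <=
      \int[P']_w H (brownian_steps ^~ w).
    apply: le_Rintegral => //.
      by have := integrableB measurableT iGc iMS.
    by move=> w _; exact: interpolation_ge.
  rewrite (RintegralB measurableT iGc iMS) (RintegralB measurableT iGB ic).
  rewrite Rintegral_prob_cst RintegralZl// Rintegral_sum//.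
  have ES i : \int[P']_w ((brownian_steps i w / k) ^+ 2) = sigma ^+ 2 / N%:R / k ^+ 2.
    have [isq <-] := brownian_steps_sq i.
    rewrite -RintegralZr//; apply: eq_Rintegral => w _.
    by rewrite expr_div_n.
  under eq_bigr do rewrite ES.
  rewrite sumr_const card_ord -[_ *+ N]mulr_natl.
  have -> : M * (N%:R * (sigma ^+ 2 / N%:R / k ^+ 2)) = M * sigma ^+ 2 / k ^+ 2.
    by field; rewrite !gt_eqF.
  have : M * sigma ^+ 2 / k ^+ 2 <= e / 4.
    rewrite ler_pdivrMr ?exprn_gt0//.
    have : e / 4 * q <= e / 4 * k ^+ 2 by rewrite ler_wpM2l// divr_ge0// ltW.
    have -> : e / 4 * q = M * sigma ^+ 2 by rewrite /q; field; rewrite gt_eqF.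
    by [].
  by lra.
move: h2; rewrite ler_norml => /andP[h4 h5]; lra.
Qed.

End fdd.

(** * Cone functionals on path space *)

Definition dyadic (R : realType) (p i : nat) : R := i%:R / 2 ^+ p.

(* [(p, c, q, L)] codes the function [(q - L * sup |x - f|)^+] of the path [x],
   [f] being the step function with value [c_i] on the [i]-th dyadic interval of
   order [p]. *)
Definition cone : Type := (nat * seq rat * rat * nat)%type.

Section cones.
Context {R : realType}.
Implicit Types (a : cone) (S : seq cone) (x y : R -> R).

Lemma dyadicE p m i : (m <= p)%N ->
  dyadic R m i = dyadic R p (i * 2 ^ (p - m)).
Proof.
move=> mp; rewrite /dyadic natrM natrX -{2}(subnK mp) exprD.
by field; rewrite !expf_neq0.
Qed.

Lemma dyadic_ge0 p i : 0 <= dyadic R p i.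
Proof. by rewrite divr_ge0// exprn_ge0. Qed.

Lemma dyadic_le1 p i : (i <= 2 ^ p)%N -> dyadic R p i <= 1.
Proof. by move=> h; rewrite ler_pdivrMr ?exprn_gt0// mul1r -natrX ler_nat. Qed.

Lemma truncn_dyadic (p p0 i : nat) : (p0 <= p)%N ->
  Num.truncn (2 ^+ p0 * dyadic R p i) = (i %/ 2 ^ (p - p0))%N.
Proof.
move=> h; have -> : 2 ^+ p0 * dyadic R p i = i%:R / 2 ^+ (p - p0).
  rewrite /dyadic -{1}(subnK h) exprD; field.
  by rewrite !expf_neq0.
have k0 : 0 < 2 ^+ (p - p0) :> R by rewrite exprn_gt0.
apply: truncn_def; rewrite ler_pdivlMr// ltr_pdivrMr//.
rewrite -natrX -!natrM ler_nat ltr_nat leq_divM/=.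
by rewrite ltn_ceil// expn_gt0.
Qed.

Definition cone_order a : nat := a.1.1.1.
Definition cone_step a (t : R) : R :=
  ratr (nth 0 a.1.1.2 (Num.truncn (2 ^+ cone_order a * t))).
Definition cone_height a : R := ratr a.1.2.
Definition cone_slope a : R := a.2%:R.

(** The order [p] of the grid is separate from the order of the step function: the cone stays fixed
    while [p] goes to infinity. The endpoint 1 belongs to the grid. *)
Definition grid_dist a p x : R :=
  \big[Num.max/0]_(i < (2 ^ p).+1)
    `|x (dyadic R p i) - cone_step a (dyadic R p i)|.

Definition cone_fun a p x : R :=
  Num.max 0 (cone_height a - cone_slope a * grid_dist a p x).

Definition cones_fun S p x : R := \big[Num.max/0]_(a <- S) cone_fun a p x.

Definition cones_bound S : R := \sum_(a <- S) `|cone_height a|.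
Definition cones_lip S : R := \sum_(a <- S) cone_slope a.
Definition cones_order S : nat := \max_(a <- S) cone_order a.

Lemma cones_bound_ge0 S : 0 <= cones_bound S.
Proof. by apply: sumr_ge0. Qed.

Lemma cones_lip_ge0 S : 0 <= cones_lip S.
Proof. by apply: sumr_ge0 => a _; exact: ler0n. Qed.

Lemma grid_dist_ge0 a p x : 0 <= grid_dist a p x.
Proof. exact: bigmax_ge_id. Qed.

Lemma grid_dist_le a p x r : 0 <= r ->
  (forall i, (i <= 2 ^ p)%N ->
    `|x (dyadic R p i) - cone_step a (dyadic R p i)| <= r) ->
  grid_dist a p x <= r.
Proof. by move=> r0 h; apply: bigmax_le => // i _; apply: h; rewrite -ltnS. Qed.

Lemma grid_dist_ge a p x i : (i <= 2 ^ p)%N ->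
  `|x (dyadic R p i) - cone_step a (dyadic R p i)| <= grid_dist a p x.
Proof.
rewrite -ltnS => h.
exact: (le_bigmax _ (fun i : 'I_(2 ^ p).+1 =>
  `|x (dyadic R p i) - cone_step a (dyadic R p i)|) (Ordinal h)).
Qed.

Lemma cone_fun_ge0 a p x : 0 <= cone_fun a p x.
Proof. by rewrite /cone_fun le_max lexx. Qed.

Lemma cone_fun_le a p x : cone_fun a p x <= `|cone_height a|.
Proof.
rewrite /cone_fun ge_max normr_ge0/=; apply: le_trans (ler_norm _).
by rewrite gerBl mulr_ge0// grid_dist_ge0.
Qed.

Lemma cones_fun_ge0 S p x : 0 <= cones_fun S p x.
Proof. exact: bigmax_ge_id. Qed.

Lemma cones_fun_le S p x : cones_fun S p x <= cones_bound S.
Proof.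
rewrite /cones_fun /cones_bound; elim: S => [|a S IH]; first by rewrite !big_nil.
rewrite !big_cons ge_max; apply/andP; split.
  apply: (le_trans (cone_fun_le a p x)); rewrite lerDl; exact: sumr_ge0.
by apply: (le_trans IH); rewrite lerDr.
Qed.

Lemma cones_fun_norm_le S p x : `|cones_fun S p x| <= cones_bound S.
Proof. by rewrite ger0_norm ?cones_fun_ge0// cones_fun_le. Qed.

Lemma cones_fun_le_comp S p p' x y (r : R) : 0 <= r ->
  (forall a, a \in S -> cone_fun a p x <= cone_fun a p' y + cone_slope a * r) ->
  cones_fun S p x <= cones_fun S p' y + cones_lip S * r.
Proof.
move=> r0; rewrite /cones_fun /cones_lip; elim: S => [|a S IH] h.
  by rewrite !big_nil mul0r addr0.
have IHS := IH (fun b bS => h b (mem_behead (s := a :: S) bS)).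
have ha := h a (mem_head _ _).
rewrite !big_cons ge_max mulrDl; apply/andP; split.
  apply: (le_trans ha); apply: lerD; first by rewrite le_max lexx.
  by rewrite lerDl mulr_ge0//; exact: cones_lip_ge0.
apply: (le_trans IHS); apply: lerD; first by rewrite le_max lexx orbT.
by rewrite lerDr mulr_ge0// ler0n.
Qed.

Lemma cone_fun_le_comp a p p' x y (r : R) :
  grid_dist a p' y <= grid_dist a p x + r ->
  0 <= r -> cone_fun a p x <= cone_fun a p' y + cone_slope a * r.
Proof.
move=> h r0; have s0 : 0 <= cone_slope a by exact: ler0n.
rewrite {1}/cone_fun ge_max; apply/andP; split.
  by rewrite addr_ge0 ?cone_fun_ge0// mulr_ge0.
have : cone_slope a * grid_dist a p' y <= cone_slope a * (grid_dist a p x + r).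
  by rewrite ler_wpM2l.
have : cone_height a - cone_slope a * grid_dist a p' y <= cone_fun a p' y.
  by rewrite /cone_fun le_max lexx orbT.
lra.
Qed.

Lemma cones_fun_lipschitz S p x y (r : R) :
  (forall i, (i <= 2 ^ p)%N -> `|x (dyadic R p i) - y (dyadic R p i)| <= r) ->
  `|cones_fun S p x - cones_fun S p y| <= cones_lip S * r.
Proof.
move=> h; have r0 : 0 <= r by exact: le_trans (h 0%N _).
have H u v : (forall i, (i <= 2 ^ p)%N -> `|u (dyadic R p i) - v (dyadic R p i)| <= r) ->
    cones_fun S p u <= cones_fun S p v + cones_lip S * r.
  move=> huv; apply: cones_fun_le_comp => // a _; apply: cone_fun_le_comp => //.
  apply: grid_dist_le => [|i ip]; first by rewrite addr_ge0// grid_dist_ge0.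
  rewrite distrC.
  have := ler_distD (u (dyadic R p i)) (cone_step a (dyadic R p i)) (v (dyadic R p i)).
  move=> /le_trans; apply; apply: lerD; last exact: huv.
  by rewrite distrC; exact: grid_dist_ge.
have h1 := H x y h; have h2 := H y x (fun i ip => eq_ind_r (fun z => z <= r) (h i ip) (distrC _ _)).
by rewrite ler_norml; apply/andP; split; lra.
Qed.

(** A finer dyadic grid contains the coarser one, so distances grow and cones shrink. Hence the
    limit in [p] exists for an arbitrary function [x]. *)
Lemma cones_fun_nonincreasing S x :
  {homo cones_fun S ^~ x : p p' / (p <= p')%N >-> p' <= p}.
Proof.
move=> p p' pp; rewrite -[leRHS]addr0 -(mulr0 (cones_lip S)).
apply: cones_fun_le_comp => // a _; apply: cone_fun_le_comp => //.
rewrite addr0; apply: grid_dist_le => [|i ip]; first exact: grid_dist_ge0.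
rewrite (dyadicE i pp); apply: grid_dist_ge.
by rewrite -{2}(subnK pp) expnD mulnC leq_mul2l ip orbT.
Qed.

(** From order [m] on, the step functions are constant on dyadic intervals of order [m], so refining
    the grid reveals nothing but the oscillation of [x] inside these intervals. *)
Lemma cones_fun_osc S m p x (r : R) : (cones_order S <= m)%N -> (m <= p)%N ->
  0 <= r ->
  (forall i k, (i < 2 ^ m)%N -> (k <= 2 ^ (p - m))%N ->
    `|x (dyadic R m i + dyadic R p k) - x (dyadic R m i)| <= r) ->
  cones_fun S m x <= cones_fun S p x + cones_lip S * r.
Proof.
move=> Sm mp r0 h; apply: cones_fun_le_comp => // a aS.
have am : (cone_order a <= m)%N.
  apply: leq_trans Sm; rewrite /cones_order (big_rem a)//=; exact: leq_maxl.
apply: cone_fun_le_comp => //.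
apply: grid_dist_le => [|j jp]; first by rewrite addr_ge0// grid_dist_ge0.
pose i := (j %/ 2 ^ (p - m))%N; pose k := (j %% 2 ^ (p - m))%N.
have K0 : (0 < 2 ^ (p - m))%N by rewrite expn_gt0.
have jE : dyadic R p j = dyadic R m i + dyadic R p k.
  by rewrite (dyadicE i mp) /dyadic -mulrDl -natrD -divn_eq.
have stepE : cone_step a (dyadic R p j) = cone_step a (dyadic R m i).
  rewrite /cone_step !truncn_dyadic//; last exact: leq_trans mp.
  rewrite /i -divnMA -expnD; congr (ratr (nth _ _ (_ %/ 2 ^ _))).
  by rewrite addnBA// subnK.
have im : (i <= 2 ^ m)%N.
  by rewrite -(mulnK (2 ^ m)%N K0) -expnD subnKC// leq_div2r.
rewrite stepE jE.
have hx : `|x (dyadic R m i + dyadic R p k) - x (dyadic R m i)| <= r.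
  (* The endpoint [j = 2 ^ p] gives [i = 2 ^ m], which the hypothesis does not cover; then [k = 0]
     and the difference vanishes. *)
  move: (im); rewrite leq_eqVlt => /predU1P[iE|im']; last first.
    by apply: h => //; rewrite /k ltnW// ltn_mod.
  have -> : k = 0%N.
    have jE' : (j = 2 ^ m * 2 ^ (p - m) + k)%N by rewrite -iE -divn_eq.
    have : (2 ^ m * 2 ^ (p - m) + k <= 2 ^ p)%N by rewrite -jE'.
    by rewrite -expnD subnKC// -{2}[(2 ^ p)%N]addn0 leq_add2l leqn0 => /eqP.
  by rewrite /dyadic mul0r addr0 subrr normr0.
have := ler_distD (x (dyadic R m i)) (x (dyadic R m i + dyadic R p k))
  (cone_step a (dyadic R m i)).
move=> /le_trans; apply; rewrite addrC; apply: lerD => //.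
exact: grid_dist_ge.
Qed.

Lemma measurable_cones_fun d (T : measurableType d) S p (X : R -> T -> R) :
  (forall i, (i <= 2 ^ p)%N -> measurable_fun setT (X (dyadic R p i))) ->
  measurable_fun setT (fun w => cones_fun S p (X ^~ w)).
Proof.
move=> mX.
have mmax (I : Type) (r : seq I) (F : I -> T -> R) :
    (forall i, measurable_fun setT (F i)) ->
    measurable_fun setT (fun w => \big[Num.max/0]_(i <- r) F i w).
  move=> mF; elim: r => [|i r IH].
    by under eq_fun do rewrite big_nil; exact: measurable_cst.
  by under eq_fun do rewrite big_cons; exact: measurable_maxr.
apply: (mmax _) => a; apply: measurable_maxr => //; apply: measurable_funB => //.
apply: measurable_funM => //; apply: (mmax _) => i.
apply: measurableT_comp => //; apply: measurable_funB => //.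
by apply: mX; rewrite -ltnS.
Qed.

End cones.

(** * Oscillation between grid points *)

Section probability_bounds.
Context {R : realType} {d : measure_display} {T : measurableType d}.
Variable P : probability T R.

Lemma fine_probability_le (A : set T) (f : T -> R) : measurable A ->
  P.-integrable setT (EFin \o f) -> (forall w, 0 <= f w) ->
  (forall w, A w -> 1 <= f w) -> fine (P A) <= \int[P]_w f w.
Proof.
move=> mA fi f0 Af.
have -> : fine (P A) = \int[P]_w \1_A w.
  by rewrite /Rintegral integral_indic// setIT.
apply: le_Rintegral => //; first exact: integrable_indic.
by move=> w _; rewrite indicE; case: (boolP (w \in A)) => [/set_mem/Af|].
Qed.

Lemma measurable_exceeds (n : nat) (F : nat -> T -> R) (a : R) :
  (forall k, (k <= n)%N -> measurable_fun setT (F k)) ->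
  measurable [set w | exists2 k, (k <= n)%N & a < `|F k w|].
Proof.
move=> mF; have -> : [set w | exists2 k, (k <= n)%N & a < `|F k w|] =
    \bigcup_(k in [set k | (k <= n)%N]) [set w | a < `|F k w|].
  by apply/seteqP; split => [w [k kn h]|w [k kn h]]; exists k.
apply: bigcup_measurable => k kn.
rewrite (_ : [set _ | _] = (Num.norm \o F k) @^-1` `]a, +oo[%classic).
  rewrite -[X in measurable X]setTI.
  by apply: (measurableT_comp (@normr_measurable R setT) (mF k kn)).
by apply/seteqP; split => x /=; rewrite in_itv/= andbT.
Qed.

Lemma fine_probability_bigcup (n : nat) (A : 'I_n -> set T) (b : 'I_n -> R) :
  (forall i, measurable (A i)) -> (forall i, fine (P (A i)) <= b i) ->
  forall C, measurable C -> (C `<=` \bigcup_i A i) ->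
  fine (P C) <= \sum_(i < n) b i.
Proof.
move=> mA Ab C mC CA.
have iA i : P.-integrable setT (EFin \o (\1_(A i) : T -> R)).
  exact: integrable_indic.
apply: (@le_trans _ _ (\int[P]_w \sum_(i < n) \1_(A i) w)).
  apply: fine_probability_le => //.
  - exact: (integrable_sum_EFin (index_enum 'I_n) iA).
  - by move=> w; apply: sumr_ge0 => i _; rewrite indicE.
  - move=> w /CA[i _ Aw]; rewrite (bigD1 i)//= indicE mem_set// lerDl.
    by apply: sumr_ge0 => j _; rewrite indicE.
rewrite Rintegral_sum//; apply: ler_sum => i _; apply: le_trans (Ab i).
by rewrite /Rintegral integral_indic// setIT.
Qed.

End probability_bounds.

Section oscillation.
Context {R : realType} {d d' : measure_display}.
Context {T : measurableType d} {T' : measurableType d'}.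
Variables (P : probability T R) (V : R -> T -> R) (sigma : R).
Variables (P' : probability T' R) (B : R -> T' -> R).
Hypothesis lV : square_integrable_levy P V sigma.
Hypothesis bB : brownian P' B.

Definition levy_path (t : R) (w : T) (x : R) : R :=
  (Num.sqrt t)^-1 * increment V 0 (t * x) w.

Definition brownian_path (w : T') (x : R) : R := sigma * increment B 0 x w.

Lemma measurable_levy_path t x : 0 <= t -> 0 <= x ->
  measurable_fun setT (fun w => levy_path t w x).
Proof.
move=> t0 x0; apply: measurable_funM => //.
by apply: (measurable_increment lV) => //; rewrite mulr_ge0.
Qed.

Lemma measurable_brownian_path x : 0 <= x -> x <= 1 ->
  measurable_fun setT (fun w => brownian_path w x).
Proof.
move=> x0 x1; apply: measurable_funM => //.
by apply: (brownian_measurable_increment bB).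
Qed.

(** Deviation from the left end of a block of order [m], as seen on the grid of order [p]; the
    factor 2 is that of [ottaviani]. *)
Definition oscillates (m p : nat) (eps : R) (x : R -> R) : Prop :=
  exists i, (i < 2 ^ m)%N /\ exists2 k, (k <= 2 ^ (p - m))%N &
    2 * eps < `|x (dyadic R m i + dyadic R p k) - x (dyadic R m i)|.

Lemma measurable_oscillates m p eps t : 0 <= t ->
  measurable [set w | oscillates m p eps (levy_path t w)].
Proof.
move=> t0; rewrite (_ : [set _ | _] = \bigcup_(i in [set i | (i < 2 ^ m)%N])
    [set w | exists2 k, (k <= 2 ^ (p - m))%N & 2 * eps <
      `|levy_path t w (dyadic R m i + dyadic R p k) - levy_path t w (dyadic R m i)|]).
  apply: bigcup_measurable => i _.
  apply: (measurable_exceeds (F := fun k w =>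
    levy_path t w (dyadic R m i + dyadic R p k) - levy_path t w (dyadic R m i))).
  move=> k _; apply: measurable_funB; apply: measurable_levy_path => //.
    by rewrite addr_ge0// dyadic_ge0.
  exact: dyadic_ge0.
by apply/seteqP; split => [w [i [im h]]|w [i im h]]; exists i.
Qed.

(** The condition of [levy_maximal] reads 2 sigma^2 (t / 2^m + 1) <= eps^2 t; each of the two
    numerical hypotheses bounds one summand by half the right-hand side. *)
Lemma block_oscillation (m p : nat) (eps t : R) (i : 'I_(2 ^ m)) :
  (m <= p)%N -> 0 < eps -> 0 < t -> 4 * sigma ^+ 2 / eps ^+ 2 <= 2 ^+ m ->
  4 * sigma ^+ 2 / eps ^+ 2 <= t ->
  fine (P [set w | exists2 k, (k <= 2 ^ (p - m))%N & 2 * eps <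
      `|levy_path t w (dyadic R m i + dyadic R p k) - levy_path t w (dyadic R m i)|])
  <= 2 * fine (P [set w | eps < `|levy_steps V t i w|]).
Proof.
move=> mp e0 t0 hm ht.
have st0 : 0 < Num.sqrt t by rewrite sqrtr_gt0.
pose u k := t * (dyadic R m i + dyadic R p k).
have u0 : 0 <= u 0%N by rewrite mulr_ge0 ?(ltW t0)// addr_ge0// dyadic_ge0.
have uE k : u k - u 0%N = t * dyadic R p k.
  by rewrite /u [dyadic R p 0]/dyadic mul0r; ring.
have uS k : (k < 2 ^ (p - m))%N -> u k <= u k.+1.
  move=> _; rewrite /u ler_pM2l// lerD2l /dyadic.
  by rewrite ler_wpM2r ?invr_ge0 ?exprn_ge0// ler_nat leqnSn.
have lam0 : 0 < eps * Num.sqrt t by rewrite mulr_gt0.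
have dK : dyadic R p (2 ^ (p - m)) = dyadic R m 1 by rewrite [RHS](dyadicE _ mp) mul1n.
have cond : 2 * (sigma ^+ 2 * (u (2 ^ (p - m))%N - u 0%N + 1)) <=
    (eps * Num.sqrt t) ^+ 2.
  rewrite uE dK exprMn sqr_sqrtr ?(ltW t0)// /dyadic div1r.
  have e20 : 0 < eps ^+ 2 by rewrite exprn_gt0.
  move: hm ht; rewrite !ler_pdivrMr// => hm ht.
  have m0 : 0 < 2 ^+ m :> R by rewrite exprn_gt0.
  have h1 : 2 * (sigma ^+ 2 * (t / 2 ^+ m)) <= 2^-1 * (t * eps ^+ 2).
    rewrite -(ler_pM2r m0).
    have -> : 2 * (sigma ^+ 2 * (t / 2 ^+ m)) * 2 ^+ m = 2 * t * sigma ^+ 2.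
      by field; rewrite gt_eqF.
    have : t * (4 * sigma ^+ 2) <= t * (2 ^+ m * eps ^+ 2) by rewrite ler_pM2l.
    by lra.
  by lra.
have := levy_maximal lV lam0 u0 uS cond.
have incE k w : 0 < Num.sqrt t -> levy_path t w (dyadic R m i + dyadic R p k) -
    levy_path t w (dyadic R m i) = (Num.sqrt t)^-1 * increment V (u 0%N) (u k) w.
  move=> _; rewrite /levy_path /increment /u [dyadic R p 0]/dyadic mul0r addr0; ring.
have gtE (c : R) (y : R) : (c < `|(Num.sqrt t)^-1 * y|) = (c * Num.sqrt t < `|y|).
  by rewrite normrM gtr0_norm ?invr_gt0// mulrC ltr_pdivlMr.
set A := [set w | exists2 k, _ & _]; set C := [set w | _].
have -> : A = [set w | exists2 k, (k <= 2 ^ (p - m))%N & 2 * eps <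
      `|levy_path t w (dyadic R m i + dyadic R p k) - levy_path t w (dyadic R m i)|].
  by apply/seteqP; split => w [k kn h]; exists k => //; move: h;
    rewrite incE// gtE mulrA.
have -> : C = [set w | eps < `|levy_steps V t i w|].
  have e1 : u 0%N = t * (i%:R / (2 ^ m)%:R).
    by rewrite /u /dyadic mul0r addr0 natrX.
  have e2 : u (2 ^ (p - m))%N = t * (i.+1%:R / (2 ^ m)%:R).
    rewrite /u dK /dyadic -mulrDl natr1 natrX//.
  by apply/seteqP; split => w; rewrite /C /= /levy_steps gtE -e1 -e2.
have mA : measurable [set w | exists2 k, (k <= 2 ^ (p - m))%N & 2 * eps <
      `|levy_path t w (dyadic R m i + dyadic R p k) - levy_path t w (dyadic R m i)|].
  apply: (measurable_exceeds (F := fun k w =>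
    levy_path t w (dyadic R m i + dyadic R p k) - levy_path t w (dyadic R m i))).
  move=> k _; apply: measurable_funB; apply: measurable_levy_path; rewrite ?(ltW t0)//.
    by rewrite addr_ge0// dyadic_ge0.
  exact: dyadic_ge0.
have mC : measurable [set w | eps < `|levy_steps V t i w|].
  have := measurable_exceeds (n := 0%N) (F := fun=> levy_steps V t i) eps
    (fun _ _ => measurable_levy_steps lV i (ltW t0)).
  rewrite (_ : [set w | exists2 k, _ & _] = [set w | eps < `|levy_steps V t i w|])//.
  by apply/seteqP; split => [w [k _]//|w h]; exists 0%N.
by rewrite -lee_fin EFinM !fineK// fin_num_measure.
Qed.

End oscillation.

Section cones_expectation.
Context {R : realType} {d d' : measure_display}.
Context {T : measurableType d} {T' : measurableType d'}.
Variables (P : probability T R) (V : R -> T -> R) (sigma : R).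
Variables (P' : probability T' R) (B : R -> T' -> R).
Hypothesis lV : square_integrable_levy P V sigma.
Hypothesis bB : brownian P' B.

Lemma uniform_threshold (n : nat) (Q : 'I_n -> R -> Prop) :
  (forall i, exists A, forall t, A <= t -> Q i t) ->
  exists A, forall t, A <= t -> forall i, Q i t.
Proof.
move=> /choice[A HA]; exists (\big[Num.max/0]_(i < n) A i) => t At i.
by apply: HA; apply: le_trans At; exact: (le_bigmax _ A i).
Qed.

(** The indicator of |x| > eps is dominated by two smooth functions, one for each sign, that vanish
    for |x| <= eps/2. Their expectations pass to the normal law, where they are at most (2/eps)^3
    times a third moment, of order 2^(-3m/2). *)
Lemma step_tail (m : nat) (i : 'I_(2 ^ m)) (eps : R) : 0 < eps ->
  forall e, 0 < e -> exists A, forall t, A <= t ->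
  fine (P [set w | eps < `|levy_steps V t i w|]) <=
  2 * (8 / eps ^+ 3 * (`|sigma| ^+ 3 * (12 * expR 2^-1 * (Num.sqrt (2 ^- m)) ^+ 3))) + e.
Proof.
move=> e0 e ee0; set K := `|sigma| ^+ 3 * _.
have N0 : 0 < (2 ^ m)%:R :> R by rewrite ltr0n expn_gt0.
pose chi (s x : R) := smoothstep (s * (2 / eps) * x + (-1)).
have schi s : smooth (chi s) by apply: smooth_affine; exact: smooth_smoothstep.
pose t0 : R := i%:R / (2 ^ m)%:R.
have t00 : 0 <= t0 by rewrite divr_ge0.
have h0 : 0 < (2 ^ m)%:R^-1 :> R by rewrite invr_gt0.
have t0h : t0 + (2 ^ m)%:R^-1 = i.+1%:R / (2 ^ m)%:R.
  by rewrite /t0 -natr1 mulrDl mul1r.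
have th1 : t0 + (2 ^ m)%:R^-1 <= 1.
  by rewrite t0h ler_pdivrMr// mul1r ler_nat.
have ttd : t0 < t0 + (2 ^ m)%:R^-1 by rewrite ltrDl.
have e20 : 0 < e / 2 by rewrite divr_gt0.
have [_ _ _ _ [i3 E3]] := brownian_increment_moments bB t00 ttd th1.
rewrite (addrC t0) addrK in E3; rewrite (addrC _ t0) in E3.
set I := increment B t0 (t0 + _) in i3 E3.
have mI : measurable_fun setT I.
  by apply: (brownian_measurable_increment bB) => //; lra.
have chi_le s : `|s| = 1 -> \int[P']_w chi s (sigma * I w) <= 8 / eps ^+ 3 * K.
  move=> s1; have [mchi _ _] := schi s.
  apply: (@le_trans _ _ (\int[P']_w (8 / eps ^+ 3 * `|sigma| ^+ 3 * `|I w| ^+ 3))).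
    apply: le_Rintegral => //.
    - apply: (@bounded_meas_norm_le _ _ _ _ _ 1).
        by apply: measurableT_comp => //; exact: measurable_funM.
      by move=> w; have /andP[c0 c1] := smoothstep_itv (s * (2 / eps) * (sigma * I w) + -1);
        rewrite ger0_norm.
    - by have := integrableZl measurableT (8 / eps ^+ 3 * `|sigma| ^+ 3) i3.
    - move=> w _; have -> : 8 / eps ^+ 3 * `|sigma| ^+ 3 * `|I w| ^+ 3 =
          (`|s * (2 / eps) * (sigma * I w)|) ^+ 3.
        rewrite !normrM s1 mul1r !exprMn normfV (gtr0_norm e0) exprVn.
        rewrite (ger0_norm (_ : 0 <= 2))//; ring.
      rewrite /chi; set y := s * (2 / eps) * (sigma * I w).
      have [y1|y1] := leP y 1.
        by rewrite smoothstep_le0 ?exprn_ge0//; lra.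
      have /andP[_ c1] := smoothstep_itv (y + -1).
      apply: (le_trans c1); rewrite exprn_ege1//.
      by apply: le_trans (ltW y1) (ler_norm _).
  rewrite RintegralZl// -(mulrA (8 / eps ^+ 3)) ler_wpM2l ?divr_ge0 ?exprn_ge0 ?(ltW e0)//.
  rewrite ler_wpM2l ?exprn_ge0//.
  by move: E3; rewrite natrX.
have [A1 H1] := clt_real lV bB (schi 1) t00 h0 th1 e20.
have [A2 H2] := clt_real lV bB (schi (-1)) t00 h0 th1 e20.
exists (Num.max (Num.max A1 A2) 0) => t; rewrite !ge_max => /andP[/andP[t1 t2] t3].
have mX := measurable_levy_steps lV i t3.
have XE w : (Num.sqrt t)^-1 * increment V (t * t0) (t * (t0 + (2 ^ m)%:R^-1)) w =
    levy_steps V t i w by rewrite t0h.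
have {}H1 := H1 t t1; have {}H2 := H2 t t2.
have b s : `|s| = 1 -> P.-integrable setT (EFin \o (fun w => chi s (levy_steps V t i w))).
  move=> s1; have [mchi _ _] := schi s.
  apply: (@bounded_meas_norm_le _ _ _ _ _ 1); first exact: measurableT_comp mchi mX.
  by move=> w; have /andP[c0 c1] := smoothstep_itv (s * (2 / eps) * levy_steps V t i w + -1);
    rewrite ger0_norm.
have b1 := b 1 (normr1 _); have b2 := b (-1) (normrN1 _).
have mC : measurable [set w | eps < `|levy_steps V t i w|].
  have := measurable_exceeds (n := 0%N) (F := fun=> levy_steps V t i) eps
    (fun _ _ => mX).
  rewrite (_ : [set w | exists2 k, _ & _] = [set w | eps < `|levy_steps V t i w|])//.
  by apply/seteqP; split => [w [k _]//|w h]; exists 0%N.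
have : fine (P [set w | eps < `|levy_steps V t i w|]) <=
    \int[P]_w (chi 1 (levy_steps V t i w) + chi (-1) (levy_steps V t i w)).
  apply: fine_probability_le => //.
  - by have := integrableD measurableT b1 b2.
  - move=> w; have /andP[c0 _] := smoothstep_itv (1 * (2 / eps) * levy_steps V t i w + -1).
    have /andP[c1 _] := smoothstep_itv (-1 * (2 / eps) * levy_steps V t i w + -1).
    by rewrite addr_ge0.
  - move=> w /=; set y := levy_steps V t i w; rewrite /chi => hy.
    have big (z : R) : eps < z -> 1 <= 2 / eps * z + -1.
      move=> hz; have : 2 / eps * eps <= 2 / eps * z.
        by rewrite ler_wpM2l ?divr_ge0// ltW.
      have -> : 2 / eps * eps = 2 by field; rewrite gt_eqF.
      by lra.
    have /andP[c0 _] := smoothstep_itv (1 * (2 / eps) * y + -1).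
    have /andP[c1 _] := smoothstep_itv (-1 * (2 / eps) * y + -1).
    move: hy; rewrite ltr_normr => /orP[hy|hy].
      rewrite [smoothstep (1 * _ * _ + _)]smoothstep_ge1 ?lerDl//.
      by rewrite mul1r; exact: big.
    rewrite [smoothstep (-1 * _ * _ + _)]smoothstep_ge1 ?lerDr//.
    have -> : -1 * (2 / eps) * y = 2 / eps * - y by ring.
    exact: big.
rewrite (RintegralD measurableT b1 b2) => h.
have c1 := chi_le 1 (normr1 _); have c2 := chi_le (-1) (normrN1 _).
move: H1 H2; under [X in `|X - _|]eq_Rintegral do rewrite XE.
move=> H1; under [X in `|X - _|]eq_Rintegral do rewrite XE.
move=> H2; move: H1 H2; rewrite !ler_norml => /andP[_ H1] /andP[_ H2].
by lra.
Qed.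

(** The block estimates are summed. The threshold on [t] depends on [m] but not on [p], because the
    maximal inequality does not see the fineness of the grid; this allows [p] to go to infinity with
    [t] fixed. *)
Lemma oscillation_small (eps e : R) : 0 < eps -> 0 < e -> exists m0, forall m,
  (m0 <= m)%N -> exists A, forall t, A <= t -> forall p, (m <= p)%N ->
  fine (P [set w | oscillates m p eps (levy_path V t w)]) <= e.
Proof.
move=> eps0 e0.
pose K : R := 8 / eps ^+ 3 * (`|sigma| ^+ 3 * (12 * expR 2^-1)).
have K0 : 0 <= K.
  apply: mulr_ge0; first by rewrite divr_ge0 ?exprn_ge0 ?(ltW eps0).
  by apply: mulr_ge0; rewrite ?exprn_ge0//; apply: mulr_ge0; rewrite ?expR_ge0.
(* [b <= 2 ^+ m] yields both 4 K 2^(-m/2) <= e/2 for the Gaussian part and the condition of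
   [block_oscillation]. *)
pose b : R := (8 * K / e) ^+ 2 + 4 * sigma ^+ 2 / eps ^+ 2.
have s0 : 0 <= 4 * sigma ^+ 2 / eps ^+ 2.
  by rewrite divr_ge0 ?exprn_ge0 ?(ltW eps0)// mulr_ge0// sqr_ge0.
exists (Num.truncn b).+1 => m hm.
have bm : b <= 2 ^+ m.
  apply: (le_trans (ltW (truncnS_gt b))); rewrite -natrX ler_nat.
  by apply: leq_trans hm _; apply: ltnW; exact: ltn_expl.
have m0 : 0 < 2 ^+ m :> R by rewrite exprn_gt0.
pose e1 := e / 4 / 2 ^+ m.
have e10 : 0 < e1 by rewrite !divr_gt0.
have [A HA] := uniform_threshold (fun i : 'I_(2 ^ m) => step_tail i eps0 e10).
exists (Num.max A (Num.max 1 (4 * sigma ^+ 2 / eps ^+ 2))) => t.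
rewrite !ge_max => /and3P[tA t1 t2] p mp.
have t0 : 0 < t by lra.
have hm' : 4 * sigma ^+ 2 / eps ^+ 2 <= 2 ^+ m.
  by apply: le_trans bm; rewrite /b lerDr sqr_ge0.
pose bi : R := 2 * (2 * (K * (Num.sqrt (2 ^- m)) ^+ 3) + e1).
apply: (@le_trans _ _ (\sum_(i < 2 ^ m) bi)).
  apply: (@fine_probability_bigcup _ _ _ P (2 ^ m) (fun i => [set w |
      exists2 k, (k <= 2 ^ (p - m))%N & 2 * eps < `|levy_path V t w
      (dyadic R m i + dyadic R p k) - levy_path V t w (dyadic R m i)|])).
  - move=> i; apply: (measurable_exceeds (F := fun k w =>
      levy_path V t w (dyadic R m i + dyadic R p k) - levy_path V t w (dyadic R m i))).
    move=> k _; apply: measurable_funB; apply: (measurable_levy_path lV); rewrite ?(ltW t0)//.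
      by rewrite addr_ge0// dyadic_ge0.
    exact: dyadic_ge0.
  - move=> i; apply: (le_trans (block_oscillation lV i mp eps0 t0 hm' t2)).
    rewrite /bi ler_pM2l//; have := HA t tA i.
    by rewrite /K !mulrA.
  - by apply: (measurable_oscillates lV); exact: ltW.
  - move=> w [i [im h]]; by exists (Ordinal im).
rewrite sumr_const card_ord -[_ *+ _]mulr_natl natrX /bi.
set q := Num.sqrt (2 ^- m).
have q2 : q ^+ 2 = 2 ^- m by rewrite sqr_sqrtr// invr_ge0 ltW.
have q0 : 0 <= q by exact: sqrtr_ge0.
have -> : 2 ^+ m * (2 * (2 * (K * q ^+ 3) + e1)) = 4 * K * q + e / 2.
  have -> : q ^+ 3 = 2 ^- m * q by rewrite exprSr q2.
  by rewrite /e1; field; rewrite gt_eqF.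
have : 4 * K * q <= e / 2.
  have hq : (8 * K / e * q) ^+ 2 <= 1.
    rewrite exprMn q2 ler_pdivrMr// mul1r; apply: le_trans bm.
    by rewrite /b lerDl.
  have : 8 * K / e * q <= 1.
    rewrite -ler_sqr ?nnegrE ?expr1n// mulr_ge0// divr_ge0 ?(ltW e0)//.
    by rewrite mulr_ge0.
  rewrite mulrAC ler_pdivrMr// mul1r; lra.
by lra.
Qed.

(** Read only on the grid of order [m], where the strict inequality makes the value at the [i]-th
    point the sum of the first [i] steps. *)
Definition path_of_steps (m : nat) (xi : 'I_(2 ^ m) -> R) (x : R) : R :=
  \sum_(l < 2 ^ m | dyadic R m l < x) xi l.

Let path_stepsE (m i : nat) (xi : 'I_(2 ^ m) -> R) :
  path_of_steps xi (dyadic R m i) = \sum_(l < 2 ^ m | (l < i)%N) xi l.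
Proof.
by apply: eq_bigl => l; rewrite /dyadic ltr_pM2r ?ltr_nat ?invr_gt0 ?exprn_gt0.
Qed.

Lemma cones_fun_eq S p (x y : R -> R) :
  (forall i, (i <= 2 ^ p)%N -> x (dyadic R p i) = y (dyadic R p i)) ->
  cones_fun S p x = cones_fun S p y.
Proof.
move=> h; apply/eqP; rewrite -subr_eq0 -normr_le0 -(mulr0 (cones_lip S)).
by apply: cones_fun_lipschitz => i ip; rewrite h// subrr normr0.
Qed.

Let levy_cones (S : seq cone) m t w :
  cones_fun S m (levy_path V t w) = cones_fun S m (@path_of_steps m (levy_steps V t ^~ w)).
Proof.
apply: cones_fun_eq => i im; rewrite path_stepsE /levy_path /levy_steps.
rewrite -mulr_sumr; congr (_ * _).
rewrite (sum_increment V (fun i => t * (i%:R / (2 ^ m)%:R)) w im).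
by rewrite mul0r mulr0 /dyadic natrX.
Qed.

Let brownian_cones (S : seq cone) m w :
  cones_fun S m (brownian_path sigma B w) =
  cones_fun S m (@path_of_steps m (fun i => brownian_steps sigma B i w)).
Proof.
apply: cones_fun_eq => i im; rewrite path_stepsE /brownian_path /brownian_steps.
rewrite -mulr_sumr; congr (_ * _).
rewrite (sum_increment B (fun i => i%:R / (2 ^ m)%:R) w im).
by rewrite mul0r /dyadic natrX.
Qed.

Lemma measurable_levy_cones (S : seq cone) p t : 0 <= t ->
  measurable_fun setT (fun w => cones_fun S p (levy_path V t w)).
Proof.
move=> t0; apply: (@measurable_cones_fun _ _ _ S p (fun x w => levy_path V t w x)) => i ip.
by apply: (measurable_levy_path lV) => //; exact: dyadic_ge0.
Qed.

Lemma measurable_brownian_cones (S : seq cone) p :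
  measurable_fun setT (fun w => cones_fun S p (brownian_path sigma B w)).
Proof.
apply: (@measurable_cones_fun _ _ _ S p (fun x w => brownian_path sigma B w x)) => i ip.
by apply: (measurable_brownian_path sigma bB); [exact: dyadic_ge0|exact: dyadic_le1].
Qed.

Lemma cones_liminf_grid (S : seq cone) (m : nat) (e : R) : 0 < e ->
  exists A, forall t, A <= t ->
  \int[P']_w cones_fun S m (brownian_path sigma B w) - e <=
  \int[P]_w cones_fun S m (levy_path V t w).
Proof.
move=> e0.
pose G (xi : 'I_(2 ^ m) -> R) := cones_fun S m (path_of_steps xi).
(* A value on the grid is a sum of up to [2 ^ m] steps, hence the extra factor; it may depend on
   [m], which stays fixed here. *)
have GL x y (r : R) : (forall i, `|x i - y i| <= r) ->
    `|G x - G y| <= (cones_lip S * (2 ^ m)%:R) * r.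
  move=> h; rewrite -mulrA; apply: cones_fun_lipschitz => i im.
  rewrite !path_stepsE -sumrB; apply: (le_trans (ler_norm_sum _ _ _)).
  rewrite mulr_natl -[X in _ *+ X]card_ord -sumr_const [leLHS]big_mkcond/=.
  apply: ler_sum => l _; case: ifP => _; first exact: h.
  exact: le_trans (h l).
have [| | |A HA] := @fdd_liminf _ _ _ _ _ P V sigma P' B lV bB (2 ^ m)%N _ G
  (cones_bound S) (cones_lip S * (2 ^ m)%:R)
  (fun _ => cones_fun_ge0 _ _ _) (fun _ => cones_fun_le _ _ _) GL _ _ e e0.
- by rewrite expn_gt0.
- rewrite (_ : (fun w => _) = fun w => cones_fun S m (brownian_path sigma B w)).
    exact: measurable_brownian_cones.
  by apply/funext => w; rewrite brownian_cones.
- move=> t t0.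
  rewrite (_ : (fun w => _) = fun w => cones_fun S m (levy_path V t w)).
    exact: measurable_levy_cones.
  by apply/funext => w; rewrite levy_cones.
exists A => t At; have := HA t At; rewrite /G.
under eq_Rintegral do rewrite -brownian_cones.
by under [X in _ <= X]eq_Rintegral do rewrite -levy_cones.
Qed.

(** Refining the grid from [m'] to [p] costs [L * (2 * eps)] off the oscillation event and at most
    [M] on it. A third of [e] is spent on each of these and on the convergence on the grid of order
    [m']. *)
Lemma cones_liminf (S : seq cone) (e : R) : 0 < e ->
  exists m, forall m', (m <= m')%N -> exists A, forall t, A <= t ->
  forall p, (m' <= p)%N ->
  \int[P']_w cones_fun S m' (brownian_path sigma B w) - e <=
  \int[P]_w cones_fun S p (levy_path V t w).
Proof.
move=> e0; pose L : R := cones_lip S; pose M : R := cones_bound S.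
have L0 : 0 <= L := cones_lip_ge0 S; have M0 : 0 <= M := cones_bound_ge0 S.
pose eps := e / (6 * (L + 1)); pose e1 := e / (3 * (M + 1)).
have L1 : 0 < 6 * (L + 1) by rewrite mulr_gt0// ltr_wpDl.
have M1 : 0 < 3 * (M + 1) by rewrite mulr_gt0// ltr_wpDl.
have eps0 : 0 < eps by rewrite divr_gt0.
have e10 : 0 < e1 by rewrite divr_gt0.
have Leps : L * (2 * eps) <= e / 3.
  have : 6 * (L + 1) * eps = e by rewrite /eps mulrCA divff ?mulr1 ?gt_eqF.
  by move: eps0; lra.
have Me1 : M * e1 <= e / 3.
  have : 3 * (M + 1) * e1 = e by rewrite /e1 mulrCA divff ?mulr1 ?gt_eqF.
  by move: e10; lra.
have [m0 H0] := oscillation_small eps0 e10.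
exists (maxn m0 (cones_order S)) => m; rewrite geq_max => /andP[m0m Sm].
have [A1 H1] := H0 m m0m.
have e30 : 0 < e / 3 by rewrite divr_gt0.
have [A2 H2] := cones_liminf_grid S m e30.
exists (Num.max (Num.max A1 A2) 0) => t; rewrite !ge_max => /andP[/andP[t1 t2] t0] p mp.
have {}H1 := H1 t t1 p mp; have {}H2 := H2 t t2.
pose Osc := [set w | oscillates m p eps (levy_path V t w)].
have mO : measurable Osc by exact: (measurable_oscillates lV).
have ic q : P.-integrable setT (EFin \o (fun w => cones_fun S q (levy_path V t w))).
  apply: (@bounded_meas_norm_le _ _ _ _ _ M); first exact: measurable_levy_cones.
  by move=> w; rewrite ger0_norm ?cones_fun_ge0// cones_fun_le.
have i1 : P.-integrable setT (EFin \o cst (L * (2 * eps))).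
  exact: finite_measure_integrable_cst.
have iO : P.-integrable setT (EFin \o (\1_Osc : T -> R)) by exact: integrable_indic.
have iMO : P.-integrable setT (EFin \o (fun w => M * \1_Osc w)).
  by have := integrableZl measurableT M iO.
have ip1 : P.-integrable setT (EFin \o (fun w => cones_fun S p (levy_path V t w) +
    L * (2 * eps))).
  by have := integrableD measurableT (ic p) i1.
have : \int[P]_w cones_fun S m (levy_path V t w) <=
    \int[P]_w (cones_fun S p (levy_path V t w) + L * (2 * eps) + M * \1_Osc w).
  apply: le_Rintegral => //.
    by have := integrableD measurableT ip1 iMO.
  move=> w _; rewrite indicE; case: (boolP (w \in Osc)) => wO; last first.
    rewrite mulr0 addr0; apply: cones_fun_osc => //.
      by rewrite mulr_ge0// ltW.
    move=> i k im kp; rewrite leNgt; apply/negP => h; move/negP : wO; apply.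
    by rewrite inE; exists i; split => //; exists k.
  rewrite mulr1; apply: (le_trans (cones_fun_le _ _ _)).
  by rewrite lerDr addr_ge0 ?cones_fun_ge0// mulr_ge0// mulr_ge0// ltW.
rewrite (RintegralD measurableT ip1 iMO) (RintegralD measurableT (ic p) i1).
rewrite Rintegral_prob_cst RintegralZl//.
have -> : \int[P]_w \1_Osc w = fine (P Osc).
  by rewrite /Rintegral integral_indic// setIT.
have : M * fine (P Osc) <= M * e1 by rewrite ler_wpM2l.
by lra.
Qed.

End cones_expectation.

(** * Logarithmic averages *)

Section harmonic_sums.
Context {R : realType}.

Definition harm (n : nat) : R := \sum_(k < n) k.+1%:R^-1.

Lemma harmS n : harm n.+1 = harm n + n.+1%:R^-1.
Proof. by rewrite /harm big_ord_recr. Qed.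

Lemma harm_ge0 n : 0 <= harm n.
Proof. by apply: sumr_ge0 => k _; rewrite invr_ge0. Qed.

Lemma invS_le_lnB (n : nat) : (0 < n)%N ->
  n.+1%:R^-1 <= ln n.+1%:R - ln n%:R :> R.
Proof.
move=> n0; have n0R : 0 < n%:R :> R by rewrite ltr0n.
have : ln (1 + (- n.+1%:R^-1)) <= - n.+1%:R^-1 :> R.
  by apply: le_ln1Dx; rewrite ltrN2 invf_lt1// ltr1n.
have -> : 1 + (- n.+1%:R^-1) = n%:R / n.+1%:R :> R.
  by rewrite -natr1; field; rewrite natr1 pnatr_eq0.
rewrite ln_div ?posrE// => h; rewrite -lerN2 opprB; exact: h.
Qed.

Lemma invS_ge_lnB (n : nat) : ln n.+2%:R - ln n.+1%:R <= n.+1%:R^-1 :> R.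
Proof.
have : ln (1 + n.+1%:R^-1) <= n.+1%:R^-1 :> R.
  by apply: le_ln1Dx; apply: (@lt_trans _ _ 0); rewrite ?ltrN10// invr_gt0.
have -> : 1 + n.+1%:R^-1 = n.+2%:R / n.+1%:R :> R.
  have : n.+1%:R != 0 :> R by rewrite pnatr_eq0.
  by rewrite -[n.+2%:R]natr1; set x : R := n.+1%:R => x0; rewrite mulrDl divff// mul1r.
by rewrite ln_div ?posrE.
Qed.

Lemma harm_block (a b : nat) : (0 < a)%N -> (a <= b)%N ->
  harm b - harm a <= ln b%:R - ln a%:R.
Proof.
move=> a0; elim: b => [|b IH]; first by rewrite leqNgt a0.
rewrite leq_eqVlt => /predU1P[->|]; first by rewrite !subrr.
rewrite ltnS => ab; rewrite harmS; have := IH ab.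
have := invS_le_lnB (leq_trans a0 ab).
move: (ln _) (ln _) (ln _) (_^-1) (harm b) (harm a) => x y z u v t; lra.
Qed.

Lemma harm_le n : (0 < n)%N -> harm n <= 1 + ln n%:R.
Proof.
move=> n0; have := harm_block (isT : (0 < 1)%N) n0.
by rewrite ln1 harmS /harm big_ord0 add0r invr1; lra.
Qed.

Lemma harm_ge n : ln n.+1%:R <= harm n.
Proof.
elim: n => [|n IH]; first by rewrite ln1 /harm big_ord0.
by rewrite harmS; have := lerD IH (invS_ge_lnB n); rewrite addrC subrK.
Qed.

(** Comparison with the integral of x^(g-1); the constant is 2/g in place of 1/g so that the crude
    bound e^(-y) <= 1 - y/2 on [0,1] closes the induction. *)
Lemma sum_powR_le (g : R) (n : nat) : 0 < g -> g <= 1 ->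
  \sum_(j < n) (j.+1%:R `^ g) / j.+1%:R <= 2 / g * n%:R `^ g.
Proof.
move=> g0 g1; elim: n => [|n IH].
  by rewrite big_ord0 powR0 ?mulr0// gt_eqF.
rewrite big_ord_recr/=; apply: (le_trans (lerD IH (lexx _))).
set y := g / n.+1%:R; set X := n.+1%:R `^ g.
have N0 : 0 < n.+1%:R :> R by [].
have y0 : 0 < y by rewrite divr_gt0.
have y1 : y <= 1 by rewrite ler_pdivrMr// mul1r (le_trans g1)// ler1n.
have X0 : 0 < X by rewrite powR_gt0.
suff H : n%:R `^ g <= X * (1 - y / 2).
  have : 2 / g * n%:R `^ g <= 2 / g * (X * (1 - y / 2)).
    by rewrite ler_wpM2l// divr_ge0// ltW.
  have -> : 2 / g * (X * (1 - y / 2)) = 2 / g * X - X / n.+1%:R.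
    have E (N X' : R) : 0 < N -> 2 / g * (X' * (1 - g / N / 2)) = 2 / g * X' - X' / N.
      by move=> ?; field; rewrite !gt_eqF.
    by rewrite /y E.
  by rewrite -lerBrDr.
case: n N0 @y @X IH y0 y1 X0 => [|n] N0 y X IH y0 y1 X0.
  by rewrite powR0 ?gt_eqF// mulr_ge0 ?(ltW X0)//; lra.
have n0 : 0 < n.+1%:R :> R by [].
have -> : n.+1%:R `^ g = X * expR (g * (ln n.+1%:R - ln n.+2%:R)).
  rewrite /X /powR !gt_eqF// -expRD; congr expR; ring.
rewrite ler_pM2l//.
have h := invS_le_lnB (ltn0Sn n).
apply: (@le_trans _ _ (expR (- y))).
  rewrite ler_expR /y -mulrN ler_pM2l// -lerN2 opprK opprB; exact: h.
rewrite expRN -[leLHS]mul1r ler_pdivrMr ?expR_gt0//.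
have e1 := expR_ge1Dx y.
have : (1 - y / 2) * (1 + y) <= (1 - y / 2) * expR y by rewrite ler_wpM2l//; lra.
have : y * y <= y * 1 by rewrite ler_pM2l.
by lra.
Qed.

Lemma sum_inv_sq_le n : \sum_(i < n.+1) (i.+1%:R ^+ 2)^-1 <= 2 - n.+1%:R^-1 :> R.
Proof.
elim: n => [|n IH]; first by rewrite big_ord1 expr1n invr1; lra.
rewrite big_ord_recr/=; apply: (le_trans (lerD IH (lexx _))).
rewrite -[n.+2%:R]natr1; set x : R := n.+1%:R.
have x0 : 0 < x by rewrite ltr0n.
have xS : 0 < x + 1 by lra.
have -> : 2 - (x + 1)^-1 = 2 - x^-1 + (x * (x + 1))^-1.
  by field; rewrite !gt_eqF.
rewrite lerD2l lef_pV2 ?posrE ?mulr_gt0 ?exprn_gt0// expr2 ler_pM2r//; lra.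
Qed.

End harmonic_sums.

Section log_average_law_of_large_numbers.
Context {R : realType} {d : measure_display} {T : measurableType d}.
Variables (P : probability T R) (Z : nat -> T -> R) (M K g : R).
Hypothesis mZ : forall k, measurable_fun setT (Z k).
Hypothesis ZM : forall k w, `|Z k w| <= M.
Hypothesis g0 : 0 < g.
Hypothesis g1 : g <= 1.
Hypothesis cZ : forall j k, (j <= k)%N ->
  \int[P]_w (Z j w * Z k w) <= K * (j.+1%:R `^ g / k.+1%:R `^ g).

Let S n w := \sum_(k < n) Z k w / k.+1%:R.

Let mS n : measurable_fun setT (S n).
Proof. by apply: measurable_sum => k; apply: measurable_funM. Qed.

Let SM n w : `|S n w| <= M * harm n.
Proof.
apply: (le_trans (ler_norm_sum _ _ _)); rewrite /harm mulr_sumr.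
apply: ler_sum => k _; rewrite normrM normfV (ger0_norm (ler0n _ _)).
by rewrite ler_wpM2r// ZM.
Qed.

Let M0 : 0 <= M.
Proof. by apply: le_trans (ZM 0 point). Qed.

Let iS2 n : P.-integrable setT (EFin \o (fun w => S n w ^+ 2)).
Proof.
apply: (@bounded_meas_norm_le _ _ _ _ _ ((M * harm n) ^+ 2)).
  by apply: measurable_funX.
move=> w; rewrite normrX ler_sqr ?nnegrE//; exact: le_trans (SM n w).
Qed.

(** The new index adds cross terms, at most 2 K (n+1)^(-1-g) times the sum of (j+1)^(g-1), hence at
    most (4K/g)/(n+1), and a square, at most M^2/(n+1). The second moment thus grows like ln n, not
    like its square. *)
Let second_moment n : \int[P]_w (S n w ^+ 2) <= (4 * K / g + M ^+ 2) * harm n.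
Proof.
have K0 : 0 <= K.
  have := cZ (leqnn 0); rewrite powR1 divrr ?unitr1// mulr1; apply: le_trans.
  by apply: Rintegral_ge0 => w _; rewrite -expr2 sqr_ge0.
elim: n => [|n IH].
  rewrite /harm big_ord0 mulr0 /S; under eq_Rintegral do rewrite big_ord0 expr0n/=.
  by rewrite Rintegral_prob_cst.
have iZZ j : P.-integrable setT (EFin \o (fun w => 2 / n.+1%:R * (Z j w * Z n w / j.+1%:R))).
  apply: (@bounded_meas_norm_le _ _ _ _ _ (2 / n.+1%:R * (M * M / j.+1%:R))).
    by do 3! apply: measurable_funM => //.
  move=> w; rewrite !normrM !normfV !(ger0_norm (ler0n _ _))//.
  rewrite ler_wpM2l// ler_wpM2r// ler_pM//; exact: ZM.
have iZ2 : P.-integrable setT (EFin \o (fun w => (Z n w / n.+1%:R) ^+ 2)).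
  apply: (@bounded_meas_norm_le _ _ _ _ _ ((M / n.+1%:R) ^+ 2)).
    by apply: measurable_funX; apply: measurable_funM.
  move=> w; rewrite normrX ler_sqr ?nnegrE// ?divr_ge0//.
  by rewrite normrM normfV (ger0_norm (ler0n _ _)) ler_wpM2r.
have -> : \int[P]_w (S n.+1 w ^+ 2) = \int[P]_w (S n w ^+ 2 +
    (\sum_(j < n) 2 / n.+1%:R * (Z j w * Z n w / j.+1%:R) + (Z n w / n.+1%:R) ^+ 2)).
  apply: eq_Rintegral => w _; rewrite /S big_ord_recr/= -/(S n w).
  rewrite -mulr_sumr (eq_bigr (fun j : 'I_n => Z j w / j.+1%:R * Z n w)); last first.
    by move=> j _; rewrite mulrAC.
  by rewrite -mulr_suml -/(S n w); ring.
have iSum : P.-integrable setT (EFin \o (fun w =>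
    \sum_(j < n) 2 / n.+1%:R * (Z j w * Z n w / j.+1%:R))).
  exact: (integrable_sum_EFin (index_enum 'I_n) (fun j : 'I_n => iZZ j)).
rewrite (RintegralD measurableT (iS2 n)); last by have := integrableD measurableT iSum iZ2.
rewrite (RintegralD measurableT iSum iZ2) harmS [leRHS]mulrDr; apply: lerD => //.
have N0 : 0 < n.+1%:R :> R by rewrite ltr0n.
have N1 : 1 <= n.+1%:R :> R by rewrite ler1n.
rewrite [leRHS]mulrDl; apply: lerD; last first.
  rewrite -[leRHS](Rintegral_prob_cst P); apply: le_Rintegral => //.
    exact: finite_measure_integrable_cst.
  move=> w _; rewrite -real_normK ?num_real// normrM normfV (ger0_norm (ler0n _ _)).
  rewrite exprMn; apply: ler_pM => //.
  - by rewrite ler_sqr ?nnegrE// ZM.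
  - by rewrite expr2 -[leRHS]mul1r ler_wpM2r// invf_le1.
rewrite Rintegral_sum//.
apply: (@le_trans _ _ (\sum_(j < n)
    2 * K / n.+1%:R / n.+1%:R `^ g * (j.+1%:R `^ g / j.+1%:R))).
  apply: ler_sum => j _.
  have -> : \int[P]_w (2 / n.+1%:R * (Z j w * Z n w / j.+1%:R)) =
      2 / n.+1%:R / j.+1%:R * \int[P]_w (Z j w * Z n w).
    rewrite -RintegralZl//; first by apply: eq_Rintegral => w _; ring.
    apply: (@bounded_meas_norm_le _ _ _ _ _ (M * M)); first exact: measurable_funM.
    by move=> w; rewrite normrM ler_pM//; exact: ZM.
  have := cZ (ltnW (ltn_ord j)) => /(ler_wpM2l _) h.
  have c0 : 0 <= 2 / n.+1%:R / j.+1%:R :> R by rewrite !divr_ge0.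
  by apply: (le_trans (h _ c0)); rewrite le_eqVlt; apply/orP; left; apply/eqP; ring.
rewrite -mulr_sumr; have := sum_powR_le n g0 g1.
have c0 : 0 <= 2 * K / n.+1%:R / n.+1%:R `^ g.
  by rewrite !divr_ge0// ?powR_ge0// mulr_ge0.
move=> /(ler_wpM2l c0) /le_trans; apply.
have : n%:R `^ g <= n.+1%:R `^ g :> R by rewrite ge0_ler_powR ?nnegrE ?ler_nat// ltW.
have c1 : 0 <= 2 * K / n.+1%:R / n.+1%:R `^ g * (2 / g).
  by rewrite mulr_ge0// divr_ge0// ltW.
move=> /(ler_wpM2l c1); rewrite -[leLHS]mulrA => /le_trans; apply.
rewrite le_eqVlt; apply/orP; left; apply/eqP; field.
by rewrite !gt_eqF// powR_gt0.
Qed.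


(* The second moments of the averages are O(1 / ln n), hence summable along this
   subsequence. *)
Let N (i : nat) := (2 ^ (i.+1 ^ 2))%N.
Let l : R := ln 2.
Let l0 : 0 < l. Proof. by rewrite ln_gt0// ltr1n. Qed.

Let lnN i : ln (N i)%:R = i.+1%:R ^+ 2 * l :> R.
Proof. by rewrite /N natrX lnXn// -[LHS]mulr_natl natrX. Qed.

Let N_gt0 i : (0 < N i)%N. Proof. by rewrite expn_gt0. Qed.

Let Y i w := (S (N i) w / ln (N i)%:R) ^+ 2.

Let Y_summable n : \int[P]_w (\sum_(i < n) Y i w) <=
  2 * ((4 * K / g + M ^+ 2) * (1 + l) / l ^+ 2).
Proof.
have C0 : 0 <= 4 * K / g + M ^+ 2.
  have := second_moment 1; rewrite harmS /harm big_ord0 add0r invr1 mulr1.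
  by apply: le_trans; apply: Rintegral_ge0 => w _; rewrite sqr_ge0.
set C := 4 * K / g + M ^+ 2 in C0 *.
have iY i : P.-integrable setT (EFin \o Y i).
  rewrite (_ : _ \o _ = EFin \o (fun w => (ln (N i)%:R)^-1 ^+ 2 * S (N i) w ^+ 2)).
    by have := integrableZl measurableT ((ln (N i)%:R)^-1 ^+ 2) (iS2 (N i)).
  by apply/funext => w /=; rewrite /Y exprMn mulrC.
rewrite (Rintegral_sum (index_enum _) (fun i : 'I_n => iY i)).
apply: (@le_trans _ _ (\sum_(i < n) C * (1 + l) / l ^+ 2 * (i.+1%:R ^+ 2)^-1)).
  apply: ler_sum => i _.
  have -> : \int[P]_w Y i w = (ln (N i)%:R)^-1 ^+ 2 * \int[P]_w (S (N i) w ^+ 2).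
    by rewrite -RintegralZl//; apply: eq_Rintegral => w _; rewrite /Y exprMn mulrC.
  have c0 : 0 <= (ln (N i)%:R)^-1 ^+ 2 :> R by rewrite sqr_ge0.
  apply: (le_trans (ler_wpM2l c0 (second_moment (N i)))).
  apply: (le_trans (ler_wpM2l c0 (ler_wpM2l C0 (harm_le (N_gt0 i))))).
  rewrite lnN; set x : R := i.+1%:R.
  have x1 : 1 <= x ^+ 2 by rewrite exprn_ege1// ler1n.
  have x0 : 0 < x ^+ 2 by lra.
  have -> : (x ^+ 2 * l)^-1 ^+ 2 * (C * (1 + x ^+ 2 * l)) =
      C / l ^+ 2 * ((1 + x ^+ 2 * l) / (x ^+ 2 * x ^+ 2)).
    by field; rewrite !gt_eqF// ltr0n.
  have -> : C * (1 + l) / l ^+ 2 * (x ^+ 2)^-1 = C / l ^+ 2 * ((1 + l) / x ^+ 2).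
    by field; rewrite !gt_eqF// ltr0n.
  rewrite ler_wpM2l ?divr_ge0 ?sqr_ge0// ler_pdivrMr ?mulr_gt0// mulrA divfK ?gt_eqF//.
  by rewrite mulrDl mul1r mulrC lerD2r.
rewrite -mulr_sumr mulrC ler_wpM2r//.
  by rewrite divr_ge0 ?sqr_ge0// mulr_ge0// addr_ge0// ltW.
case: n => [|n]; first by rewrite big_ord0.
by apply: le_trans (sum_inv_sq_le n) _; rewrite lerBlDr lerDl.
Qed.

(** The series of the squares [Y i] has finite expectation, so it converges almost surely and its
    terms tend to 0. *)
Let subsequence_cvg :
  {ae P, forall w, S (N i) w / ln (N i)%:R @[i --> \oo] --> 0}.
Proof.
have mY i : measurable_fun setT (Y i).
  by apply: measurable_funX; apply: measurable_funM.
have Y0 i w : 0 <= Y i w by exact: sqr_ge0.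
have mYs : measurable_fun setT (fun w => \sum_(i <oo) (Y i w)%:E)%E.
  apply: (@ge0_emeasurable_sum _ _ _ setT (fun i w => (Y i w)%:E) xpredT).
    by move=> i w _ _; rewrite lee_fin.
  by move=> i _; apply/measurable_EFinP.
have fin : (\int[P]_w \sum_(i <oo) (Y i w)%:E < +oo)%E.
  rewrite integral_nneseries; [|by []|by move=> i; apply/measurable_EFinP|
    by move=> i w _; rewrite lee_fin].
  apply: (@le_lt_trans _ _ (2 * ((4 * K / g + M ^+ 2) * (1 + l) / l ^+ 2))%:E);
    last exact: ltry.
  apply: lime_le.
    by apply: is_cvg_nneseries => i _ _; apply: integral_ge0 => w _; rewrite lee_fin.
  apply: nearW => n.
  rewrite -ge0_integral_sum; [|by []|by move=> i; apply/measurable_EFinP|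
    by move=> i w _; rewrite lee_fin].
  apply: le_trans (_ : _ <= (\int[P]_w (\sum_(i < n) Y i w))%:E)%E _; last first.
    by rewrite lee_fin; exact: Y_summable.
  rewrite /Rintegral fineK.
    apply: ge0_le_integral => //=.
    - by move=> w _; apply: sume_ge0 => i _; rewrite lee_fin.
    - by apply: emeasurable_sum => i; apply/measurable_EFinP.
    - by apply/measurable_EFinP; apply: measurable_sum.
    - by move=> w _; rewrite sumEFin big_mkord.
  apply: integrable_fin_num => //.
  apply: (@integrable_sum_EFin _ _ _ P _ (index_enum _) (fun i : 'I_n => Y i)) => i.
  rewrite (_ : _ \o _ = EFin \o (fun w => (ln (N i)%:R)^-1 ^+ 2 * S (N i) w ^+ 2)).
    by have := integrableZl measurableT ((ln (N i)%:R)^-1 ^+ 2) (iS2 (N i)).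
  by apply/funext => w /=; rewrite /Y exprMn mulrC.
have /integrable_ae : P.-integrable setT (fun w => \sum_(i <oo) (Y i w)%:E)%E.
  apply/integrableP; split => //; rewrite (le_lt_trans _ fin)//.
  rewrite le_eqVlt; apply/orP; left; apply/eqP; apply: eq_integral => w _.
  by rewrite gee0_abs//; apply: nneseries_ge0 => i _ _; rewrite lee_fin.
move=> /(_ measurableT); apply: filterS => w /(_ I) fw.
have : Y i w @[i --> \oo] --> 0.
  apply: cvg_series_cvg_0; apply: nondecreasing_is_cvgn.
    apply/nondecreasing_seqP => n; rewrite /series/= big_nat_recr//= lerDl; exact: Y0.
  exists (fine (\sum_(i <oo) (Y i w)%:E)%E) => _ [n _ <-].
  rewrite -lee_fin fineK// /series/= -sumEFin.
  apply: nneseries_lim_ge => i _ _; rewrite lee_fin; exact: Y0.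
move=> Yw; have : Num.sqrt (Y i w) @[i --> \oo] --> 0.
  by rewrite -[X in _ --> X]sqrtr0; apply: continuous_cvg Yw => //; exact: sqrt_continuous.
under eq_cvg do rewrite /Y sqrtr_sqr.
by move=> h; apply/norm_cvg0P.
Qed.

(** Let n lie between N_i and N_(i+1). The sums at n and at N_i differ by at most M (ln N_(i+1) - ln
    N_i), which is linear in i, whereas ln N_i is quadratic in i. *)
Lemma log_average_cvg0 :
  {ae P, forall w, (ln n%:R)^-1 * \sum_(k < n) Z k w / k.+1%:R @[n --> \oo] --> 0}.
Proof.
apply: filterS subsequence_cvg => w Sw.
apply/cvgrPdist_lt => e e0.
have e20 : 0 < e / 2 by rewrite divr_gt0.
have [i0 _ H0] := (cvgrPdist_lt _ _).1 Sw (e / 2) e20.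
(* With x = i + 1 the variation inside a block is at most 3 M l x, which is below (e/2) l x^2 once x
   > 6 M / e. *)
pose i1 := maxn i0 (Num.truncn (6 * M / e)).
exists (N i1) => //= n Nn.
have exN : exists i, (N i <= n)%N by exists i1.
have ltNn i : (N i <= n)%N -> (i <= n)%N.
  move=> /(leq_trans _); apply; apply: ltnW.
  apply: (leq_trans (ltn_expl i (ltnSn 1))); rewrite /N leq_exp2l//.
  by rewrite (leq_trans (leqnSn i))// expnS leq_pmulr// expn_gt0.
pose i := ex_maxn exN ltNn.
have [Ni imax] : (N i <= n)%N /\ forall j, (N j <= n)%N -> (j <= i)%N.
  by rewrite /i; case: ex_maxnP.
have i1i : (i1 <= i)%N by exact: imax.
have nN : (n <= N i.+1)%N.
  by rewrite leqNgt; apply/negP => /ltnW /imax; rewrite ltnn.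
rewrite sub0r normrN normrM -/(S n w).
have lnNi0 : 0 < ln (N i)%:R :> R by rewrite lnN mulr_gt0// exprn_gt0// ltr0n.
have lnn : ln (N i)%:R <= ln n%:R :> R.
  by rewrite ler_ln ?posrE ?ltr0n ?ler_nat//; exact: leq_trans (N_gt0 i) Ni.
have lnn0 : 0 < ln n%:R :> R by exact: lt_le_trans lnn.
rewrite gtr0_norm ?invr_gt0// mulrC ltr_pdivrMr//.
have /H0 : (i0 <= i)%N by apply: leq_trans i1i; exact: leq_maxl.
rewrite sub0r normrN normrM (gtr0_norm (_ : 0 < (ln (N i)%:R)^-1)) ?invr_gt0//.
rewrite ltr_pdivrMr// => h1.
have h2 : `|S n w - S (N i) w| <= M * (l * (2 * i%:R + 3)).
  have -> : S n w - S (N i) w = \sum_(N i <= k < n) Z k w / k.+1%:R.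
    rewrite /S -!(big_mkord xpredT (fun k => Z k w / k.+1%:R)).
    by rewrite (big_cat_nat (leq0n _) Ni)/= addrAC subrr add0r.
  apply: (@le_trans _ _ (M * (harm n - harm (N i)))).
    rewrite /harm -!(big_mkord xpredT (fun k => k.+1%:R^-1)).
    rewrite (big_cat_nat (leq0n _) Ni)/= addrAC subrr add0r mulr_sumr.
    apply: (le_trans (ler_norm_sum _ _ _)); apply: ler_sum => k _.
    by rewrite normrM normfV (ger0_norm (ler0n _ _)) ler_wpM2r// ZM.
  rewrite ler_wpM2l//; apply: (le_trans (harm_block (N_gt0 i) Ni)).
  apply: (@le_trans _ _ (ln (N i.+1)%:R - ln (N i)%:R : R)).
    by rewrite lerD2r ler_ln ?posrE ?ltr0n ?ler_nat//; exact: leq_trans (N_gt0 i) Ni.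
  rewrite !lnN -!natr1 le_eqVlt; apply/orP; left; apply/eqP; ring.
have h3 : M * (l * (2 * i%:R + 3)) < e / 2 * ln n%:R.
  apply: (@lt_le_trans _ _ (e / 2 * ln (N i)%:R)); last by rewrite ler_pM2l.
  rewrite lnN; set x : R := i.+1%:R.
  have Me : 6 * M / e < x.
    apply: (lt_le_trans (truncnS_gt _)); rewrite ler_nat ltnS.
    by apply: leq_trans i1i; exact: leq_maxr.
  have x0 : 0 < x by rewrite ltr0n.
  have -> : 2 * i%:R + 3 = 2 * x + 1 by rewrite /x -natr1; ring.
  have x1 : 1 <= x by rewrite ler1n.
  apply: (@le_lt_trans _ _ (3 * M * x * l)).
    have : M * l * 1 <= M * l * x by rewrite ler_wpM2l// mulr_ge0// ltW.
    lra.
  rewrite mulrA ltr_pM2r// expr2 mulrA ltr_pM2r//.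
  by move: Me; rewrite ltr_pdivrMr//; lra.
have -> : S n w = S (N i) w + (S n w - S (N i) w) by rewrite addrC subrK.
apply: (le_lt_trans (ler_normD _ _)).
have h4 : e / 2 * ln (N i)%:R <= e / 2 * ln n%:R by rewrite ler_pM2l.
have : `|S (N i) w| + `|S n w - S (N i) w| < e / 2 * ln n%:R + e / 2 * ln n%:R.
  by apply: ltrD; [exact: lt_le_trans h1 h4|exact: le_lt_trans h2 h3].
by rewrite -mulrDl -splitr.
Qed.

End log_average_law_of_large_numbers.

(** * Decay of correlations between rescaled paths *)

Section covariance.
Context {R : realType} {d : measure_display} {T : measurableType d}.
Variables (P : probability T R) (V : R -> T -> R) (sigma : R).
Hypothesis lV : square_integrable_levy P V sigma.

(* The part of the path rescaled at time [t] that is independent of the process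
   up to time [s]. *)
Definition future_path (s t : R) (w : T) (x : R) : R :=
  (Num.sqrt t)^-1 * increment V s (Num.max (t * x) s) w.

Lemma levy_future_path (s t : R) w x :
  levy_path V t w x - future_path s t w x =
  (Num.sqrt t)^-1 * increment V 0 (Num.min (t * x) s) w.
Proof.
rewrite /levy_path /future_path /increment -mulrBr.
by case: (leP (t * x) s) => h; congr (_ * _); ring.
Qed.

Lemma measurable_future_path s t x : 0 <= s ->
  measurable_fun setT (fun w => future_path s t w x).
Proof.
move=> s0; apply: measurable_funM => //.
by apply: (measurable_increment lV) => //; rewrite le_max s0 orbT.
Qed.

(** The two paths differ by V run up to time [s] at most, so [levy_maximal] on [0,s] applies; where
    its condition fails, the right-hand side is at least 1. The factor [1 + s^-1] stems from the
    summand 1 in [moment2_increment_le]. *)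
Let past_gap (p : nat) (s t : R) : 0 < s -> s <= t ->
  fine (P [set w | exists2 k, (k <= 2 ^ p)%N & (s / t) `^ 3^-1 <
    `|levy_path V t w (dyadic R p k) - future_path s t w (dyadic R p k)|]) <=
  8 * (sigma ^+ 2 * (1 + s^-1)) * (s / t) `^ 3^-1.
Proof.
move=> s0 st; have t0 : 0 < t by lra.
set r := _ `^ _; have r0 : 0 < r by rewrite powR_gt0// divr_gt0.
have r3 : r ^+ 3 = s / t.
  by rewrite -powR_mulrn ?(ltW r0)// /r -powRrM mulVf// powRr1// divr_ge0// ltW.
(* [r ^ 2 * t = s / r], so the maximal inequality gives a multiple of [r]. *)
have st0 : 0 < Num.sqrt t by rewrite sqrtr_gt0.
pose u k := Num.min (t * dyadic R p k) s.
pose lam := r * Num.sqrt t / 2.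
have lam0 : 0 < lam by rewrite divr_gt0// mulr_gt0.
have lamE : 2 * lam = r * Num.sqrt t by rewrite /lam mulrC divfK.
have u00 : u 0%N = 0 by rewrite /u /dyadic mul0r mulr0 min_l// ltW.
have dyS k : dyadic R p k <= dyadic R p k.+1.
  by rewrite ler_wpM2r ?invr_ge0 ?exprn_ge0// ler_nat leqnSn.
have uS k : (k < 2 ^ p)%N -> u k <= u k.+1.
  by move=> _; rewrite /u le_min !ge_min lexx orbT andbT ler_pM2l// dyS.
have un : u (2 ^ p)%N = s.
  by rewrite /u /dyadic natrX divff ?expf_neq0// mulr1 min_r.
have lam2 : lam ^+ 2 = s / (4 * r).
  have -> : lam ^+ 2 = r ^+ 3 * (Num.sqrt t) ^+ 2 / (4 * r).
    by rewrite /lam; field; rewrite gt_eqF.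
  by rewrite r3 sqr_sqrtr ?ltW// divfK// gt_eqF.
have mD : measurable [set w | exists2 k, (k <= 2 ^ p)%N & r <
    `|levy_path V t w (dyadic R p k) - future_path s t w (dyadic R p k)|].
  apply: (measurable_exceeds (F := fun k w => levy_path V t w (dyadic R p k) -
    future_path s t w (dyadic R p k))) => k _.
  apply: measurable_funB; last by apply: measurable_future_path; exact: ltW.
  by apply: (measurable_levy_path lV); [exact: ltW|exact: dyadic_ge0].
have [|small] := leP (2 * (sigma ^+ 2 * (s + 1))) (lam ^+ 2); last first.
  apply: (@le_trans _ _ 1).
    by rewrite -lee_fin fineK ?fin_num_measure// probability_le1.
  move: small; rewrite lam2 ltr_pdivrMr ?mulr_gt0// => /ltW hs.
  rewrite -(ler_pM2r s0) mul1r; apply: (le_trans hs).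
  by rewrite le_eqVlt; apply/orP; left; apply/eqP; field; rewrite gt_eqF.
rewrite -[s + 1]/(s + 1) -{1}[s]subr0 -{1}u00 -{1}un => hl.
have := levy_maximal lV lam0 (eq_ind_r (fun x => 0 <= x) (lexx 0) u00) uS hl.
rewrite u00 un => /le_trans => /(_ (2%:E * (sigma ^+ 2 * (s - 0 + 1) / lam ^+ 2)%:E)%E).
move=> /(_ (lee_wpmul2l _ (chebyshev_increment lV (lexx 0) (ltW s0) lam0))).
rewrite lee_fin => /(_ (ler0n _ _)) h.
rewrite -lee_fin fineK ?fin_num_measure//.
rewrite (_ : [set w | _] = [set w | exists2 k, (k <= 2 ^ p)%N &
    2 * lam < `|increment V 0 (u k) w|]).
  apply: (le_trans h); rewrite -EFinM lee_fin lam2.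
  by rewrite le_eqVlt; apply/orP; left; apply/eqP; field; rewrite !gt_eqF.
by apply/seteqP; split => w [k kp hk]; exists k => //; move: hk;
  rewrite levy_future_path normrM gtr0_norm ?invr_gt0// (mulrC (Num.sqrt t)^-1)
    ltr_pdivlMr// lamE.
Qed.

Let mG S p s t : 0 <= s ->
  measurable_fun setT (fun w => cones_fun S p (future_path s t w)).
Proof.
move=> s0; apply: (@measurable_cones_fun _ _ _ S p (fun x w => future_path s t w x)) => i ip.
exact: measurable_future_path.
Qed.

(** One grid of [n + n] increments serves both factors: its first half runs through the grid of
    [0,s], its second half through the times [Num.max (t * x) s]. The halves meet at [u n = s], and
    each functional depends on one half only. *)
Let past_future_independent S p s t : 0 < s -> s <= t ->
  \int[P]_w (cones_fun S p (levy_path V s w) * cones_fun S p (future_path s t w)) =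
  \int[P]_w cones_fun S p (levy_path V s w) *
  \int[P]_w cones_fun S p (future_path s t w).
Proof.
move=> s0 st; have t0 : 0 < t by lra.
pose n := (2 ^ p)%N.
pose u k := if (k <= n)%N then s * dyadic R p k
            else Num.max (t * dyadic R p (k - n)) s.
have dyS k : dyadic R p k <= dyadic R p k.+1.
  by rewrite ler_wpM2r ?invr_ge0 ?exprn_ge0// ler_nat leqnSn.
have dyn : dyadic R p n = 1 by rewrite /n /dyadic natrX divff ?expf_neq0.
have u00 : u 0%N = 0 by rewrite /u /= /dyadic mul0r mulr0.
have uP k : (k <= n)%N -> u k = s * dyadic R p k by rewrite /u => ->.
have uF k : u (n + k)%N = Num.max (t * dyadic R p k) s.
  case: k => [|k]; last by rewrite /u leqNgt -addSnnS leq_addr/= addSnnS addKn.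
  by rewrite addn0 uP// dyn mulr1 {1}/dyadic mul0r mulr0 max_r// ltW.
have uS k : (k < n + n)%N -> u k <= u k.+1.
  move=> _; have [kn|nk] := ltnP k n.
    rewrite (uP _ (ltnW kn)) (uP _ kn) ler_pM2l//; exact: dyS.
  rewrite -(subnKC nk) -addnS !uF ge_max !le_max lexx orbT andbT.
  by rewrite ler_pM2l// dyS.
pose xi (i : 'I_(n + n)) := increment V (u i) (u i.+1).
have ug := @grid_ge0 _ (n + n) u (eq_ind_r (fun x => 0 <= x) (lexx 0) u00) uS.
have mxi i : measurable_fun setT (xi i).
  by apply: (measurable_increment lV); apply: ug => //; exact: ltnW.
have ind : mutually_independent P xi.
  by apply: (levy_grid_independent lV) => //; rewrite u00.
pose D (i : 'I_(n + n)) := (i < n)%N; pose D' (i : 'I_(n + n)) := (n <= i)%N.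
have mf : measurable_fun [set: g_sigma_algebraType (cylinders xi D)]
    (fun w => cones_fun S p (levy_path V s w)).
  apply: (@measurable_cones_fun R _ (g_sigma_algebraType (cylinders xi D)) S p
    (fun x w => levy_path V s w x)) => k kp.
  rewrite (_ : (fun w => _) = fun w => (Num.sqrt s)^-1 *
      \sum_(l < n + n) if (l < k)%N then xi l w else 0).
    apply: measurable_funM => //; apply: measurable_sum => l.
    case: (ltnP l k) => lk //; apply: measurable_fun_cylinders.
    exact: leq_trans lk kp.
  apply/funext => w; rewrite -big_mkcond/= (sum_increment V u w (leq_trans kp (leq_addr _ _))).
  by rewrite u00 uP.
have mg : measurable_fun [set: g_sigma_algebraType (cylinders xi D')]
    (fun w => cones_fun S p (future_path s t w)).
  apply: (@measurable_cones_fun R _ (g_sigma_algebraType (cylinders xi D')) S p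
    (fun x w => future_path s t w x)) => k kp.
  rewrite (_ : (fun w => _) = fun w => (Num.sqrt t)^-1 *
      \sum_(l < n + n) if (n <= l < n + k)%N then xi l w else 0).
    apply: measurable_funM => //; apply: measurable_sum => l.
    case: (boolP (n <= l < n + k)%N) => // /andP[nl _].
    exact: measurable_fun_cylinders.
  apply/funext => w; rewrite /future_path; congr (_ * _).
  have -> : increment V s (Num.max (t * dyadic R p k) s) w =
      increment V (u 0%N) (u (n + k)%N) w - increment V (u 0%N) (u n) w.
    by rewrite uF (uP n)// dyn mulr1 /increment; ring.
  rewrite -!(sum_increment (n := n + n) V u) ?leq_add2l ?leq_addr//.
  rewrite !(big_mkcond (fun l : 'I_(n + n) => (l < _)%N))/= -sumrB.
  apply: eq_bigr => l _; have [ln|nl] := ltnP l n.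
    by rewrite (leq_trans ln (leq_addr _ _)) subrr.
  by rewrite subr0.
apply: independent_Rintegral_mul => //.
- by split; [apply: (measurable_levy_cones lV); exact: ltW|exists (cones_bound S) => w; exact: cones_fun_norm_le].
- by split; [apply: mG; exact: ltW|exists (cones_bound S) => w; exact: cones_fun_norm_le].
- apply: (cylinders_independent_fun mxi ind _ mf mg) => i.
  by rewrite /D /D' => h; rewrite leqNgt h.
Qed.

(** The later path is replaced by its independent part once in the mean of the product and once in
    the product of the means, whence the factor 2. Each time the error is at most [L * r] off the
    event of a large gap and [M] on it. *)
Lemma cones_covariance S p s t : 0 < s -> s <= t ->
  `|\int[P]_w (cones_fun S p (levy_path V s w) * cones_fun S p (levy_path V t w)) -
    \int[P]_w cones_fun S p (levy_path V s w) *
    \int[P]_w cones_fun S p (levy_path V t w)| <=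
  2 * cones_bound S * (cones_lip S + cones_bound S *
    (8 * (sigma ^+ 2 * (1 + s^-1)))) * (s / t) `^ 3^-1.
Proof.
move=> s0 st; have t0 : 0 < t by lra.
set r := _ `^ _; have r0 : 0 <= r by exact: powR_ge0.
pose M : R := cones_bound S; pose L : R := cones_lip S.
have M0 : 0 <= M := cones_bound_ge0 S; have L0 : 0 <= L := cones_lip_ge0 S.
set f := fun w => cones_fun S p (levy_path V s w).
set g := fun w => cones_fun S p (levy_path V t w).
pose h w := cones_fun S p (future_path s t w).
pose A := [set w | exists2 k, (k <= 2 ^ p)%N & r <
  `|levy_path V t w (dyadic R p k) - future_path s t w (dyadic R p k)|].
have mf : measurable_fun setT f by apply: (measurable_levy_cones lV); exact: ltW.
have mg : measurable_fun setT g by apply: (measurable_levy_cones lV); exact: ltW.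
have mh : measurable_fun setT h by apply: mG; exact: ltW.
have fM w : `|f w| <= M by exact: cones_fun_norm_le.
have gM w : `|g w| <= M by exact: cones_fun_norm_le.
have hM w : `|h w| <= M by exact: cones_fun_norm_le.
have mA : measurable A.
  apply: (measurable_exceeds (F := fun k w => levy_path V t w (dyadic R p k) -
    future_path s t w (dyadic R p k))) => k _.
  apply: measurable_funB; last by apply: measurable_future_path; exact: ltW.
  by apply: (measurable_levy_path lV); [exact: ltW|exact: dyadic_ge0].
have gh w : `|g w - h w| <= L * r + M * \1_A w.
  rewrite indicE; case: (boolP (w \in A)) => wA.
    rewrite mulr1; apply: (@le_trans _ _ M); last by rewrite lerDr mulr_ge0.
    rewrite ler_norml; have := cones_fun_ge0 S p (levy_path V t w).
    have := cones_fun_ge0 S p (future_path s t w).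
    have := cones_fun_le S p (levy_path V t w).
    have := cones_fun_le S p (future_path s t w).
    by rewrite -/(g w) -/(h w) -/M; lra.
  rewrite mulr0 addr0; apply: cones_fun_lipschitz => i ip.
  rewrite leNgt; apply/negP => hi; move/negP: wA; apply.
  by rewrite inE; exists i.
have iA : P.-integrable setT (EFin \o (\1_A : T -> R)) by exact: integrable_indic.
have iMA : P.-integrable setT (EFin \o (fun w => M * \1_A w)).
  by have := integrableZl measurableT M iA.
have iL : P.-integrable setT (EFin \o cst (L * r)).
  exact: finite_measure_integrable_cst.
have iR : P.-integrable setT (EFin \o (fun w => L * r + M * \1_A w)).
  by have := integrableD measurableT iL iMA.
have iMR : P.-integrable setT (EFin \o (fun w => M * (L * r + M * \1_A w))).
  by have := integrableZl measurableT M iR.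
have ER : \int[P]_w (L * r + M * \1_A w) <= (L + M * (8 * (sigma ^+ 2 * (1 + s^-1)))) * r.
  rewrite (RintegralD measurableT iL iMA) Rintegral_prob_cst RintegralZl//.
  have -> : \int[P]_w \1_A w = fine (P A).
    by rewrite /Rintegral integral_indic// setIT.
  by rewrite mulrDl lerD2l -mulrA ler_wpM2l//; exact: past_gap.
have i1 (a b : T -> R) : measurable_fun setT a -> measurable_fun setT b ->
    (forall w, `|a w| <= M) -> (forall w, `|b w| <= M) ->
    P.-integrable setT (EFin \o (fun w => a w * b w)).
  move=> ma mb aM bM; apply: (@bounded_meas_norm_le _ _ _ _ _ (M * M)).
    exact: measurable_funM.
  by move=> w; rewrite normrM ler_pM.
have i2 (a : T -> R) : measurable_fun setT a -> (forall w, `|a w| <= M) ->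
    P.-integrable setT (EFin \o a).
  exact: bounded_meas_norm_le.
have h1 : `|\int[P]_w (f w * g w) - \int[P]_w (f w * h w)| <=
    \int[P]_w (M * (L * r + M * \1_A w)).
  apply: Rintegral_dist_le; [exact: i1|exact: i1|by []|move=> w].
  by rewrite -mulrBr normrM ler_pM.
have h2 : `|\int[P]_w h w - \int[P]_w g w| <= \int[P]_w (L * r + M * \1_A w).
  by apply: Rintegral_dist_le => [|||w]; [exact: i2|exact: i2| |rewrite distrC].
have E : \int[P]_w (f w * h w) = \int[P]_w f w * \int[P]_w h w.
  exact: past_future_independent.
have Ef : `|\int[P]_w f w| <= M by exact: Rintegral_norm_le.
rewrite RintegralZl// in h1.
have -> : \int[P]_w (f w * g w) - \int[P]_w f w * \int[P]_w g w =
   (\int[P]_w (f w * g w) - \int[P]_w (f w * h w)) +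
   \int[P]_w f w * (\int[P]_w h w - \int[P]_w g w) by rewrite E; ring.
apply: (le_trans (ler_normD _ _)); rewrite normrM.
have h3 : `|\int[P]_w f w| * `|\int[P]_w h w - \int[P]_w g w| <=
  M * \int[P]_w (L * r + M * \1_A w) by rewrite ler_pM.
apply: (le_trans (lerD h1 h3)); rewrite -/M -/L.
have := ler_wpM2l M0 ER; move: (\int[P]__ _) (L + _) => I A' h4; lra.
Qed.

End covariance.

Section cones_limits.
Context {R : realType}.
Implicit Types (S : seq cone) (x : R -> R).

(** The cones taken with the supremum over all dyadic points, which is the uniform distance on [0,1]
    when the path is càdlàg, the step functions being right-continuous. *)
Definition cones_lim S x : R := limn (fun p => cones_fun S p x).

Let noninc S x : nonincreasing_seq (fun p => cones_fun S p x).
Proof. by move=> p q pq; exact: cones_fun_nonincreasing. Qed.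

Let is_cvg_cones S x : cvgn (fun p => cones_fun S p x).
Proof.
apply: nonincreasing_is_cvgn; first exact: noninc.
by exists 0 => _ [p _ <-]; exact: cones_fun_ge0.
Qed.

Lemma cones_fun_cvg S x : cones_fun S p x @[p --> \oo] --> cones_lim S x.
Proof. exact: is_cvg_cones. Qed.

Lemma cones_lim_le_fun S p x : cones_lim S x <= cones_fun S p x.
Proof. exact: (nonincreasing_cvgn_ge (@noninc S x) (@is_cvg_cones S x)). Qed.

Lemma cones_lim_ge S x (c : R) : (forall p, c <= cones_fun S p x) ->
  c <= cones_lim S x.
Proof. by move=> h; apply: limr_ge => //; exact: nearW. Qed.

Lemma cones_lim_ge0 S x : 0 <= cones_lim S x.
Proof. by apply: cones_lim_ge => p; exact: cones_fun_ge0. Qed.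

Lemma cones_lim_norm_le S x : `|cones_lim S x| <= cones_bound S.
Proof.
rewrite ger0_norm ?cones_lim_ge0//.
by apply: (le_trans (cones_lim_le_fun S 0 x)); exact: cones_fun_le.
Qed.

Context {d : measure_display} {T : measurableType d}.
Variable P : probability T R.

Lemma measurable_cones_lim S (X : T -> R -> R) :
  (forall p, measurable_fun setT (fun w => cones_fun S p (X w))) ->
  measurable_fun setT (fun w => cones_lim S (X w)).
Proof.
move=> mX; apply: (@measurable_fun_cvg _ _ _ setT (fun p w => cones_fun S p (X w))).
  exact: mX.
by move=> w _; exact: cones_fun_cvg.
Qed.

Lemma Rintegral_cones_lim S (X : T -> R -> R) :
  (forall p, measurable_fun setT (fun w => cones_fun S p (X w))) ->
  \int[P]_w cones_fun S p (X w) @[p --> \oo] --> \int[P]_w cones_lim S (X w).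
Proof.
move=> mX; apply: (@Rintegral_dominated_cvg _ _ _ P _ _ (cst (cones_bound S))) => //.
- exact: measurable_cones_lim.
- exact: finite_measure_integrable_cst.
- by move=> p w; exact: cones_fun_norm_le.
Qed.

End cones_limits.

Section cones_log_average.
Context {R : realType} {d d' : measure_display}.
Context {T : measurableType d} {T' : measurableType d'}.
Variables (P : probability T R) (V : R -> T -> R) (sigma : R).
Variables (P' : probability T' R) (B : R -> T' -> R).
Hypothesis lV : square_integrable_levy P V sigma.
Hypothesis bB : brownian P' B.

Let mF S t p : 0 <= t ->
  measurable_fun setT (fun w => cones_fun S p (levy_path V t w)).
Proof. by move=> t0; exact: (measurable_levy_cones lV). Qed.

Let mL S t : 0 <= t ->
  measurable_fun setT (fun w => cones_lim S (levy_path V t w)).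
Proof. by move=> t0; apply: measurable_cones_lim => p; exact: mF. Qed.

(** The threshold of [cones_liminf] is uniform in [p], so [p] may go to infinity with [t] fixed; on
    the Brownian side passing to the limit only lowers the value. *)
Lemma cones_lim_liminf S (e : R) : 0 < e -> exists A, forall t, A <= t ->
  \int[P']_w cones_lim S (brownian_path sigma B w) - e <=
  \int[P]_w cones_lim S (levy_path V t w).
Proof.
move=> e0; have [m Hm] := cones_liminf lV bB S e0.
have [A HA] := Hm m (leqnn m).
have mB p : measurable_fun setT (fun w => cones_fun S p (brownian_path sigma B w)).
  exact: (measurable_brownian_cones sigma bB).
exists (Num.max A 0) => t; rewrite ge_max => /andP[At t0].
have cE := @Rintegral_cones_lim _ _ _ P S (levy_path V t) (fun p => mF S p t0).
apply: (cvgr_to_ge cE).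
exists m => // p /= mp; apply: le_trans (HA t At p mp); rewrite lerD2r.
apply: le_Rintegral => //.
- apply: (@bounded_meas_norm_le _ _ _ _ _ (cones_bound S)).
    exact: measurable_cones_lim.
  by move=> w; exact: cones_lim_norm_le.
- apply: (@bounded_meas_norm_le _ _ _ _ _ (cones_bound S)) => // w.
  exact: cones_fun_norm_le.
- by move=> w _; exact: cones_lim_le_fun.
Qed.

Lemma cones_lim_covariance S s t : 0 < s -> s <= t ->
  `|\int[P]_w (cones_lim S (levy_path V s w) * cones_lim S (levy_path V t w)) -
    \int[P]_w cones_lim S (levy_path V s w) *
    \int[P]_w cones_lim S (levy_path V t w)| <=
  2 * cones_bound S * (cones_lip S + cones_bound S *
    (8 * (sigma ^+ 2 * (1 + s^-1)))) * (s / t) `^ 3^-1.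
Proof.
move=> s0 st; have t0 : 0 <= t by lra. have s0' := ltW s0.
set c := (X in _ <= X); set l := (X in X <= _).
suff cE : `|\int[P]_w (cones_fun S p (levy_path V s w) *
    cones_fun S p (levy_path V t w)) -
    \int[P]_w cones_fun S p (levy_path V s w) *
    \int[P]_w cones_fun S p (levy_path V t w)| @[p --> \oo] --> l.
  by apply: (cvgr_to_le cE); apply: nearW => p; exact: (cones_covariance lV).
rewrite /l; apply: cvg_norm; apply: cvgB; last first.
  by apply: cvgM; apply: Rintegral_cones_lim => p; exact: mF.
apply: (@Rintegral_dominated_cvg _ _ _ P _ _ (cst (cones_bound S * cones_bound S))).
- by move=> p; apply: measurable_funM; exact: mF.
- by apply: measurable_funM; exact: mL.
- exact: finite_measure_integrable_cst.
- by move=> w; apply: cvgM; exact: cones_fun_cvg.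
- by move=> p w; rewrite normrM ler_pM// cones_fun_norm_le.
Qed.

Variables (s : nat -> R) (beta : R).
Hypothesis s_gt0 : forall n, (1 <= n)%N -> 0 < s n.
Hypothesis beta_gt0 : 0 < beta.
Hypothesis s_increasing : forall m n, (1 <= m)%N -> (m <= n)%N ->
  s m / (m%:R `^ beta) <= s n / (n%:R `^ beta).

Let s_ratio m n : (1 <= m)%N -> (m <= n)%N ->
  s m / s n <= m%:R `^ beta / n%:R `^ beta.
Proof.
move=> m1 mn; have n1 := leq_trans m1 mn.
have := s_increasing m1 mn.
have b k : (1 <= k)%N -> 0 < k%:R `^ beta :> R by move=> k1; rewrite powR_gt0// ltr0n.
rewrite ler_pdivrMr ?b// => h; rewrite ler_pdivrMr ?s_gt0//.
by rewrite mulrAC -mulrA mulrC.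
Qed.

Let s_le m n : (1 <= m)%N -> (m <= n)%N -> s m <= s n.
Proof.
move=> m1 mn; have n1 := leq_trans m1 mn.
have := s_ratio m1 mn; rewrite ler_pdivrMr ?s_gt0// => /le_trans; apply.
rewrite -[leRHS]mul1r ler_wpM2r ?(ltW (s_gt0 n1))// ler_pdivrMr ?powR_gt0 ?ltr0n//.
by rewrite mul1r ge0_ler_powR ?nnegrE ?ler_nat// ltW.
Qed.

Let s_unbounded (A : R) : exists k0, forall k, (k0 <= k)%N -> A <= s k.+1.
Proof.
have s1 : 0 < s 1%N by exact: s_gt0.
pose k0 := Num.truncn ((`|A| / s 1%N) `^ beta^-1).
exists k0 => k k0k.
have := s_increasing (leqnn 1) (ltn0Sn k); rewrite powR1 divr1.
rewrite ler_pdivlMr ?powR_gt0 ?ltr0n//; apply: le_trans.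
apply: (le_trans (ler_norm A)).
rewrite mulrC -ler_pdivrMr//.
have q0 : 0 <= `|A| / s 1%N by rewrite divr_ge0// ltW.
have -> : `|A| / s 1%N = ((`|A| / s 1%N) `^ beta^-1) `^ beta.
  by rewrite -powRrM mulVf ?gt_eqF// powRr1.
apply: ge0_ler_powR; rewrite ?nnegrE ?powR_ge0 ?(ltW beta_gt0)//.
apply: (le_trans (ltW (truncnS_gt _))); rewrite ler_nat ltnS; exact: k0k.
Qed.

Let centered_log_average S : {ae P, forall w,
  (ln n%:R)^-1 * \sum_(k < n) (cones_lim S (levy_path V (s k.+1) w) -
    \int[P]_w cones_lim S (levy_path V (s k.+1) w)) / k.+1%:R @[n --> \oo] --> 0}.
Proof.
pose M : R := cones_bound S; have M0 : 0 <= M := cones_bound_ge0 S.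
(* The covariance decays like ((j+1)/(k+1))^(beta/3); the exponent is capped at 1 to fit
   [sum_powR_le], which only weakens the bound as the ratio is at most 1. *)
pose g := Num.min (beta / 3) 1.
have g0 : 0 < g by rewrite lt_min ltr01 divr_gt0.
have g1 : g <= 1 by rewrite ge_min lexx orbT.
pose F k w := cones_lim S (levy_path V (s k.+1) w).
have s0 k : 0 < s k.+1 by exact: s_gt0.
have mFk k : measurable_fun setT (F k) by apply: mL; exact: ltW.
have FM k w : `|F k w| <= M by exact: cones_lim_norm_le.
have EM k : `|\int[P]_w F k w| <= M by exact: Rintegral_norm_le.
have iF k : P.-integrable setT (EFin \o F k).
  exact: (bounded_meas_norm_le P (mFk k) (FM k)).
(* The sequence [s] is nondecreasing from index 1 on, so the inverse of its first value bounds the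
   inverses of all the others. *)
pose K := 2 * M * (cones_lip S + M * (8 * (sigma ^+ 2 * (1 + (s 1%N)^-1)))).
apply: (@log_average_cvg0 _ _ _ P (fun k w => F k w - \int[P]_w F k w) (M + M) K g) => //.
- by move=> k; exact: measurable_funB.
- by move=> k w; apply: (le_trans (ler_normB _ _)); exact: lerD.
move=> j k jk; set Ej := \int[P]_w F j w; set Ek := \int[P]_w F k w.
have iFF : P.-integrable setT (EFin \o (fun w => F j w * F k w)).
  apply: (@bounded_meas_norm_le _ _ _ _ _ (M * M)); first exact: measurable_funM.
  by move=> w; rewrite normrM ler_pM.
have -> : \int[P]_w ((F j w - Ej) * (F k w - Ek)) =
    \int[P]_w (F j w * F k w) - Ej * Ek.
  have i1 : P.-integrable setT (EFin \o (fun w => Ej * F k w)).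
    by have := integrableZl measurableT Ej (iF k).
  have i2 : P.-integrable setT (EFin \o (fun w => Ek * F j w)).
    by have := integrableZl measurableT Ek (iF j).
  have i3 : P.-integrable setT (EFin \o cst (Ej * Ek)).
    exact: finite_measure_integrable_cst.
  have i12 : P.-integrable setT (EFin \o (fun w => Ej * F k w + Ek * F j w)).
    by have := integrableD measurableT i1 i2.
  have i4 : P.-integrable setT (EFin \o (fun w => F j w * F k w -
      (Ej * F k w + Ek * F j w))).
    by have := integrableB measurableT iFF i12.
  transitivity (\int[P]_w (F j w * F k w - (Ej * F k w + Ek * F j w) + Ej * Ek)).
    by apply: eq_Rintegral => w _; ring.
  rewrite (RintegralD measurableT i4 i3) (RintegralB measurableT iFF i12).
  rewrite (RintegralD measurableT i1 i2) Rintegral_prob_cst !RintegralZl//.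
  by rewrite -/Ej -/Ek; ring.
apply: (le_trans (ler_norm _)).
apply: (le_trans (cones_lim_covariance S (s0 j) (s_le (ltn0Sn j) (jk : (j.+1 <= k.+1)%N)))).
rewrite -/M; apply: ler_pM.
- apply: mulr_ge0; first exact: mulr_ge0.
  apply: addr_ge0; first exact: cones_lip_ge0.
  do 2! apply: mulr_ge0 => //.
  by rewrite mulr_ge0 ?sqr_ge0// addr_ge0// invr_ge0 ltW.
- exact: powR_ge0.
- rewrite ler_wpM2l ?mulr_ge0// lerD2l ler_wpM2l// ler_wpM2l//.
  rewrite ler_wpM2l ?sqr_ge0// lerD2l lef_pV2 ?posrE//; exact: s_le.
have j1 : 0 < j.+1%:R :> R by rewrite ltr0n.
have k1 : 0 < k.+1%:R :> R by rewrite ltr0n.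
have q0 : 0 < j.+1%:R / k.+1%:R :> R by rewrite divr_gt0.
have q1 : j.+1%:R / k.+1%:R <= 1 :> R.
  by rewrite ler_pdivrMr// mul1r ler_nat ltnS.
have divE (a : R) : j.+1%:R `^ a / k.+1%:R `^ a = (j.+1%:R / k.+1%:R) `^ a.
  rewrite -{1}[j.+1%:R](divfK (lt0r_neq0 k1)) powRM ?(ltW q0) ?(ltW k1)//.
  by rewrite mulfK// gt_eqF// powR_gt0.
apply: (@le_trans _ _ (((j.+1%:R / k.+1%:R) `^ beta) `^ 3^-1)).
  apply: ge0_ler_powR; rewrite ?nnegrE ?powR_ge0 ?divr_ge0 ?(ltW (s0 _))//.
  by rewrite -divE; exact: s_ratio.
by rewrite divE -powRrM ger_powR ?q0// /g ge_min lexx.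
Qed.

Let lower_log_average S : {ae P, forall w, forall e, 0 < e ->
  \forall n \near \oo,
    \int[P']_w' cones_lim S (brownian_path sigma B w') - e <=
    (ln n%:R)^-1 * \sum_(k < n) cones_lim S (levy_path V (s k.+1) w) / k.+1%:R}.
Proof.
apply: filterS (centered_log_average S) => w cw e e0.
set I := \int[P']_w' _; pose F k := cones_lim S (levy_path V (s k.+1) w).
pose E k := \int[P]_w cones_lim S (levy_path V (s k.+1) w).
have F0 k : 0 <= F k by exact: cones_lim_ge0.
have E0 k : 0 <= E k by apply: Rintegral_ge0 => w' _; exact: cones_lim_ge0.
pose a := I - e / 2.
have [a0|a0] := leP a 0.
  apply: nearW => n; apply: (@le_trans _ _ 0); first by move: a0; rewrite /a; lra.
  rewrite mulr_ge0 ?inv_ln_nat_ge0//; apply: sumr_ge0 => k _.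
  by rewrite divr_ge0// cones_lim_ge0.
have e20 : 0 < e / 2 by rewrite divr_gt0.
have e40 : 0 < e / 4 by rewrite divr_gt0.
have [A HA] := cones_lim_liminf S e20.
have [k0 Hk0] := s_unbounded A.
have aE k : (k0 <= k)%N -> a <= E k by move=> /Hk0 /HA.
(* The first [k0] expectations are only known to be nonnegative; dropping them costs a constant,
   which division by ln n removes. A nonpositive [a] was settled separately because all averages are
   nonnegative. *)
have sumE n : a * harm n - a * harm k0 <= \sum_(k < n) E k / k.+1%:R.
  elim: n => [|n IH].
    by rewrite big_ord0 /harm big_ord0 mulr0 sub0r oppr_le0 mulr_ge0 ?harm_ge0// ltW.
  rewrite big_ord_recr/=; have [nk|kn] := ltnP n k0; last first.
    rewrite harmS mulrDr addrAC; apply: lerD => //.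
    by rewrite ler_wpM2r// aE.
  apply: (@le_trans _ _ 0).
    rewrite subr_le0 ler_pM2l// /harm -!(big_mkord xpredT (fun k => k.+1%:R^-1)).
    rewrite [leRHS](big_cat_nat (leq0n _) nk)/= lerDl.
    by apply: sumr_ge0 => k _; rewrite invr_ge0.
  by rewrite addr_ge0 ?divr_ge0//; apply: sumr_ge0 => k _; rewrite divr_ge0.
have [n0 _ Hn0] := (cvgrPdist_lt _ _).1 cw _ e40.
pose c := a * harm k0; have c0 : 0 <= c by rewrite mulr_ge0 ?harm_ge0// ltW.
(* Makes the lost constant [c] at most [e / 4 * ln n%:R]; the other quarter of [e] is the error of
   the centered averages. The [.+2] ensures [1 < n], so that ln n is positive. *)
pose n1 := (Num.truncn (expR (4 * c / e))).+2.
exists (maxn n0 n1) => // n /=; rewrite geq_max => /andP[n0n n1n].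
have {Hn0} := Hn0 n n0n; rewrite /= sub0r normrN ltr_norml => /andP[h _].
have nb : expR (4 * c / e) < n%:R.
  apply: (lt_le_trans (truncnS_gt _)); rewrite ler_nat.
  exact: leq_trans (leqnSn _) n1n.
have n2 : (1 < n)%N by exact: leq_trans n1n.
have ln0 : 0 < ln n%:R :> R by rewrite ln_gt0// ltr1n.
have cl : 4 * c / e <= ln n%:R.
  by rewrite -(expRK (4 * c / e)) ler_ln ?posrE ?expR_gt0 ?ltr0n ?(ltnW n2)// ltW.
rewrite [leRHS]mulrC ler_pdivlMr//.
have hE := sumE n.
have hh : a * ln n%:R <= a * harm n.
  rewrite ler_pM2l//; apply: le_trans (harm_ge n).
  by rewrite ler_ln ?posrE ?ltr0n ?ler_nat ?(ltnW n2).
have hc : c <= e / 4 * ln n%:R.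
  by move: cl; rewrite ler_pdivrMr//; lra.
move: h; rewrite [ltRHS]mulrC ltr_pdivlMr//.
have -> : \sum_(k < n) (F k - E k) / k.+1%:R =
    \sum_(k < n) F k / k.+1%:R - \sum_(k < n) E k / k.+1%:R.
  by rewrite -sumrB; apply: eq_bigr => k _; rewrite mulrBl.
move: hE hh hc; rewrite -/c /a.
move: (\sum_(k < n) F k / _) (\sum_(k < n) E k / _) (harm n) (ln _) => x y z l.
move=> h1 h2 h3 h4; lra.
Qed.

Lemma cones_lower_log_average : {ae P, forall w, forall S e, 0 < e ->
  \forall n \near \oo,
    \int[P']_w' cones_lim S (brownian_path sigma B w') - e <=
    (ln n%:R)^-1 * \sum_(k < n) cones_lim S (levy_path V (s k.+1) w) / k.+1%:R}.
Proof.
have h (i : nat) := lower_log_average (odflt [::] (unpickle i)).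
have := ae_foralln h; apply: filterS => w hw S.
by have := hw (pickle S); rewrite pickleK.
Qed.

End cones_log_average.

(** * The Skorohod space *)

Section uniform_continuity.
Context {R : realType}.

Lemma dyadic_modulus (x : R -> R) (e : R) : 0 < e ->
  {within `[0, 1], continuous x} ->
  exists p, forall s t, s \in `[0, 1] -> t \in `[0, 1] ->
    `|s - t| <= (2 ^+ p)^-1 -> `|x s - x t| <= e.
Proof.
move=> e0 cx; have := @segment_compact R 0 1.
move=> /compact_near_coveringP.
move=> /(_ nat \oo (fun p t => t \in `[0, 1] -> forall s, s \in `[0, 1] ->
  `|s - t| <= (2 ^+ p)^-1 -> `|x s - x t| <= e) _) [].
  move=> t tI; have e20 : 0 < e / 2 by rewrite divr_gt0.
  have := (subspace_continuousP _ _).1 cx t tI => /cvgrPdist_lt/(_ _ e20).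
  rewrite near_withinE => /nbhs_ballP[r /= r0 hr].
  have r20 : 0 < r / 2 by rewrite divr_gt0.
  near=> t' p => t'I s sI st'.
  have tt' : `|t - t'| < r / 2 by near: t'; exact: nbhsx_ballx.
  have pr : (2 ^+ p)^-1 <= r / 2.
    near: p; exists (Num.truncn (r / 2)^-1) => // p /= hp.
    rewrite invf_ple ?posrE ?exprn_gt0//.
    apply: (le_trans (ltW (truncnS_gt _))); rewrite -natrX ler_nat.
    by apply: (leq_trans (_ : _ <= p.+1)%N) => //; exact: ltn_expl.
  have h1 : `|x t - x t'| < e / 2.
    apply: hr => //; rewrite /ball/= ; apply: (lt_trans tt').
    by rewrite ltr_pdivrMr// ltr_pMr// ltr1n.
  have h2 : `|x t - x s| < e / 2.
    apply: hr => //; rewrite /ball/=.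
    apply: (le_lt_trans (ler_distD t' _ _)); rewrite [ltRHS]splitr.
    by apply: ltr_leD => //; rewrite distrC (le_trans st').
  rewrite (le_trans (ler_distD (x t) _ _))// (distrC (x s)) [leRHS]splitr.
  by rewrite lerD// ltW.
move=> p _ hp; exists p => s t sI tI st; exact: (hp p (leqnn p) t tI tI s sI st).
Unshelve. all: by end_near. Qed.

End uniform_continuity.

Section evaluation.
Context {R : realType}.
Implicit Types x y : skorohod R.

(** Evaluation at an interior time is not continuous in the J1-topology, but exceeding [c] somewhere
    in an open interval is an open condition: a small time change keeps the witness in the
    interval. *)
Let open_exceeds (t q c : R) : open [set x : skorohod R |
  exists s, [/\ s \in `[0, 1], t < s, s < q & c < x s]].
Proof.
rewrite openE => x [s [sI ts sq cx]].
pose e := Num.min (Num.min (s - t) (q - s)) (x s - c).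
have e0 : 0 < e by rewrite !lt_min !subr_gt0 ts sq.
have := @nbhsx_ballx R (skorohod R) x _ e0.
rewrite /interior; apply: (@filterS _ (nbhs (x : skorohod R))) => y.
move=> [lam [r [lamP re lamr xyr]]].
have [mu muP muK] := time_change_inv lamP.
have mI := time_change_mem muP sI.
exists (mu s); have := lamr _ mI; have := xyr _ mI; rewrite muK//.
move: re; rewrite !lt_min !ler_norml => /andP[/andP[r1 r2] r3] /andP[a1 a2] /andP[b1 b2].
by split => //; lra.
Qed.

Lemma skorohod_right_limit x t (e : R) : 0 <= t -> t < 1 -> 0 < e ->
  exists2 q, t < q & forall s, t < s -> s < q -> s \in `[0, 1] /\ `|x t - x s| < e.
Proof.
move=> t0 t1 e0; have tI : t \in `[0, 1] by rewrite in_itv/= t0 ltW.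
have [xr _] := @skorohod_cadlag R x t tI.
have [r /= r0 hr] : \forall y \near t, t < y -> y \in `[0, 1] -> `|x t - x y| < e.
  have : \forall y \near within `[0, 1] t^'+, `|x t - x y| < e.
    by move/cvgrPdist_lt : xr; exact.
  by rewrite near_withinE /at_right near_withinE.
exists (Num.min (t + r) 1); first by rewrite lt_min ltrDl r0.
move=> s ts; rewrite lt_min => /andP[sr s1].
have sI : s \in `[0, 1] by rewrite in_itv/= ltW/= ?ltW// (le_lt_trans t0).
split => //; apply: hr => //; rewrite /ball/= distrC gtr0_norm ?subr_gt0//.
by rewrite ltrBlDl.
Qed.

Lemma measurable_evaluation (t : R) : 0 <= t -> t <= 1 ->
  measurable_fun setT (fun x : borel (skorohod R) => (x : skorohod R) t).
Proof.
move=> t0; rewrite le_eqVlt => /predU1P[->|t1].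
  (* Time changes fix the endpoint 1, so evaluation there is continuous. *)
  apply: (measurability _ (RGenOInfty.measurableE R)).
  move=> _ [_ [c ->] <-]; rewrite setTI; apply: sub_sigma_algebra.
  rewrite /= openE => x; rewrite /= in_itv/= andbT => cx.
  have e0 : 0 < x 1 - c by rewrite subr_gt0.
  have := @nbhsx_ballx R (skorohod R) x _ e0.
  rewrite /interior; apply: (@filterS _ (nbhs (x : skorohod R))) => y.
  move=> [lam [r [lamP re lamr xyr]]].
  have I1 : 1 \in `[0, 1 : R] by rewrite in_itv/= ler01 lexx.
  have := xyr _ I1; rewrite (time_change_ends lamP).2 /= in_itv/= andbT.
  by rewrite ler_norml => /andP[a1 a2]; lra.
apply: (measurability _ (RGenCInfty.measurableE R)).
move=> _ [_ [c ->] <-]; rewrite setTI.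
(* By right continuity, [c <= x t] holds iff [x] exceeds each [c - 1 / (k + 1)]
   somewhere on each [(t, t + 1 / (n + 1))]; these conditions are open. *)
pose U n k := [set x : skorohod R | exists s,
  [/\ s \in `[0, 1], t < s, s < t + n.+1%:R^-1 & c - k.+1%:R^-1 < x s]].
rewrite (_ : _ @^-1` _ = \bigcap_n \bigcap_k U n k).
  apply: bigcapT_measurable => n; apply: bigcapT_measurable => k.
  by apply: sub_sigma_algebra; exact: open_exceeds.
have inv0 (r : R) : 0 < r -> exists n : nat, n.+1%:R^-1 < r.
  move=> r0; exists (Num.truncn r^-1).
  by rewrite invf_plt ?posrE//; exact: truncnS_gt.
apply/seteqP; split => x /=; rewrite in_itv/= andbT.
  move=> cx n _ k _; have k0 : 0 < k.+1%:R^-1 :> R by rewrite invr_gt0.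
  have [q tq hq] := skorohod_right_limit x t0 t1 k0.
  have n0 : t < t + n.+1%:R^-1 by rewrite ltrDl invr_gt0.
  pose s := (t + Num.min q (t + n.+1%:R^-1)) / 2.
  have tm : t < Num.min q (t + n.+1%:R^-1) by rewrite lt_min tq n0.
  have ts : t < s by rewrite /s; lra.
  have sm : s < Num.min q (t + n.+1%:R^-1) by rewrite /s; lra.
  move: sm; rewrite lt_min => /andP[sq sn].
  have [sI] := hq s ts sq; rewrite ltr_norml => /andP[_ h].
  exists s; split => //.
  by rewrite ltrBlDl addrC -ltrBlDl; apply: le_lt_trans h; rewrite lerD2r.
move=> h; rewrite leNgt; apply/negP => xc.
have e0 : 0 < (c - x t) / 2 by rewrite divr_gt0// subr_gt0.
have [q tq hq] := skorohod_right_limit x t0 t1 e0.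
have qt : 0 < q - t by rewrite subr_gt0.
have [n hn] := inv0 _ qt.
have [k hk] := inv0 _ e0.
have [s [sI ts sn cs]] := h n I k I.
have sq : s < q.
  by apply: (lt_trans sn); rewrite -ltrBrDl.
have [_] := hq s ts sq; rewrite ltr_norml => /andP[h1 h2].
move: cs hk h1 h2; move: (k.+1%:R^-1) => kk; lra.
Qed.

End evaluation.

(** * Cones below a continuous functional *)

Section cones_below.
Context {R : realType}.
Implicit Types (a : cone) (S : seq cone).

Lemma cones_lim_eq S (x y : R -> R) : {in `[0, 1], x =1 y} ->
  cones_lim S x = cones_lim S y.
Proof.
move=> xy; congr (limn _); apply/funext => p; apply: cones_fun_eq => i ip.
by apply: xy; rewrite in_itv/= dyadic_ge0 dyadic_le1.
Qed.

Lemma cones_fun1 a p (x : R -> R) : cones_fun [:: a] p x = cone_fun a p x.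
Proof. by rewrite /cones_fun big_cons big_nil max_l// cone_fun_ge0. Qed.

Lemma cones_lim_cons_le a S (x : R -> R) (c : R) :
  cones_lim [:: a] x <= c -> cones_lim S x <= c -> cones_lim (a :: S) x <= c.
Proof.
move=> ac Sc; rewrite leNgt; apply/negP => h.
have ha := cvgr_lt _ (@cones_fun_cvg R [:: a] x) _ (le_lt_trans ac h).
have hS := cvgr_lt _ (@cones_fun_cvg R S x) _ (le_lt_trans Sc h).
have [p [h1 h2]] := filter_ex (filterI (ha _) (hS _)).
have := cones_lim_le_fun (a :: S) p x.
rewrite /cones_fun big_cons -/(cones_fun S p x) le_max -cones_fun1.
by rewrite leNgt h1/= leNgt h2.
Qed.

Lemma cones_lim_nil (x : R -> R) : cones_lim [::] x = 0.
Proof.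
apply/eqP; rewrite eq_le cones_lim_ge0 andbT.
by apply: (le_trans (cones_lim_le_fun _ 0 x)); rewrite /cones_fun big_nil.
Qed.

Lemma cones_lim_mem a S (x : R -> R) : a \in S ->
  cones_lim [:: a] x <= cones_lim S x.
Proof.
move=> aS; apply: cones_lim_ge => p.
apply: (le_trans (cones_lim_le_fun _ p x)); rewrite cones_fun1.
elim: S aS => // b S IH; rewrite inE /cones_fun big_cons le_max.
by move=> /predU1P[->|/IH ->]; rewrite ?lexx ?orbT.
Qed.

(** By right continuity, the values at t < 1 are limits along dyadic points to the right of t; the
    point 1 is itself dyadic. *)
Lemma skorohod_dyadic_le (x y : skorohod R) (r : R) :
  (forall p i, (i <= 2 ^ p)%N -> `|x (dyadic R p i) - y (dyadic R p i)| <= r) ->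
  forall t, t \in `[0, 1] -> `|x t - y t| <= r.
Proof.
move=> h t; rewrite in_itv/= => /andP[t0]; rewrite le_eqVlt => /predU1P[->|t1].
  have -> : 1 = dyadic R 0 1 by rewrite /dyadic expr0 divr1.
  exact: h.
rewrite leNgt; apply/negP => rt.
have e0 : 0 < (`|x t - y t| - r) / 2 by rewrite divr_gt0// subr_gt0.
have [q1 tq1 h1] := skorohod_right_limit x t0 t1 e0.
have [q2 tq2 h2] := skorohod_right_limit y t0 t1 e0.
pose g := Num.min (q1 - t) (q2 - t).
have g0 : 0 < g by rewrite lt_min !subr_gt0 tq1.
pose p := Num.truncn g^-1.
have pg : (2 ^+ p)^-1 < g.
  rewrite invf_plt ?posrE ?exprn_gt0//; apply: (lt_le_trans (truncnS_gt _)).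
  by rewrite -natrX ler_nat; exact: ltn_expl.
pose i := (Num.truncn (2 ^+ p * t)).+1; pose s := dyadic R p i.
have p0 : 0 < 2 ^+ p :> R by rewrite exprn_gt0.
have ts : t < s by rewrite /s /dyadic ltr_pdivlMr// mulrC truncnS_gt.
have sg : s < t + g.
  have : s <= t + (2 ^+ p)^-1.
    rewrite /s /dyadic ler_pdivrMr// mulrDl mulVf ?gt_eqF// /i -natr1 lerD2r mulrC.
    by have /andP[] := truncn_itv (mulr_ge0 (ltW p0) t0); rewrite -(mulrC t).
  by move=> /le_lt_trans; apply; rewrite ltrD2l.
have [sq1 sq2] : s < q1 /\ s < q2.
  have : g <= q1 - t by rewrite /g ge_min lexx.
  have : g <= q2 - t by rewrite /g ge_min lexx orbT.
  by split; lra.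
have [sI hx] := h1 s ts sq1; have [_ hy] := h2 s ts sq2.
have ip : (i <= 2 ^ p)%N.
  move: sI; rewrite in_itv/= => /andP[_]; rewrite /s /dyadic ler_pdivrMr// mul1r.
  by rewrite -natrX ler_nat.
have := h p i ip; rewrite -/s.
have := ler_distD (x s) (x t) (y t).
have := ler_distD (y s) (x s) (y t).
rewrite (distrC (y s)); lra.
Qed.

(** The height lies between F x - 3e/4 and F x - e/2, and the step function is so close to x that
    the cone loses at most e/4 at x. The slope makes the cone vanish beyond distance rho/2 from the
    step function, so where it is positive the path is within 3 rho/4 of x uniformly. Taking the
    identity as time change, F there exceeds F x - e/2, which is above the height. *)
Lemma cone_approximation (F : skorohod R -> R) (x : skorohod R) (e : R) :
  0 < e -> continuous F -> (forall y, 0 <= F y) ->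
  {within `[0, 1], continuous x} ->
  exists a, (forall y, cones_lim [:: a] (y : skorohod R) <= F y) /\
    F x - e <= cones_lim [:: a] x.
Proof.
move=> e0 cF F0 cx; have [Fe|eF] := leP (F x) e.
  (* Height and slope 0 code the zero functional. *)
  exists (0%N, [::], 0%Q, 0%N); split => [y|]; last first.
    by apply: le_trans (cones_lim_ge0 _ _); rewrite subr_le0.
  apply: le_trans (F0 y); apply: (le_trans (cones_lim_le_fun _ 0 _)).
  by rewrite cones_fun1 /cone_fun /cone_height /cone_slope/= raddf0 mul0r subrr maxxx.
have e20 : 0 < e / 2 by rewrite divr_gt0.
have /(@nbhs_ballP R (skorohod R))[rho /= rho0 hrho] :
    \forall y \near (x : skorohod R), `|F x - F y| < e / 2.
  by have /cvgrPdist_lt := cF x; exact.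
have [q] := @rat_in_itvoo R (F x - 3 * e / 4) (F x - e / 2) ltac:(lra).
rewrite in_itv/= => /andP[q1 q2].
have q0 : 0 < ratr q :> R by lra.
pose L := (Num.truncn (2 * ratr q / rho)).+1.
have L0 : 0 < L%:R :> R by rewrite ltr0n.
have Lrho : ratr q <= L%:R * (rho / 2).
  have : 2 * ratr q / rho <= L%:R by rewrite ltW// truncnS_gt.
  rewrite ler_pdivrMr//; lra.
pose eta := Num.min (rho / 4) (e / (4 * L%:R)).
have eta0 : 0 < eta by rewrite lt_min !divr_gt0// mulr_gt0.
have eta1 : eta <= rho / 4 by rewrite ge_min lexx.
have eta2 : L%:R * eta <= e / 4.
  apply: (@le_trans _ _ (L%:R * (e / (4 * L%:R)))).
    by rewrite ler_pM2l// ge_min lexx orbT.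
  by rewrite le_eqVlt; apply/orP; left; apply/eqP; field; rewrite gt_eqF.
have eta20 : 0 < eta / 2 by rewrite divr_gt0.
have [p0 hp0] := dyadic_modulus eta20 cx.
have /choice[c hc] : forall i : nat, exists c : rat,
    `|x (dyadic R p0 i) - ratr c| <= eta / 2.
  move=> i; have [c] := @rat_in_itvoo R (x (dyadic R p0 i) - eta / 2)
    (x (dyadic R p0 i) + eta / 2) ltac:(lra).
  rewrite in_itv/= => /andP[c1 c2]; exists c.
  by rewrite ler_norml; apply/andP; split; lra.
pose a : cone := (p0, mkseq c (2 ^ p0).+1, q, L).
have P0 : 0 < 2 ^+ p0 :> R by rewrite exprn_gt0.
have stepE t : t \in `[0, 1] -> `|x t - cone_step a t| <= eta.
  move=> tI; have := tI; rewrite in_itv/= => /andP[t0 t1].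
  pose i := Num.truncn (2 ^+ p0 * t).
  have /andP[i1 i2] := truncn_itv (mulr_ge0 (ltW P0) t0).
  have ip : (i <= 2 ^ p0)%N.
    have : i%:R <= 2 ^+ p0 :> R by apply: (le_trans i1); rewrite ger_pMr.
    by rewrite -natrX ler_nat.
  have -> : cone_step a t = ratr (c i) by rewrite /cone_step/= nth_mkseq.
  have iI : dyadic R p0 i \in `[0, 1] by rewrite in_itv/= dyadic_ge0 dyadic_le1.
  have h1 : `|x t - x (dyadic R p0 i)| <= eta / 2.
    apply: hp0 => //; rewrite /dyadic ler_norml.
    have E1 : i%:R / 2 ^+ p0 <= t by rewrite ler_pdivrMr// mulrC.
    have E2 : t <= i%:R / 2 ^+ p0 + (2 ^+ p0)^-1.
      by rewrite -{2}[(2 ^+ p0)^-1]mul1r -mulrDl ler_pdivlMr// natr1 mulrC ltW.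
    have : 0 < (2 ^+ p0)^-1 :> R by rewrite invr_gt0.
    by move=> ?; apply/andP; split; lra.
  by rewrite (le_trans (ler_distD (x (dyadic R p0 i)) _ _))// [leRHS]splitr lerD.
have dI p i : (i <= 2 ^ p)%N -> dyadic R p i \in `[0, 1].
  by move=> ip; rewrite in_itv/= dyadic_ge0 dyadic_le1.
exists a; split => [y|]; last first.
  apply: cones_lim_ge => p; rewrite cones_fun1 /cone_fun le_max; apply/orP; right.
  have : grid_dist a p x <= eta.
    by apply: grid_dist_le => [|i ip]; [exact: ltW|exact: stepE (dI _ _ ip)].
  move=> /(ler_wpM2l (ltW L0)).
  by rewrite /cone_height /cone_slope /=; lra.
rewrite leNgt; apply/negP => Fy.
have yp p : F y < ratr q /\ grid_dist a p y < rho / 2.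
  have := lt_le_trans Fy (cones_lim_le_fun [:: a] p y).
  rewrite cones_fun1 /cone_fun lt_max ltNge F0/= /cone_height /cone_slope/= => h.
  have gd0 := grid_dist_ge0 a p y; split.
    by apply: (lt_le_trans h); rewrite gerBl mulr_ge0// ltW.
  rewrite -(ltr_pM2l L0); apply: lt_le_trans Lrho.
  by have := F0 y; lra.
have xy t : t \in `[0, 1] -> `|x t - y t| <= 3 * rho / 4.
  apply: skorohod_dyadic_le => p i ip.
  have [_ gd] := yp p; have := grid_dist_ge a y ip.
  have := stepE _ (dI _ _ ip).
  have := ler_distD (cone_step a (dyadic R p i)) (x (dyadic R p i)) (y (dyadic R p i)).
  rewrite (distrC (cone_step _ _)); lra.
have : J1_ball x rho y.
  exists id, (3 * rho / 4); split => //; first exact: time_change_id.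
    by lra.
  by move=> t _; rewrite subrr normr0; lra.
move=> /hrho; rewrite ltr_norml => /andP[h1 h2].
have [h3 _] := yp 0%N; lra.
Qed.

End cones_below.

Section continuous_functionals.
Context {R : realType}.

Lemma measurable_continuous_functional (F : skorohod R -> R) : continuous F ->
  measurable_fun setT (F : borel (skorohod R) -> R).
Proof.
move=> cF; apply: (measurability _ (RGenOInfty.measurableE R)).
move=> _ [_ [c ->] <-]; rewrite setTI; apply: sub_sigma_algebra.
by apply: open_comp => // x _; exact: cF.
Qed.

Let cvg_scale_right (t x : R) : 0 < t ->
  (fun y => t * y) @ within `[0, 1] x^'+ --> within `[0, +oo[ (t * x)^'+.
Proof.
move=> t0 U /nbhs_ballP[r /= r0 hr]; apply/nbhs_ballP.
exists (r / t); rewrite /= ?divr_gt0// => y /= xy xly yI.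
apply: hr; rewrite /ball/= in xy *.
- by rewrite -mulrBr normrM gtr0_norm// mulrC -ltr_pdivlMr.
- by rewrite ltr_pM2l.
- move: yI; rewrite /= !in_itv/= andbT => /andP[y0 _].
  by rewrite mulr_ge0// ltW.
Qed.

Let cvg_scale_left (t x : R) : 0 < t ->
  (fun y => t * y) @ within `[0, 1] x^'- --> within `[0, +oo[ (t * x)^'-.
Proof.
move=> t0 U /nbhs_ballP[r /= r0 hr]; apply/nbhs_ballP.
exists (r / t); rewrite /= ?divr_gt0// => y /= xy xly yI.
apply: hr; rewrite /ball/= in xy *.
- by rewrite -mulrBr normrM gtr0_norm// mulrC -ltr_pdivlMr.
- by rewrite ltr_pM2l.
- move: yI; rewrite /= !in_itv/= andbT => /andP[y0 _].
  by rewrite mulr_ge0// ltW.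
Qed.

Lemma cadlag_rescale (f : R -> R) (t : R) : 0 < t ->
  cadlag `[0, +oo[%classic f ->
  cadlag `[0, 1]%classic (fun x => (Num.sqrt t)^-1 * f (t * x)).
Proof.
move=> t0 cf; apply: cadlagMl => x; rewrite /= in_itv/= => /andP[x0 _].
have txI : `[0, +oo[%classic (t * x) by rewrite /= in_itv/= andbT mulr_ge0// ltW.
have [fr [l fl]] := cf _ txI; split.
  exact: cvg_comp (cvg_scale_right t0) fr.
by exists l; exact: cvg_comp (cvg_scale_left t0) fl.
Qed.

Lemma rescaled_levy_path d (T : measurableType d) (V : R -> T -> R) (t : R)
    (w : T) : 0 < t ->
  cadlag `[0, +oo[%classic (V ^~ w) -> V 0 w = 0 ->
  {in `[0, 1], levy_path V t w =1 (rescaled V t w : skorohod R)}.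
Proof.
move=> t0 cV V0 x xI; rewrite /levy_path /increment V0 subr0 /rescaled /to_skorohod.
case: pselect => [fP|nf]; last by case: (nf (cadlag_rescale t0 cV)).
by rewrite /= patchE mem_setE xI.
Qed.

End continuous_functionals.

Section wiener.
Context {R : realType} {d : measure_display} {T : measurableType d}.
Variables (P : probability T R) (W : {mfun T >-> borel (skorohod R)}).
Hypothesis wW : standard_wiener P W.

Let B (t : R) (w : T) : R := (W w : skorohod R) t.

Lemma wiener_brownian : brownian P B.
Proof.
have [_ _ iB nB] := wW; split => //.
- move=> t t0 t1.
  have := measurableT_comp (measurable_evaluation t0 t1) (measurable_funPT W).
  exact.
Qed.

(** Cones are countable through their codes. The maximum of those among the first [n] codes that lie
    below [F] tends to [F] at every continuous path, by [cone_approximation], and dominated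
    convergence selects one [n]. *)
Lemma wiener_lower_cones (sigma : R) (F : skorohod R -> R) (M e : R) :
  continuous F -> (forall x, 0 <= F x) -> (forall x, F x <= M) -> 0 < e ->
  exists S, (forall y : skorohod R, cones_lim S y <= F y) /\
    \int[P]_w F (skorohod_scale sigma (W w)) - e <=
    \int[P]_w cones_lim S (brownian_path sigma B w).
Proof.
move=> cF F0 FM e0.
pose good (a : cone) := forall y : skorohod R, cones_lim [:: a] y <= F y.
pose A n : seq cone := [seq a <- pmap unpickle (iota 0 n) | `[< good a >]].
have Agood n y : cones_lim (A n) (y : skorohod R) <= F y.
  rewrite /A; elim: (pmap _ _) => [|a S IH] /=; first by rewrite cones_lim_nil.
  by case: ifP => [/asboolP ga|//]; apply: cones_lim_cons_le => //; exact: ga.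
pose X w : skorohod R := skorohod_scale sigma (W w).
have bX : {ae P, forall w, {in `[0, 1], brownian_path sigma B w =1 X w} /\
    {within `[0, 1], continuous (X w)}}.
  have [W0 cW _ _] := wW; apply: filterS2 W0 cW => w w0 cw; split.
    by move=> x xI; rewrite /brownian_path /increment /B w0 subr0.
  by move=> x; apply: cvgM; [exact: cvg_cst|exact: cw].
have mFX : measurable_fun setT (fun w => F (X w)).
  have := measurableT_comp (measurable_continuous_functional cF)
    (measurable_funPT (skorohod_scale sigma \o W : {mfun T >-> borel (skorohod R)})).
  exact.
have mA n : measurable_fun setT (fun w => cones_lim (A n) (brownian_path sigma B w)).
  apply: measurable_cones_lim => p.
  exact: (measurable_brownian_cones sigma wiener_brownian).
have cvgA : {ae P, forall w, cones_lim (A n) (brownian_path sigma B w)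
    @[n --> \oo] --> F (X w)}.
  apply: filterS bX => w [bXw cX]; apply/cvgrPdist_le => eps eps0.
  have [a [ga aX]] := cone_approximation eps0 cF F0 cX.
  exists (pickle a).+1 => // n /= an.
  rewrite (cones_lim_eq _ bXw) ger0_norm ?subr_ge0; last exact: Agood.
  have : cones_lim [:: a] (X w) <= cones_lim (A n) (X w).
    apply: cones_lim_mem; rewrite mem_filter; apply/andP; split; first exact/asboolP.
    rewrite mem_pmap; apply/mapP; exists (pickle a); first by rewrite mem_iota.
    by rewrite pickleK.
  by lra.
have M0 : 0 <= M by exact: le_trans (F0 (X point)) (FM _).
(* On the null set where [brownian_path] is not the path of [X], these values need not stay below
   [M]; truncation provides a dominating constant everywhere. *)
pose f n w := Num.min M (cones_lim (A n) (brownian_path sigma B w)).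
have cf : {ae P, forall w, f n w @[n --> \oo] --> F (X w)}.
  apply: filterS2 bX cvgA => w [bXw _] cw.
  rewrite (_ : (fun n => f n w) = fun n => cones_lim (A n) (brownian_path sigma B w))//.
  apply/funext => n; rewrite /f min_r// (cones_lim_eq _ bXw).
  exact: le_trans (Agood _ _) (FM _).
have : \int[P]_w f n w @[n --> \oo] --> \int[P]_w F (X w).
  apply: (@Rintegral_dominated_cvg_ae _ _ _ P _ _ (cst M)) => //.
  - by move=> n; apply: measurable_minr.
  - exact: finite_measure_integrable_cst.
  - move=> n w; rewrite ger0_norm ?ge_min ?lexx// le_min M0/=.
    exact: cones_lim_ge0.
move=> /cvgrPdist_le/(_ _ e0)[n _ /(_ n (leqnn n))] /= hn.
exists (A n); split; first exact: Agood.
have : \int[P]_w f n w <= \int[P]_w cones_lim (A n) (brownian_path sigma B w).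
  apply: le_Rintegral => //.
  - apply: (@bounded_meas_norm_le _ _ _ _ _ M); first exact: measurable_minr.
    move=> w; rewrite ger0_norm ?ge_min ?lexx// le_min M0/=.
    exact: cones_lim_ge0.
  - apply: (@bounded_meas_norm_le _ _ _ _ _ (cones_bound (A n))) => // w.
    exact: cones_lim_norm_le.
  - by move=> w _; rewrite /f ge_min lexx orbT.
move: hn; rewrite ler_norml -/X => /andP[h1 h2]; rewrite -/(X _); lra.
Qed.

End wiener.

Section log_average_integral.
Context {R : realType} {T : Type}.
Variables (V : R -> T -> R) (s : nat -> R).

Let L (n : nat) (w : T) (F : skorohod R -> R) : R :=
  (ln n%:R)^-1 * \sum_(k < n) F (rescaled V (s k.+1) w) / k.+1%:R.

Let integral_ge0 n w (F : skorohod R -> R) : (forall x, 0 <= F x) ->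
  measurable_fun setT (F : borel (skorohod R) -> R) ->
  (\int[log_average V s n w]_x (F x)%:E = (L n w F)%:E)%E.
Proof.
move=> F0 mF; have mE : measurable_fun setT (fun x : borel (skorohod R) => (F x)%:E).
  exact/measurable_EFinP.
rewrite /log_average ge0_integral_mscale//; last by move=> x _; rewrite lee_fin.
rewrite ge0_integral_measure_sum//; last by move=> x _; rewrite lee_fin.
rewrite /L EFinM -sumEFin; congr (_ * _)%E; apply: eq_bigr => k _.
rewrite ge0_integral_mscale//; last by move=> x _; rewrite lee_fin.
by rewrite integral_dirac// diracT mul1e -EFinM mulrC.
Qed.

Lemma integral_log_average n w (F : skorohod R -> R) :
  measurable_fun setT (F : borel (skorohod R) -> R) ->
  (\int[log_average V s n w]_x (F x)%:E =
   ((ln n%:R)^-1 * \sum_(k < n) F (rescaled V (s k.+1) w) / k.+1%:R)%:E)%E.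
Proof.
move=> mF; rewrite integralE.
have -> : ((fun x : borel (skorohod R) => (F x)%:E)^\+ =
    fun x => (Num.max (F x) 0)%:E)%E by apply/funext => x; rewrite funeposE EFin_max.
have -> : ((fun x : borel (skorohod R) => (F x)%:E)^\- =
    fun x => (Num.max (- F x) 0)%:E)%E by apply/funext => x; rewrite funenegE EFin_max.
rewrite (integral_ge0 n w (F := fun x => Num.max (F x) 0)); first last.
- exact: measurable_maxr.
- by move=> x; rewrite le_max lexx orbT.
rewrite (integral_ge0 n w (F := fun x => Num.max (- F x) 0)); first last.
- by apply: measurable_maxr => //; exact: measurable_funN.
- by move=> x; rewrite le_max lexx orbT.
rewrite -EFinB /L -mulrBr -sumrB; congr (_ * _)%:E; apply: eq_bigr => k _.
rewrite -mulrBl; congr (_ / _); move: (F _) => y.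
by case: (leP y 0) => y0; case: (leP (- y) 0) => ?; lra.
Qed.

End log_average_integral.

Section lower_bound.
Context {R : realType} {d d' : measure_display}.
Context {T : measurableType d} {T' : measurableType d'}.
Variables (P : probability T R) (V : R -> T -> R) (sigma : R).
Variables (P' : probability T' R) (W : {mfun T' >-> borel (skorohod R)}).
Hypothesis lV : square_integrable_levy P V sigma.
Hypothesis V_cadlag : {ae P, forall w, cadlag `[0, +oo[%classic (V ^~ w)}.
Hypothesis wW : standard_wiener P' W.
Variables (s : nat -> R) (beta : R).
Hypothesis s_gt0 : forall n, (1 <= n)%N -> 0 < s n.
Hypothesis beta_gt0 : 0 < beta.
Hypothesis s_increasing : forall m n, (1 <= m)%N -> (m <= n)%N ->
  s m / (m%:R `^ beta) <= s n / (n%:R `^ beta).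

Let average n w (F : skorohod R -> R) : R :=
  (ln n%:R)^-1 * \sum_(k < n) F (rescaled V (s k.+1) w) / k.+1%:R.

Let mean (F : skorohod R -> R) : R :=
  \int[P']_w F (skorohod_scale sigma (W w)).

(** The null set is that of the countably many families of cones; [F] comes afterwards and is served
    by one of these families. *)
Lemma lower_log_average : {ae P, forall w, forall (F : skorohod R -> R) M,
  continuous F -> (forall x, 0 <= F x) -> (forall x, F x <= M) ->
  forall e, 0 < e -> \forall n \near \oo, mean F - e <= average n w F}.
Proof.
have H := cones_lower_log_average lV (wiener_brownian wW) s_gt0 beta_gt0 s_increasing.
apply: filterS3 H V_cadlag (levy_start lV) => w H cV V0 F M cF F0 FM e e0.
have e20 : 0 < e / 2 by rewrite divr_gt0.
have [S [SF FS]] := wiener_lower_cones wW sigma cF F0 FM e20.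
apply: filterS (H S _ e20) => n hn.
apply: (@le_trans _ _ (\int[P']_w cones_lim S (brownian_path sigma
    (fun t w => (W w : skorohod R) t) w) - e / 2)).
  by rewrite /mean; lra.
apply: (le_trans hn); rewrite ler_wpM2l ?inv_ln_nat_ge0//.
apply: ler_sum => k _; rewrite ler_wpM2r ?invr_ge0//.
by rewrite (cones_lim_eq _ (rescaled_levy_path (s_gt0 (ltn0Sn k)) cV V0)).
Qed.

Lemma log_average_cvg : {ae P, forall w, forall (F : skorohod R -> R),
  continuous F -> (exists M, forall x, `|F x| <= M) ->
  average n w F @[n --> \oo] --> mean F}.
Proof.
apply: filterS lower_log_average => w H F cF [M FM].
have FM' x : - M <= F x <= M by rewrite -ler_norml.
have M0 : 0 <= M by exact: le_trans (normr_ge0 _) (FM point).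
have mF : measurable_fun setT (fun w => F (skorohod_scale sigma (W w))).
  have := measurableT_comp (measurable_continuous_functional cF)
    (measurable_funPT (skorohod_scale sigma \o W : {mfun T' >-> borel (skorohod R)})).
  exact.
have iF : P'.-integrable setT (EFin \o (fun w => F (skorohod_scale sigma (W w)))).
  exact: (@bounded_meas_norm_le _ _ _ _ _ M).
have iM : P'.-integrable setT (EFin \o cst M).
  exact: finite_measure_integrable_cst.
(* The weights add up to [harm n / ln n%:R] and not to 1, so constants are not reproduced exactly.
   The coefficient [c] is 1 for the lower bound and -1 for the upper one. *)
have harmE n w' (c : R) : average n w' (fun x => M + c * F x) =
    M * (harm n / ln n%:R) + c * average n w' F.
  rewrite /average /harm mulrC (mulrC _^-1) !mulrA -mulrDl; congr (_ / _).
  rewrite !mulr_sumr -big_split/=; apply: eq_bigr => k _; ring.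
have up := H (fun x => M + 1 * F x) (M + M) _ _ _.
have dn := H (fun x => M + (- 1) * F x) (M + M) _ _ _.
have mup : mean (fun x => M + 1 * F x) = M + mean F.
  rewrite /mean; under eq_Rintegral do rewrite mul1r.
  by rewrite (RintegralD measurableT iM iF) Rintegral_prob_cst.
have mdn : mean (fun x => M + (- 1) * F x) = M - mean F.
  rewrite /mean; under eq_Rintegral do rewrite mulN1r.
  by rewrite (RintegralB measurableT iM iF) Rintegral_prob_cst.
apply/cvgrPdist_le => e e0.
have e20 : 0 < e / 2 by rewrite divr_gt0.
have cup : continuous (fun x : skorohod R => M + 1 * F x).
  move=> x; have ca (a : R) : cst a y @[y --> (x : skorohod R)] --> a by exact: cst_continuous.
  exact: (cvgD (ca _) (cvgM (ca _) (cF x))).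
have cdn : continuous (fun x : skorohod R => M + (- 1) * F x).
  move=> x; have ca (a : R) : cst a y @[y --> (x : skorohod R)] --> a by exact: cst_continuous.
  exact: (cvgD (ca _) (cvgM (ca _) (cF x))).
have {up} [n1 _ up] := up cup (fun x => ltac:(have := FM' x; lra))
  (fun x => ltac:(have := FM' x; lra)) _ e20.
have {dn} [n2 _ dn] := dn cdn (fun x => ltac:(have := FM' x; lra))
  (fun x => ltac:(have := FM' x; lra)) _ e20.
(* The total weight is at most 1 + 1 / ln n; from here on [M / ln n%:R] is at most [e / 2]. *)
pose n3 := (Num.truncn (expR (2 * M / e))).+2.
exists (maxn (maxn n1 n2) n3) => // n /=; rewrite !geq_max.
move=> /andP[/andP[n1n n2n] n3n].
have := up n n1n; have := dn n n2n; rewrite /= !harmE mup mdn.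
have n2' : (1 < n)%N by exact: leq_trans n3n.
have nb : expR (2 * M / e) < n%:R.
  apply: (lt_le_trans (truncnS_gt _)); rewrite ler_nat.
  exact: leq_trans (leqnSn _) n3n.
have ln0 : 0 < ln n%:R :> R by rewrite ln_gt0// ltr1n.
have cl : 2 * M / e <= ln n%:R.
  by rewrite -(expRK (2 * M / e)) ler_ln ?posrE ?expR_gt0 ?ltr0n ?(ltnW n2')// ltW.
have hn : M * (harm n / ln n%:R) <= M + e / 2.
  rewrite mulrA ler_pdivrMr//.
  apply: (le_trans (ler_wpM2l M0 (harm_le (ltnW n2')))).
  have : M <= e / 2 * ln n%:R by move: cl; rewrite ler_pdivrMr//; lra.
  move: (ln _) => l; lra.
move=> h1 h2; rewrite ler_norml; move: hn h1 h2.
move: (M * _) (average n w F) (mean F) => x y z h1 h2 h3; apply/andP; split; lra.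
Qed.

End lower_bound.

Theorem theorem3 (R : realType)
    (d : measure_display) (Omega : measurableType d) (P : probability Omega R)
    (V : R -> Omega -> R) (sigma : R)
    (V_meas : forall t : R, 0 <= t -> measurable_fun setT (V t))
    (V_cadlag : {ae P, forall w, cadlag `[0, +oo[%classic (V ^~ w)})
    (V_centered : centered P V)
    (V_homogeneous : homogeneous P V)
    (V_independent : independent_increments P `[0, +oo[%classic V)
    (V0 : {ae P, forall w, V 0 w = 0})
    (sigma_ge0 : 0 <= sigma)
    (V1_variance : ('E_P[fun w => (V 1 w ^+ 2)%R] = (sigma ^+ 2)%:E)%E)
    (s : nat -> R) (beta : R)
    (s_gt0 : forall n, (1 <= n)%N -> 0 < s n)
    (beta_gt0 : 0 < beta)
    (s_increasing : forall m n, (1 <= m)%N -> (m <= n)%N ->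
      s m / (m%:R `^ beta) <= s n / (n%:R `^ beta))
    (d' : measure_display) (Omega' : measurableType d')
    (P' : probability Omega' R)
    (W : {mfun Omega' >-> borel (skorohod R)})
    (W_wiener : standard_wiener P' W) :
  {ae P, forall w,
    weak_cvg (fun n => log_average V s n w)
      (distribution P' (skorohod_scale sigma \o W))}.
Proof.
have lV : square_integrable_levy P V sigma by split.
have := log_average_cvg lV V_cadlag W_wiener s_gt0 beta_gt0 s_increasing.
apply: filterS => w Hw F cF bF; have [M FM] := bF.
have mF := measurable_continuous_functional cF.
have mFW : measurable_fun setT (fun w => F (skorohod_scale sigma (W w))).
  have := measurableT_comp mF
    (measurable_funPT (skorohod_scale sigma \o W : {mfun Omega' >-> borel (skorohod R)})).
  exact.
have iF : P'.-integrable setT (EFin \o (fun w => F (skorohod_scale sigma (W w)))).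
  exact: (@bounded_meas_norm_le _ _ _ _ _ M).
have -> : (\int[distribution P' (skorohod_scale sigma \o W)]_x (F x)%:E =
    (\int[P']_w F (skorohod_scale sigma (W w)))%:E)%E.
  rewrite integral_distribution//; last exact/measurable_EFinP.
  by rewrite /Rintegral fineK//; exact: integrable_fin_num.
rewrite (_ : (fun n => _) = fun n => ((ln n%:R)^-1 *
    \sum_(k < n) F (rescaled V (s k.+1) w) / k.+1%:R)%:E); last first.
  by apply/funext => n; exact: integral_log_average.
by apply: cvg_EFin; [exact: nearW|exact: Hw].
Qed.
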